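(* Let $(X,d,m)$ be a strong $CD(K,\infty)$ space, let $f_0,f_1$ be probability densities with respect to $m$, and let $\varphi$ be any Kantorovich potential for the couple $(f_0m,f_1m)$. Then for every $\pi\in\mathrm{GeoOpt}(f_0m,f_1m)$, \[ d(\gamma_0,\gamma_1)=|D\varphi|_w(\gamma_0)=|D^+\varphi|(\gamma_0)\qquad\text{for }\pi\text{-a.e. }\gamma, \] and $W_2^2(f_0m,f_1m)=\int_X|D\varphi|_*^2f_0\,dm$. If moreover $f_0,f_1\in L^\infty(X,m)$ and $\pi\in\mathrm{GeoOpt}(f_0m,f_1m)$ is a test plan, then \[ \lim_{t\downarrow0}\frac{\varphi(\gamma_0)-\varphi(\gamma_t)}{d(\gamma_0,\gamma_t)}=|D^+\varphi|(\gamma_0)\qquad\text{in }L^2(\mathrm{Geo}(X),\pi). \]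
   Context: $(X,d)$ compact, $m$ a Borel probability measure. $W_2$: quadratic Wasserstein distance. $c$-transform: $\psi^c(y):=\inf_{x}\big(\frac{d^2(x,y)}2-\psi(x)\big)$; $\psi$ is $c$-concave if $\psi=\phi^c$ for some $\phi$. A Kantorovich potential for $(\mu,\nu)$ is a $c$-concave (hence Lipschitz) $\psi$ attaining the supremum in $\frac12W_2^2(\mu,\nu)=\sup_\psi\int\psi\,d\mu+\int\psi^c\,d\nu$. Ascending slope: $|D^+\varphi|(x):=\limsup_{y\to x}[\varphi(y)-\varphi(x)]^+/d(y,x)$. $\mathrm{Geo}(X)$: constant speed geodesics $\gamma:[0,1]\to X$; $e_t(\gamma)=\gamma_t$; $\mathrm{GeoOpt}(\mu_0,\mu_1)$: Borel probability measures on $C([0,1],X)$ concentrated on $\mathrm{Geo}(X)$ with $(e_0,e_1)_\sharp\pi$ optimal for $W_2(\mu_0,\mu_1)$. Strong $CD(K,\infty)$: for all $\mu_0,\mu_1$ of finite entropy $\mathrm{Ent}_m$ ($\mathrm{Ent}_m(\rho m)=\int\rho\log\rho\,dm$, $+\infty$ for non-absolutely continuous measures) there is $\pi\in\mathrm{GeoOpt}(\mu_0,\mu_1)$ such that for every bounded Borel $F\ge0$ on $\mathrm{Geo}(X)$ with $\int F d\pi=1$, $\mu_t^F:=(e_t)_\sharp(F\pi)$ satisfies $\mathrm{Ent}_m(\mu^F_t)\le(1-t)\mathrm{Ent}_m(\mu^F_0)+t\mathrm{Ent}_m(\mu^F_1)-\frac K2t(1-t)W_2^2(\mu^F_0,\mu^F_1)$.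 Test plans: probability measures $\pi$ on $C([0,1],X)$ concentrated on absolutely continuous curves with $\iint_0^1|\dot\gamma_t|^2dt\,d\pi<\infty$ and $(e_t)_\sharp\pi\le C(\pi)m$ for all $t$; negligible sets of curves are those null for every test plan. $|D\varphi|_w$: minimal weak upper gradient, i.e. the $m$-a.e. smallest Borel $g\ge0$ with $|\varphi(\gamma_1)-\varphi(\gamma_0)|\le\int_0^1g(\gamma_s)|\dot\gamma_s|ds$ for all curves outside a negligible set. $|D\varphi|_*$: minimal relaxed slope, the $L^2$-smallest $G$ for which there are Lipschitz $\varphi_n\to\varphi$ in $L^2(m)$ with $|D\varphi_n|$ converging weakly in $L^2$ to some $\tilde G\le G$, where $|Dg|(x):=\limsup_{y\to x}|g(y)-g(x)|/d(y,x)$. *)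

(* Defs.v *)
From HB Require Import structures.
From mathcomp Require Import all_boot all_order all_algebra.
From mathcomp Require Import all_classical all_reals all_analysis measurable_realfun.
Set Implicit Arguments. Unset Strict Implicit. Unset Printing Implicit Defensive.
Import Order.TTheory GRing.Theory Num.Theory.
Import numFieldNormedType.Exports.
Local Open Scope classical_set_scope.
Local Open Scope ring_scope.

(* metric spaces with a chosen point (needed to build the Borel measurable type) *)
#[short(type="pmetricType")]
HB.structure Definition PointedMetric (K : numDomainType) :=
  { M of Pointed M & Metric K M }.

Section defs.
Context {R : realType} {X : pmetricType R}.
Local Notation d := (@mdist R X).

Definition BX := g_sigma_algebraType (@open X).

(* curves: functions R -> X, only their values on [0,1] matter *)
Definition curve := R -> X.
Definition supdist (g h : curve) : R := sup [set d (g t) (h t) | t in `[0, 1]].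
Definition curve_open : set (set curve) :=
  [set U | forall g, U g -> exists2 e, 0 < e & forall h, supdist g h < e -> U h].
(* C([0,1],X) with the Borel sigma-algebra of the sup distance *)
Definition Curves := g_sigma_algebraType curve_open.
Definition ev (t : R) (g : Curves) : BX := (g : curve) t.


Definition coupling (mu nu : set BX -> \bar R) (P : probability (BX * BX)%type R) :=
  forall A : set BX, measurable A ->
    P (A `*` setT) = mu A /\ P (setT `*` A) = nu A.

Definition W2sq (mu nu : set BX -> \bar R) : \bar R :=
  ereal_inf [set (\int[P]_z ((d z.1 z.2) ^+ 2)%:E)%E | P in coupling mu nu].

Definition ctrans (phi : X -> R) (y : X) : R :=
  inf [set (d x y) ^+ 2 / 2 - phi x | x in [set: X]].

(* c-concavity: psi = phi^c for some phi with phi^c real valued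
   (on compact X this is equivalent to phi bounded above) *)
Definition c_concave (psi : X -> R) :=
  exists phi : X -> R, (exists M, forall x, phi x <= M) /\ psi = ctrans phi.

Definition kantorovich_potential (mu nu : probability BX R) (psi : X -> R) :=
  c_concave psi /\
  (\int[mu]_x (psi x)%:E + \int[nu]_x (ctrans psi x)%:E = 2^-1%:E * W2sq mu nu)%E.

Definition geodesic (g : curve) :=
  forall s t, 0 <= s <= 1 -> 0 <= t <= 1 ->
    d (g s) (g t) = `|t - s| * d (g 0) (g 1).

Definition concentrated dT (T : measurableType dT) (P : set T -> \bar R) (S : set T) :=
  exists A, [/\ measurable A, A `<=` S & P A = 1%E].

(* GeoOpt(mu0, mu1): concentrated on Geo(X), and (e0,e1)_# P is an optimal
   coupling of mu0, mu1 (marginal conditions written out, and its cost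
   \int d^2 d((e0,e1)_# P) = \int d^2(g0,g1) dP equal to W_2^2) *)
Definition GeoOpt (mu0 mu1 : set BX -> \bar R) (P : probability Curves R) :=
  [/\ concentrated P (geodesic : set Curves),
      (forall A : set BX, measurable A ->
         P (ev 0 @^-1` A) = mu0 A /\ P (ev 1 @^-1` A) = mu1 A) &
      (\int[P]_g ((d (ev 0 g) (ev 1 g)) ^+ 2)%:E = W2sq mu0 mu1)%E].

Definition density_of (m : probability BX R) (mu : set BX -> \bar R) (rho : X -> R) :=
  [/\ measurable_fun setT (rho : BX -> R), (forall x, 0 <= rho x) &
      forall A : set BX, measurable A -> mu A = (\int[m]_(x in A) (rho x)%:E)%E].

(* relative entropy: \int rho log rho dm if mu = rho m, +oo if mu is not
   absolutely continuous (no density); ln 0 = 0 so 0 log 0 = 0 *)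
Definition Ent (m : probability BX R) (mu : set BX -> \bar R) : \bar R :=
  ereal_inf [set (\int[m]_x (rho x * ln (rho x))%:E)%E | rho in density_of m mu].

Definition muF (P : probability Curves R) (F : Curves -> R) (t : R) : set BX -> \bar R :=
  fun A => (\int[P]_(g in ev t @^-1` A) (F g)%:E)%E.

Definition strongCD (m : probability BX R) (K : R) :=
  forall mu0 mu1 : probability BX R,
    Ent m mu0 \is a fin_num -> Ent m mu1 \is a fin_num ->
    exists2 P : probability Curves R, GeoOpt mu0 mu1 P &
      forall F : Curves -> R, measurable_fun setT F -> (forall g, 0 <= F g) ->
        (exists M, forall g, F g <= M) -> (\int[P]_g (F g)%:E = 1)%E ->
        forall t, 0 <= t <= 1 ->
          (Ent m (muF P F t) <= (1 - t)%:E * Ent m (muF P F 0) + t%:E * Ent m (muF P F 1)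
             - (K / 2 * t * (1 - t))%:E * W2sq (muF P F 0) (muF P F 1))%E.

Definition mder (g : curve) (t : R) : \bar R :=
  ereal_inf [set ereal_sup [set (d (g (t + h)) (g t) / `|h|)%:E
                           | h in [set h | 0 < `|h| < r /\ 0 <= t + h <= 1]]
            | r in [set r : R | 0 < r]].

Definition abs_cont (g : curve) :=
  exists f : R -> R, (lebesgue_measure : set R -> \bar R).-integrable `[0, 1] (EFin \o f) /\
    forall s t, 0 <= s -> s <= t -> t <= 1 ->
      ((d (g s) (g t))%:E <= \int[lebesgue_measure]_(u in `[s, t]) (f u)%:E)%E.

Definition test_plan (m : probability BX R) (P : probability Curves R) :=
  [/\ concentrated P (abs_cont : set Curves),
      (\int[P]_g (\int[lebesgue_measure]_(t in `[0%R, 1%R]) (mder g t * mder g t)) < +oo)%E &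
      exists C : R, forall t, 0 <= t <= 1 -> forall A : set BX, measurable A ->
        (P (ev t @^-1` A) <= C%:E * m A)%E].

Definition negligible_curves (m : probability BX R) (N : set Curves) :=
  forall P, test_plan m P -> P.-negligible N.

Definition weak_ug (m : probability BX R) (phi : X -> R) (G : X -> \bar R) :=
  [/\ measurable_fun setT (G : BX -> \bar R), (forall x, (0 <= G x)%E) &
      negligible_curves m
        [set g : Curves | ~ ((`|phi ((g : curve) 1) - phi ((g : curve) 0)|)%:E <=
            \int[lebesgue_measure]_(s in `[0%R, 1%R]) (G ((g : curve) s) * mder g s))%E]].

Definition min_weak_ug (m : probability BX R) (phi : X -> R) (G : X -> \bar R) :=
  weak_ug m phi G /\
  forall G', weak_ug m phi G' -> {ae m, forall x : BX, (G x <= G' x)%E}.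

(* local Lipschitz constant |Dg|(x) = limsup_{y -> x} |g(y)-g(x)|/d(y,x)
   (0 at isolated points) *)
Definition lip_const (f : X -> R) (x : X) : \bar R :=
  ereal_inf [set ereal_sup ([set 0%E] `|`
      [set (`|f y - f x| / d y x)%:E | y in [set y | 0 < d y x < r]])
    | r in [set r : R | 0 < r]].

(* ascending slope |D^+ f|(x) = limsup_{y -> x} [f(y)-f(x)]^+/d(y,x)
   (0 at isolated points) *)
Definition asc_slope (f : X -> R) (x : X) : \bar R :=
  ereal_inf [set ereal_sup ([set 0%E] `|`
      [set (Num.max (f y - f x) 0 / d y x)%:E | y in [set y | 0 < d y x < r]])
    | r in [set r : R | 0 < r]].

Definition lipschitz (f : X -> R) := exists L : R, forall x y, `|f x - f y| <= L * d x y.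

Definition L2 (m : probability BX R) (h : X -> R) :=
  measurable_fun setT (h : BX -> R) /\ (\int[m]_x ((h x) ^+ 2)%:E < +oo)%E.

Definition weakL2_cvg (m : probability BX R) (hn : nat -> X -> R) (h : X -> R) :=
  forall v, L2 m v ->
    (fun n => \int[m]_x (hn n x * v x)%:E)%E @ \oo --> (\int[m]_x (h x * v x)%:E)%E.

Definition relaxed_slope (m : probability BX R) (phi : X -> R) (G : X -> R) :=
  L2 m G /\
  exists (Gt : X -> R) (phin : nat -> X -> R),
    [/\ L2 m Gt, {ae m, forall x : BX, Gt x <= G x},
        (forall n, lipschitz (phin n)),
        (fun n => \int[m]_x ((phin n x - phi x) ^+ 2)%:E)%E @ \oo --> 0%E &
        weakL2_cvg m (fun n x => fine (lip_const (phin n) x)) Gt].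

Definition min_relaxed_slope (m : probability BX R) (phi : X -> R) (G : X -> R) :=
  relaxed_slope m phi G /\
  forall G', relaxed_slope m phi G' ->
    (\int[m]_x ((G x) ^+ 2)%:E <= \int[m]_x ((G' x) ^+ 2)%:E)%E.

Definition prob_density (m : probability BX R) (f : X -> R) :=
  [/\ measurable_fun setT (f : BX -> R), (forall x, 0 <= f x) &
      (\int[m]_x (f x)%:E = 1)%E].

Definition Linf (m : probability BX R) (f : X -> R) :=
  exists C : R, {ae m, forall x : BX, `|f x| <= C}.
End defs.

(* Main.v *)
(* Let [S] be the ascending slope of the potential [phi], let [W] be the squared
   distance, and call [d^2(x,z)/2 - phi(x) - phi^c(z) >= 0] the defect of [(x, z)].
   If the defect of [(x, z)] vanishes, then [S x <= d(x, z)]; a quantitative version of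
   this along almost optimal couplings gives [\int S^2 dmu0 <= W].

   For the converse, restrict an almost optimal coupling to the set where both
   densities are bounded.  The strong CD condition joins the marginals by a geodesic
   plan all of whose marginals are at most [C m].  Along a geodesic of such a plan [phi]
   drops by at least [d^2 (t - t^2/2)] up to the defect, while an upper gradient [G]
   bounds the drop by [t] times the average of [G d] over the geodesic up to time [t].
   Letting first the defect and then [t] tend to 0 gives [W <= \int G^2 dmu0].

   This applies to [S], to the minimal weak upper gradient and to the minimal relaxed
   slope.  The last two are at most [S], so all the inequalities are equalities, and the
   equality cases give the first two claims.  That [S] is a weak upper gradient follows
   from a one-sided fundamental theorem of calculus.  To compare [S] with the minimal
   relaxed slope, cover [{S < a}] by countably many closed sets on which [phi] is
   [a]-Lipschitz; near each of them [phi] is uniformly close to a Lipschitz function of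
   slope at most [a], which can be glued into any relaxing sequence.

   For the last claim, the difference quotient is at least [d (1 - t/2)] and its square
   is at most the average of [S^2] over the geodesic up to time [t], whose integral
   tends to [\int S^2 dmu0 = W]. *)
Require Import Defs.
From HB Require Import structures.
From mathcomp Require Import all_boot all_order all_algebra.
From mathcomp Require Import finmap.
From mathcomp Require Import all_classical all_reals all_analysis measurable_realfun.
From mathcomp Require Import ring lra.
Import Order.TTheory GRing.Theory Num.Theory.
Import numFieldNormedType.Exports.
Import HBNNSimple.
Set Implicit Arguments. Unset Strict Implicit. Unset Printing Implicit Defensive.
Local Open Scope classical_set_scope.
Local Open Scope ring_scope.

(** * Measures and compact metric spaces *)

(** No optimal coupling of [mu0] and [mu1] is at hand: [W2sq] is an infimum, and the strong CD
    condition speaks only of measures of finite entropy. Both inequalities therefore run through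
    almost optimal couplings and the integral of the defect, which by duality is half the excess of
    the cost over [W2sq]. The squares come from Young's inequality: the drop of [phi] is at least
    about [t d^2] and at most [t] times the mean of [G d], hence at most [t / 2] times the sum of
    the means of [G^2] and [d^2]; half of the cost is absorbed and [W <= \int G^2] remains. The
    three gradients enter only through [plan_upper_gradient], an integrated inequality for geodesic
    plans with marginals below [C m], which does not see [m]-null sets. For the relaxed slope,
    gluing produces functions whose slopes are dominated by a weakly convergent sequence but need
    not converge themselves. A convergent subsequence is extracted by taking an ultrafilter limit of
    their integrals over sets, which is a measure with a density. *)

Section measure_tools.
Context d (T : measurableType d) (R : realType).
Implicit Types (mu : {measure set T -> \bar R}) (D : set T).
Local Open Scope ereal_scope.

(** The integral of a nonnegative function is a supremum over the simple functions below it, so it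
    is monotone for arbitrary functions. This serves integrands such as those containing [mder]. *)
Lemma ge0_le_lower_integral mu D (f g : T -> \bar R) :
  (forall x, D x -> 0 <= f x) -> (forall x, D x -> f x <= g x) ->
  \int[mu]_(x in D) f x <= \int[mu]_(x in D) g x.
Proof.
move=> f0 fg; have g0 x : D x -> 0 <= g x.
  by move=> Dx; exact: le_trans (f0 _ Dx) (fg _ Dx).
rewrite !ge0_integralE//; apply: le_ereal_sup => _ [h hf <-]; exists h => // x.
apply: (le_trans (hf x)); rewrite /patch; case: ifPn => //; rewrite inE; exact: fg.
Qed.

(** Each simple function below [f] is measurable and lies below [g] almost everywhere; the usual
    comparison applies to it, and then the supremum is taken. *)
Lemma ge0_lower_integral_le mu (N : set T) (f g : T -> \bar R) :
  measurable N -> mu N = 0 -> measurable_fun setT g ->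
  (forall x, 0 <= f x) -> (forall x, 0 <= g x) ->
  (forall x, ~ N x -> f x <= g x) -> \int[mu]_x f x <= \int[mu]_x g x.
Proof.
move=> mN N0 mg f0 g0 fg.
rewrite [leLHS]ge0_integralTE//; apply: ge_ereal_sup => _ [h /= hf <-].
rewrite -integralT_nnsfun; apply: ae_ge0_le_integral => //.
- by move=> x _; rewrite lee_fin; exact: fun_ge0.
- by apply/measurable_EFinP; exact: measurable_funPT.
- exists N; split => // x /= /not_implyP[_ hx].
  by apply: contrapT => Nx; apply: hx; apply: le_trans (hf x) _; exact: fg.
Qed.

Lemma bounded_integrable (P : {finite_measure set T -> \bar R}) (f : T -> R) M :
  measurable_fun setT f -> (forall x, (`|f x| <= M)%R) ->
  P.-integrable setT (EFin \o f).
Proof.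
move=> mf fM; apply: measurable_bounded_integrable => //.
- by rewrite -ge0_fin_numE//; exact: fin_num_measure.
- exists M; split; first exact: num_real.
  by move=> x Mx y _; exact: le_trans (fM y) (ltW Mx).
Qed.

Lemma ae_of_full_measure (P : probability T R) (A : set T) :
  measurable A -> P A = 1 -> {ae P, forall x, A x}.
Proof.
move=> mA A1; exists (~` A); split=> //; first exact: measurableC.
by rewrite probability_setC// A1 subee.
Qed.

Lemma ge0_integral_eq0_ae mu (f : T -> R) :
  measurable_fun setT f -> (forall x, (0 <= f x)%R) ->
  \int[mu]_x (f x)%:E = 0 -> {ae mu, forall x, f x = 0%R}.
Proof.
move=> mf f0 If.
have mF : measurable_fun setT (EFin \o f) by exact/measurable_EFinP.
have I0 : \int[mu]_x `|(f x)%:E| = 0.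
  by rewrite -If; apply: eq_integral => x _; rewrite gee0_abs// lee_fin.
have := (ae_eq_integral_abs mu measurableT mF).1 I0.
by apply: filterS => x /(_ Logic.I) /= [].
Qed.

Lemma measurable_fun_gt (f : T -> R) :
  (forall a, measurable [set x | (a < f x)%R]) -> measurable_fun setT f.
Proof.
move=> H; apply: (measurability _ (RGenOInfty.measurableE R)) => //.
move=> _ [_ [a ->] <-]; rewrite setTI.
have -> // : f @^-1` `]a, +oo[ = [set x | (a < f x)%R].
by apply/seteqP; split => x /=; rewrite in_itv /= andbT.
Qed.

Lemma measurable_fun_lt (f : T -> R) :
  (forall a, measurable [set x | (f x < a)%R]) -> measurable_fun setT f.
Proof.
move=> H; have -> : f = (fun x => - (- f x))%R.
  by apply/funext => x; rewrite opprK.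
apply: measurableT_comp => //; apply: measurable_fun_gt => a.
have -> // : [set x | (a < - f x)%R] = [set x | (f x < - a)%R].
by apply/seteqP; split => x /=; rewrite ltrNr.
Qed.

Lemma measurable_set_lt (f : T -> R) a :
  measurable_fun setT f -> measurable [set x | (f x < a)%R].
Proof.
move=> mf; rewrite (_ : [set _ | _] = f @^-1` `]-oo, a[); last first.
  by apply/seteqP; split => x /=; rewrite in_itv.
by rewrite -[X in measurable X]setTI; exact: mf.
Qed.

Lemma measurable_set_le (f : T -> R) a :
  measurable_fun setT f -> measurable [set x | (f x <= a)%R].
Proof.
move=> mf; rewrite (_ : [set _ | _] = f @^-1` `]-oo, a]); last first.
  by apply/seteqP; split => x /=; rewrite in_itv.
by rewrite -[X in measurable X]setTI; exact: mf.
Qed.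

Lemma emeasurable_fun_gt (f : T -> \bar R) :
  (forall a : R, measurable [set x | a%:E < f x]) -> measurable_fun setT f.
Proof.
move=> H; apply: (measurability _ (ErealGenOInfty.measurableE R)) => //.
move=> _ [_ [a ->] <-]; rewrite setTI.
have -> // : f @^-1` `]a%:E, +oo[ = [set x | a%:E < f x].
by apply/seteqP; split => x /=; rewrite in_itv /= andbT.
Qed.

End measure_tools.

(** * The Borel structure of a compact metric space *)

Section metric.
Context {R : realType} {X : pmetricType R}.
Local Notation d := (@mdist R X).
Local Notation BX := (@BX R X).
Local Notation Curves := (@Curves R X).
Hypothesis cX : compact [set: X].

Lemma ballE (x : X) r : ball x r = [set y | d x y < r].
Proof. exact: ballEmdist. Qed.

Lemma open_mdistP (U : set X) : open U <-> (forall x, U x -> exists2 e, 0 < e &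
  forall y, d x y < e -> U y).
Proof.
rewrite openE; split => [oU x /oU|H x /H [e e0 eU]].
  move=> /nbhs_ballP[e /= e0]; rewrite ballE => eU; exists e => //.
by apply/nbhs_ballP; exists e => //=; rewrite ballE.
Qed.

Lemma open_mball (x : X) r : open [set y | d x y < r].
Proof.
apply/open_mdistP => y /= xy; exists (r - d x y); first by rewrite subr_gt0.
by move=> z; rewrite ltrBrDl; apply: le_lt_trans; exact: metric_triangle.
Qed.

Lemma mdist_bounded : exists2 D : R, 0 < D & forall x y, d x y <= D.
Proof.
have := cX; rewrite compact_cover.
move=> /(_ nat setT (fun n => [set y : X | d point y < n%:R])).
case.
- by move=> n _; exact: open_mball.
- move=> x _; have [n dn] : exists n, d point x < n%:R.
    by exists (Num.truncn (d point x)).+1; rewrite truncnS_gt.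
  by exists n.
(* The sum of the indices of the finite subcover is a crude bound for the largest radius in it. *)
move=> S _ XS; exists (2 * (\sum_(i <- S) i)%:R + 1) => [|x y].
  by rewrite ltr_wpDl.
have H z : d point z <= (\sum_(i <- S) i)%:R.
  have [n nS /ltW] := XS z Logic.I; move=> /le_trans; apply.
  by rewrite ler_nat (big_rem n)//= leq_addr.
have := metric_triangle x point y; have := metric_sym x point.
have := H x; have := H y.
by move=> ? ? -> ?; lra.
Qed.

Lemma measurable_open (U : set X) : open U -> measurable (U : set BX).
Proof. by move=> oU; exact: sub_sigma_algebra. Qed.

Lemma measurable_curve_open (U : set (@curve R X)) :
  curve_open U -> measurable (U : set Curves).
Proof. by move=> oU; exact: sub_sigma_algebra. Qed.

Lemma measurable_fun_BX d' (T : measurableType d') (f : T -> X) :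
  (forall U : set X, open U -> measurable (f @^-1` U)) ->
  measurable_fun setT (f : T -> BX).
Proof.
move=> H; apply: (@measurability _ _ T BX setT f (@open X)) => //.
by move=> _ [U oU <-]; rewrite setTI; exact: H.
Qed.

Lemma lipschitz_gt0 (f : X -> R) : Defs.lipschitz f ->
  exists2 L, 0 < L & forall x y, `|f x - f y| <= L * d x y.
Proof.
move=> [L fL]; exists (`|L| + 1) => [|x y]; first by rewrite ltr_wpDl.
apply: (le_trans (fL x y)); apply: ler_wpM2r; first exact: mdist_ge0.
by rewrite (le_trans (ler_norm _))// lerDl.
Qed.

Lemma lipschitz_open_preimage (f : X -> R) (a : R) : Defs.lipschitz f ->
  open [set x | a < f x].
Proof.
move=> /lipschitz_gt0[L L0 fL]; apply/open_mdistP => x /= ax.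
exists ((f x - a) / L); first by rewrite divr_gt0// subr_gt0.
move=> y; rewrite ltr_pdivlMr// => xy.
have := fL x y; have := ler_norm (f x - f y).
by rewrite mulrC => ? ?; lra.
Qed.

Lemma measurable_fun_lipschitz (f : X -> R) : Defs.lipschitz f ->
  measurable_fun setT (f : BX -> R).
Proof.
move=> lf; apply: (measurability _ (RGenOInfty.measurableE R)) => //.
move=> _ [_ [a ->] <-]; rewrite setTI; apply: measurable_open.
have -> : f @^-1` `]a, +oo[ = [set x | a < f x].
  by apply/seteqP; split => x /=; rewrite in_itv /= andbT.
exact: lipschitz_open_preimage.
Qed.

Lemma lipschitz_bounded (f : X -> R) : Defs.lipschitz f -> exists M, forall x, `|f x| <= M.
Proof.
move=> /lipschitz_gt0[L L0 fL]; have [D D0 dD] := mdist_bounded.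
exists (`|f point| + L * D) => x.
have -> : f x = f point + (f x - f point) by rewrite addrC subrK.
apply: (le_trans (ler_normD _ _)); rewrite lerD2l (le_trans (fL _ _))//.
by rewrite ler_pM2l.
Qed.

Lemma lipschitz_mdist (x : X) : Defs.lipschitz (d x).
Proof.
exists 1 => y z; rewrite mul1r ler_distl.
have := metric_triangle x z y; have := metric_triangle x y z.
by rewrite (metric_sym z y) => *; apply/andP; split; lra.
Qed.

(** For each [n] compactness gives a finite net at scale [1 / (n + 1)]. The sequence runs through
    the pairs (level, position in the net), decoded from natural numbers; codes without meaning give
    [point]. *)
Lemma dense_sequence :
  exists p : nat -> X, forall x e, 0 < e -> exists n, d (p n) x < e.
Proof.
have H n : exists S : {fset X}, forall x, exists2 y, y \in S & d y x < n.+1%:R^-1.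
  have := cX; rewrite compact_cover.
  move=> /(_ X setT (fun y => [set x : X | d y x < n.+1%:R^-1])).
  case=> [y _|x _|S _ XS].
  - exact: open_mball.
  - by exists x => //=; rewrite mdistxx.
  - by exists S => x; have [y yS] := XS x Logic.I; exists y.
have [S HS] := choice H.
exists (fun k => if @choice.unpickle (nat * nat)%type k is Some u
  then nth point (enum_fset (S u.1)) u.2 else point).
move=> x e e0; have [n /= ne] := @ltr_add_invr R 0 e e0.
have [y yS yx] := HS n x.
exists (choice.pickle (n, index y (enum_fset (S n)))); rewrite choice.pickleK/= nth_index//.
by apply: lt_trans yx _; rewrite add0r in ne.
Qed.

(** Measurability is for the product sigma-algebra. The distance is the infimum over a dense
    sequence of [d (p n) x + d (p n) y], and each of these is a sum of functions of one variable. *)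
Lemma measurable_fun_mdist : measurable_fun setT (fun z : BX * BX => d z.1 z.2).
Proof.
have [p Hp] := dense_sequence.
have mp n : measurable_fun setT (d (p n) : BX -> R).
  by apply: measurable_fun_lipschitz; exact: lipschitz_mdist.
have -> : (fun z : BX * BX => d z.1 z.2) =
    (fun z : BX * BX => inf (range (fun n => d (p n) z.1 + d (p n) z.2))).
  apply/funext => -[x y] /=; apply/eqP; rewrite eq_le; apply/andP; split.
    apply: lb_le_inf; first by exists (d (p 0%N) x + d (p 0%N) y), 0%N.
    move=> _ [n _ <-]; rewrite [in leRHS]metric_sym; exact: metric_triangle.
  apply/ler_addgt0Pr => e e0; have [n ne] := Hp x (e / 2) (divr_gt0 e0 (ltr0Sn _ 1)).
  have /le_trans -> // : inf (range (fun n => d (p n) x + d (p n) y)) <=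
     d (p n) x + d (p n) y.
    apply: ge_inf; last by exists n.
    by exists 0 => _ [k _ <-]; rewrite addr_ge0// mdist_ge0.
  have := metric_triangle (p n) x y; have := metric_sym x (p n); lra.
apply: measurable_fun_lt => a.
rewrite (_ : [set _ | _] = \bigcup_n [set z : BX * BX | d (p n) z.1 + d (p n) z.2 < a]).
  apply: bigcupT_measurable => n.
  apply: (@measurable_set_lt _ _ _ (fun z : BX * BX => d (p n) z.1 + d (p n) z.2)).
  by apply: measurable_funD; apply: measurableT_comp => //; exact: mp.
apply/seteqP; split => [z /= zlt|z [n _ /= na]].
  have [|_ [n _ <-] ?] := inf_lt _ zlt; last by exists n.
  by exists (d (p 0%N) z.1 + d (p 0%N) z.2), 0%N.
apply: le_lt_trans na; apply: ge_inf; last by exists n.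
by exists 0 => _ [k _ <-]; rewrite addr_ge0// mdist_ge0.
Qed.

End metric.

(** * Curves and potentials *)

Section lebesgue_display.
Context {R : realType}.

(* [lebesgue_measure] lives on [measurableTypeR R], which has the same measurable
   sets as [R] but another display; [Defs.abs_cont] uses integrability over [R]. *)
Let idR : measurableTypeR R -> R := id.

Lemma integrable_lebesgueP (D : set R) (f : R -> \bar R) :
  measurable D ->
  (lebesgue_measure : set R -> \bar R).-integrable D f <->
  (@lebesgue_measure R).-integrable D f.
Proof.
move=> mD; have mid : measurable_fun setT idR by move=> _ A mA; rewrite setTI.
have H g : measurable_fun D g -> (forall x, 0 <= g x)%E ->
    (@integral default_measure_display R R (lebesgue_measure : set R -> \bar R) D g =
    \int[lebesgue_measure]_(x in D) g x)%E.
  move=> mg g0.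
  by rewrite -[RHS](@ge0_integral_pushforward _ _ _ _ _ idR mid (@lebesgue_measure R) D g).
split => /integrableP[mf fi]; apply/integrableP; split => //.
- by rewrite -H//; exact: measurableT_comp.
- by rewrite H//; exact: measurableT_comp.
Qed.

End lebesgue_display.

(** * Geodesics, restriction of curves and metric derivatives *)

Section curves.
Context {R : realType} {X : pmetricType R}.
Local Notation d := (@mdist R X).
Local Notation BX := (@BX R X).
Local Notation Curves := (@Curves R X).
Local Notation curve := (@curve R X).
Hypothesis cX : compact [set: X].

Lemma mdist_le_supdist t (g h : curve) : 0 <= t <= 1 -> d (g t) (h t) <= supdist g h.
Proof.
move=> t01; apply: ub_le_sup; last by exists t => //=; rewrite in_itv.
by have [D D0 dD] := mdist_bounded cX; exists D => _ [s _ <-]; exact: dD.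
Qed.

Lemma supdist_le (g h : curve) (c : R) :
  (forall t, 0 <= t <= 1 -> d (g t) (h t) <= c) -> supdist g h <= c.
Proof.
move=> H; apply: ge_sup; first by exists (d (g 0) (h 0)), 0 => //=; rewrite in_itv/= lexx ler01.
by move=> _ [t t01 <-]; apply: H; move: t01; rewrite /= in_itv.
Qed.

Lemma measurable_fun_Curves d' (T : measurableType d') (f : T -> Curves) :
  (forall U : set curve, curve_open U -> measurable (f @^-1` U)) ->
  measurable_fun setT f.
Proof.
move=> H; apply: (@measurability _ _ T Curves setT f (@curve_open R X)) => //.
by move=> _ [U oU <-]; rewrite setTI; exact: H.
Qed.

Lemma measurable_ev t : 0 <= t <= 1 -> measurable_fun setT (ev t : Curves -> BX).
Proof.
move=> t01; apply: measurable_fun_BX => U /open_mdistP oU.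
apply: measurable_curve_open => g /= /oU[e e0 eU]; exists e => // h gh.
by apply: eU; apply: le_lt_trans gh; exact: mdist_le_supdist.
Qed.

(** The complement is open for the sup distance: an equation between distances that fails still
    fails after a uniformly small perturbation of the curve. *)
Lemma measurable_geodesic : measurable (geodesic : set Curves).
Proof.
rewrite -[X in measurable X]setCK; apply: measurableC; apply: measurable_curve_open.
move=> g /= /existsNP[s] /existsNP[t] /not_implyP[s01] /not_implyP[t01] /eqP gst.
pose u := d (g s) (g t) - `|t - s| * d (g 0) (g 1).
have u0 : 0 < `|u| by rewrite normr_gt0 subr_eq0.
(* Each of the two distances in the equation changes by at most [2 / 5] of [|u|], and the factor
   [|t - s|] is at most 1, so the discrepancy [u] cannot be cancelled. *)
exists (`|u| / 5) => [|h gh]; first by rewrite divr_gt0.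
move=> /(_ s t s01 t01) hst; move: u0; apply/negP; rewrite -leNgt.
have H r : 0 <= r <= 1 -> d (g r) (h r) <= `|u| / 5.
  by move=> r01; apply/ltW/(le_lt_trans _ gh)/mdist_le_supdist.
have {}H a b : 0 <= a <= 1 -> 0 <= b <= 1 ->
    `|d (g a) (g b) - d (h a) (h b)| <= 2 / 5 * `|u|.
  move=> /H Ha /H Hb; rewrite ler_distl.
  have := metric_triangle (g a) (h a) (g b); have := metric_triangle (h a) (h b) (g b).
  have := metric_triangle (h a) (g a) (h b); have := metric_triangle (g a) (g b) (h b).
  by rewrite (metric_sym (h a) (g a)) (metric_sym (h b) (g b)) => *; apply/andP; split; lra.
have i0 : 0 <= (0 : R) <= 1 by rewrite lexx ler01.
have i1 : 0 <= (1 : R) <= 1 by rewrite lexx ler01.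
have ts : `|t - s| <= 1 by move: s01 t01 => /andP[? ?] /andP[? ?]; rewrite ler_norml; apply/andP; split; lra.
suff : `|u| <= 4 / 5 * `|u| by lra.
rewrite [leLHS](_ : _ = `|(d (g s) (g t) - d (h s) (h t)) - `|t - s| * (d (g 0) (g 1) - d (h 0) (h 1))|); last by rewrite hst /u; congr `|_|; ring.
rewrite (le_trans (ler_normB _ _))//.
rewrite (_ : 4 / 5 * _ = 2 / 5 * `|u| + 1 * (2 / 5 * `|u|)); last by rewrite /u; lra.
apply: lerD; first exact: H.
by rewrite normrM normr_id; apply: ler_pM => //; exact: H.
Qed.

Definition restr (t : R) (g : Curves) : Curves := fun s => (g : curve) (t * s).

Lemma mulr_itv01 (s t : R) : 0 <= s <= 1 -> 0 <= t <= 1 -> 0 <= s * t <= 1.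
Proof. by move=> /andP[? ?] /andP[? ?]; rewrite mulr_ge0// mulr_ile1. Qed.

Lemma measurable_restr t : 0 <= t <= 1 -> measurable_fun setT (restr t).
Proof.
move=> t01; apply: measurable_fun_Curves => U oU.
apply: measurable_curve_open => g /= /oU[e e0 eU]; exists e => // h gh.
apply: eU; apply: le_lt_trans gh; apply: supdist_le => s s01.
by apply: (@mdist_le_supdist (t * s) g h); exact: mulr_itv01.
Qed.

Lemma geodesic_restr t (g : Curves) : 0 <= t <= 1 -> geodesic g -> geodesic (restr t g).
Proof.
move=> t01 gg s r s01 r01; rewrite /restr mulr0 mulr1.
have i0 : 0 <= (0 : R) <= 1 by rewrite lexx ler01.
rewrite gg ?mulr_itv01// (gg 0 t)// -mulrBr subr0 normrM; ring.
Qed.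

Lemma geodesic_mdist0 (g : curve) t : geodesic g -> 0 <= t <= 1 ->
  d (g 0) (g t) = t * d (g 0) (g 1).
Proof.
move=> gg t01; rewrite gg ?lexx ?ler01// subr0 ger0_norm//.
by case/andP: t01.
Qed.

Lemma geodesic_mdist1 (g : curve) t : geodesic g -> 0 <= t <= 1 ->
  d (g t) (g 1) = (1 - t) * d (g 0) (g 1).
Proof.
move=> gg t01; rewrite gg ?lexx ?ler01// ger0_norm// subr_ge0.
by case/andP: t01.
Qed.

Lemma mder_geodesic (g : curve) t : geodesic g -> 0 <= t <= 1 ->
  mder g t = (d (g 0) (g 1))%:E.
Proof.
move=> gg t01; apply/eqP; rewrite eq_le; apply/andP; split.
  apply: (@le_trans _ _ (ereal_sup [set (d (g (t + h)) (g t) / `|h|)%:E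
      | h in [set h | 0 < `|h| < 1 /\ 0 <= t + h <= 1]])).
    by apply: ereal_inf_lbound; exists 1 => //=.
  apply: ge_ereal_sup => _ [h [/andP[h0 _] th] <-].
  rewrite gg// opprD addrA subrr sub0r normrN mulrAC divff ?mul1r//.
  by rewrite gt_eqF.
apply: le_ereal_inf_tmp => _ [r /= r0 <-].
(* The increment must stay in [[0, 1]]: it points forward from the left half and backward from the
   right half. *)
have [h [h0 hr th]] : exists h, [/\ 0 < `|h|, `|h| < r & 0 <= t + h <= 1].
  have m0 : 0 < Num.min (r / 2) (1 / 2) by rewrite lt_min !divr_gt0.
  have mr : Num.min (r / 2) (1 / 2) < r by rewrite gt_min; apply/orP; left; lra.
  have m1 : Num.min (r / 2) (1 / 2) <= 1 / 2 by rewrite ge_min lexx orbT.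
  move: t01 => /andP[t0 t1]; have [t2|t2] := leP t (1 / 2).
    by exists (Num.min (r / 2) (1 / 2)); rewrite gtr0_norm//; split => //; lra.
  by exists (- Num.min (r / 2) (1 / 2)); rewrite normrN gtr0_norm//; split => //; lra.
apply: ereal_sup_ubound; exists h => /=; first by rewrite h0 hr.
rewrite gg// opprD addrA subrr sub0r normrN mulrAC divff ?mul1r//.
by rewrite gt_eqF.
Qed.

Lemma geodesic_abs_cont (g : curve) : geodesic g -> abs_cont g.
Proof.
move=> gg; exists (fun=> d (g 0) (g 1)); split.
  apply/integrable_lebesgueP => //; apply: continuous_compact_integrable; first exact: segment_compact.
  by apply: continuous_subspaceT => x; exact: cst_continuous.
move=> s t s0 st t1; have s1 := le_trans st t1; have t0 := le_trans s0 st.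
rewrite gg ?s0 ?t0// integral_cst//= lebesgue_measure_itv/= lte_fin.
rewrite ger0_norm ?subr_ge0//; case: ltP => [_|ts].
  by rewrite -EFinB -EFinM mulrC.
have -> : t = s by apply/eqP; rewrite eq_le st ts.
by rewrite subrr mul0r mule0.
Qed.

End curves.

(** * Elementary inequalities for c-transforms *)

Section potential.
Context {R : realType} {X : pmetricType R}.
Local Notation d := (@mdist R X).
Local Notation BX := (@BX R X).
Hypothesis cX : compact [set: X].
Implicit Types phi psi : X -> R.

Lemma ctrans_le psi M x y : (forall x, psi x <= M) ->
  psi x + ctrans psi y <= (d x y) ^+ 2 / 2.
Proof.
move=> psiM; rewrite -lerBrDl; apply: ge_inf; last by exists x.
by exists (- M) => _ [z _ <-]; have := psiM z; have := sqr_ge0 (d z y); lra.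
Qed.

(** If [D] bounds the distance, then [d^2 / 2] is [D]-Lipschitz in each variable, and an infimum of
    [D]-Lipschitz functions that is finite is [D]-Lipschitz. *)
Lemma ctrans_lipschitz psi M : (forall x, psi x <= M) -> Defs.lipschitz (ctrans psi).
Proof.
move=> psiM; have [D D0 dD] := mdist_bounded cX.
suff H y z : ctrans psi y - ctrans psi z <= D * d y z.
  exists D => y z; rewrite ler_norml H andbT lerNl opprB metric_sym; exact: H.
rewrite lerBlDl -lerBlDr; apply: lb_le_inf; first by exists ((d point z) ^+ 2 / 2 - psi point), point.
move=> _ [x _ <-]; have := ctrans_le x y psiM.
have := metric_triangle x z y; rewrite (metric_sym z y).
have := mdist_ge0 x y; have := mdist_ge0 x z; have := mdist_ge0 y z; have := dD x y; have := dD x z.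
move=> *; nra.
Qed.

Lemma c_concave_lipschitz phi : c_concave phi -> Defs.lipschitz phi.
Proof. by move=> [psi [[M psiM] ->]]; exact: ctrans_lipschitz psiM. Qed.

(** The inequality between [phi] and its transform is applied at [(g t, g 1)], where the distance is
    [1 - t] times that of the endpoints; [1 / 2 - (1 - t)^2 / 2 = t - t^2 / 2]. *)
Lemma potential_drop phi M (g : curve) t : (forall x, phi x <= M) ->
  geodesic g -> 0 <= t <= 1 ->
  (d (g 0) (g 1)) ^+ 2 * (t - t ^+ 2 / 2)
    - ((d (g 0) (g 1)) ^+ 2 / 2 - phi (g 0) - ctrans phi (g 1)) <= phi (g 0) - phi (g t).
Proof.
move=> phiM gg t01; have := ctrans_le (g t) (g 1) phiM.
rewrite (geodesic_mdist1 gg t01); move: (d _ _) => D; nra.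
Qed.

(** The same inequality at [(y, z)], with [d y z <= d y x + d x z] squared. Division by [d y x] will
    bound the slope at [x] by [d x z], up to the defect divided by [d y x]. *)
Lemma potential_slope phi M x y z : (forall x, phi x <= M) ->
  phi y - phi x <= d y x * (d x z + d y x / 2) + ((d x z) ^+ 2 / 2 - phi x - ctrans phi z).
Proof.
move=> phiM; have := ctrans_le y z phiM; have := metric_triangle y x z.
have := mdist_ge0 y z; have := mdist_ge0 x z; have := mdist_ge0 y x.
by move=> *; nra.
Qed.

End potential.

(** * Absolutely continuous curves and slopes *)

(* The fundamental theorem of calculus, as an inequality for one-sided Dini
   derivatives.  Translation invariance gives the integral of the difference
   quotients of a nondecreasing function exactly; Fatou's lemma is applied to the
   quotients of [F - sigma w], where [F] is a primitive of [g], and the quotients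
   of [F] converge almost everywhere. *)
Section dini.
Context {R : realType}.
Local Notation mu := (@lebesgue_measure R).
Local Notation T := (measurableTypeR R).

Lemma lebesgue_measure_translation (a : R) (A : set R) : measurable A ->
  pushforward mu ((fun x => x + a) : _ -> T) A = mu A.
Proof.
move=> mA; apply/esym/lebesgue_measure_unique => //=; first exact: measurable_funD.
move=> mf _ [[b c]] _ <-.
rewrite /pushforward.
have -> : (fun x => x + a) @^-1` `]b, c]%classic = `]b - a, c - a]%classic.
  by apply/seteqP; split => x /=; rewrite !in_itv/= ltrBlDr lerBrDr.
rewrite !lebesgue_measure_itv/= !lte_fin ltrD2r; case: ifP => // _.
by rewrite -!EFinB; congr EFin; lra.
Qed.

Lemma ge0_integral_translation (a : R) (f : R -> \bar R) :
  measurable_fun setT (f : T -> \bar R) -> (forall x, 0 <= f x)%E ->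
  (\int[mu]_x f (x + a)%R = \int[mu]_x f x)%E.
Proof.
move=> mf f0.
have mt : measurable_fun setT ((fun x => x + a) : T -> T).
  exact: measurable_funD.
rewrite -(@ge0_integral_pushforward _ _ _ _ _ _ mt mu setT f)//.
by apply: eq_measure_integral => A mA _; exact: lebesgue_measure_translation.
Qed.

(** Far to the right [V] is a constant, so its integral may diverge and the difference is not split
    directly. [V] is cut at [1] and its translate accordingly; translation then moves the cut to
    [1 + k], and the excess over []1, 1 + k]] is [k] times [V 1]. *)
Lemma integral_increment (W : R -> R) (k : R) : 0 < k ->
  {homo W : x y / x <= y} ->
  (forall x, x <= 0 -> W x = W 0) -> (forall x, 1 <= x -> W x = W 1) ->
  (\int[mu]_x (W (x + k) - W x)%:E = (k * (W 1 - W 0))%:E)%E.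
Proof.
move=> k0 ndW W0 W1; pose V x := W x - W 0.
have V0 x : 0 <= V x.
  rewrite subr_ge0; have [x0|/ltW x0] := leP x 0; first by rewrite W0.
  exact: ndW.
have mV : measurable_fun setT (V : T -> R).
  by apply: nondecreasing_measurable => // x y xy; rewrite lerD2r ndW.
have mI (b : R) : measurable (`]-oo, b] : set T) by exact: measurable_itv.
have mV1 (b : R) : measurable_fun setT (fun x : T => (V x * \1_(`]-oo, b]) x)%:E).
  by apply/measurable_EFinP; apply: measurable_funM => //; exact: measurable_indic.
have p0 b x : (0 <= (V x * \1_(`]-oo, b]) x)%:E)%E.
  by rewrite lee_fin mulr_ge0// indicE ler0n.
have E1 : (\int[mu]_x (V (x + k) * \1_(`]-oo, 1 + k]) (x + k))%:E =
           \int[mu]_x (V x * \1_(`]-oo, 1 + k]) x)%:E)%E.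
  exact: (@ge0_integral_translation k (fun x => (V x * \1_(`]-oo, 1 + k]) x)%:E)).
have mD : measurable_fun setT (fun x : T => (W (x + k) - W x)%:E).
  apply/measurable_EFinP; apply: measurable_funB.
    by apply: nondecreasing_measurable => // x y xy; rewrite ndW// lerD2r.
  by apply: nondecreasing_measurable => // x y xy; rewrite ndW.
have D0 x : (0 <= (W (x + k) - W x)%:E)%E.
  by rewrite lee_fin subr_ge0 ndW// lerDl ltW.
have E2 : (\int[mu]_x (V (x + k) * \1_(`]-oo, 1 + k]) (x + k))%:E =
  \int[mu]_x (W (x + k) - W x)%:E + \int[mu]_x (V x * \1_(`]-oo, 1]) x)%:E)%E.
  rewrite -ge0_integralD//; apply: eq_integral => x _; rewrite -EFinD; congr EFin.
  rewrite !indicE !mem_setE !in_itv/= lerD2r; case: (leP x 1) => x1.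
    by rewrite !mulr1 /V; lra.
  rewrite !mulr0 addr0 (W1 x) ?ltW// W1 ?subrr//.
  by rewrite (le_trans (ltW x1))// lerDl ltW.
have E3 : (\int[mu]_x (V x * \1_(`]-oo, 1 + k]) x)%:E =
  \int[mu]_x (V x * \1_(`]-oo, 1]) x)%:E + (k * (W 1 - W 0))%:E)%E.
  have -> : (k * (W 1 - W 0))%:E = (\int[mu]_x (V 1 * \1_(`]1, 1 + k]) x)%:E)%E.
    under eq_integral do rewrite EFinM.
    rewrite ge0_integralZl//; last 2 first.
    - by apply/measurable_EFinP; exact: measurable_indic.
    - by rewrite lee_fin.
    have mu1k : mu `]1, 1 + k]%classic = k%:E.
      by rewrite lebesgue_measure_itv/= lte_fin ltrDl k0 -EFinB; congr EFin; ring.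
    rewrite integral_indic// setIT [X in (_ * X)%E](_ : _ = k%:E); last exact: mu1k.
    by rewrite -EFinM; congr EFin; rewrite /V; ring.
  rewrite -ge0_integralD//; last 2 first.
  - by move=> x _; rewrite lee_fin mulr_ge0// indicE ler0n.
  - by apply/measurable_EFinP; apply: measurable_funM => //; exact: measurable_indic.
  apply: eq_integral => x _; rewrite -EFinD; congr EFin.
  rewrite !indicE !mem_setE !in_itv/=; case: (leP x 1) => x1 /=.
    by rewrite mulr0 addr0 (le_trans x1)// lerDl ltW.
  by rewrite mulr0 add0r /V (W1 x)// ltW.
(* Finiteness of the common term is what allows cancelling it from an identity of extended reals. *)
have fin1 : (\int[mu]_x (V x * \1_(`]-oo, 1]) x)%:E)%E \is a fin_num.
  rewrite ge0_fin_numE; last by apply: integral_ge0 => x _.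
  apply: (@le_lt_trans _ _ (\int[mu]_x ((V 1)%:E * (\1_(`[0, 1]) x)%:E))%E).
    apply: ge0_le_lower_integral => // x _; rewrite -EFinM lee_fin.
    rewrite !indicE !mem_setE !in_itv/=; case: (leP x 1) => x1; last by rewrite mulr0 andbF mulr0.
    rewrite mulr1 andbT; case: (leP 0 x) => x0.
      by rewrite mulr1 lerD2r ndW.
    by rewrite mulr0 /V W0 ?subrr// ltW.
  rewrite ge0_integralZl//; last 2 first.
  - by apply/measurable_EFinP; exact: measurable_indic.
  - by rewrite lee_fin.
  have mu01 : mu `[0, 1]%classic = 1%:E.
    by rewrite lebesgue_measure_itv/= lte_fin ltr01 -EFinB subr0.
  rewrite integral_indic// setIT [X in (_ * X)%E](_ : _ = 1%:E); last exact: mu01.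
  by rewrite mule1 ltry.
move: E3; rewrite -E1 E2 addeC => /(congr1 (fun z => z - \int[mu]_x (V x * \1_(`]-oo, 1]) x)%:E)%E).
by rewrite !(addeC (\int[mu]_x (V x * \1_(`]-oo, 1]) x)%:E)%E) !addeK.
Qed.

Lemma derivable_eps (F : R -> R) x l : derivable F x 1 -> derive1 F x = l ->
  forall e, 0 < e -> exists2 r, 0 < r &
    forall h, 0 < `|h| < r -> `|(F (x + h) - F x) / h - l| <= e.
Proof.
move=> dF Fl e e0.
have : (fun h => h^-1 *: ((F \o shift x) (h *: (1 : R)) - F x)) @ 0^' --> l.
  by rewrite -Fl derive1E; exact: dF.
move=> /cvgrPdist_le /(_ e e0) [r /= r0 Hr].
exists r => // h /andP[h0 hr].
have := Hr h; rewrite /= sub0r normrN => /(_ hr); rewrite -normr_gt0 => /(_ h0).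
by rewrite distrC /GRing.scale/= mulr1 (addrC h) mulrC.
Qed.

Lemma dini_increment_le (w g : R -> R) (p : R -> \bar R) (s : R) :
  s = 1 \/ s = -1 ->
  mu.-integrable setT (EFin \o g) -> (forall x, 0 <= g x) ->
  (forall x, ~ `]0, 1]%classic x -> g x = 0) ->
  (forall x y, x <= y -> `|w y - w x| <= \int[mu]_(u in `]x, y]) g u) ->
  (forall x, 0 <= p x)%E ->
  {ae mu, forall x, forall e, 0 < e -> \forall n \near \oo,
     (((w (x + s / n.+1%:R) - w x) * n.+1%:R)%:E <= p x + e%:E)%E} ->
  ((s * (w 1 - w 0))%:E <= \int[mu]_x p x)%E.
Proof.
move=> sE ig g0 gout wg p0 wp.
pose F x := \int[mu]_(u in `]-oo, x]) g u.
have igS A : measurable A -> mu.-integrable A (EFin \o g).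
  by move=> mA; apply: integrableS ig.
have FB x y : x <= y -> F y - F x = \int[mu]_(u in `]x, y]) g u.
  by move=> xy; rewrite /F Rintegral_itvB//; exact: igS.
(* The bound on the increments of [w] makes [W] nondecreasing, and [W] is constant on both sides of
   []0, 1]], where [g] vanishes; so [integral_increment] applies to it. *)
pose W x := F x - s * w x.
have ss : s * s = 1 by case: sE => ->; rewrite ?mulrNN mulr1.
have sn : `|s| = 1 by case: sE => ->; rewrite ?normrN normr1.
have ndW : {homo W : x y / x <= y}.
  move=> x y xy; rewrite -subr_ge0 /W.
  have := wg _ _ xy; rewrite -(FB _ _ xy).
  have : s * (w y - w x) <= `|w y - w x|.
    by rewrite (le_trans (ler_norm _))// normrM sn mul1r.
  by rewrite mulrBr; lra.
have Wcst x y : x <= y -> (forall u, x < u -> u <= y -> ~ `]0, 1]%classic u) -> W x = W y.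
  move=> xy H; have I0 : \int[mu]_(u in `]x, y]) g u = 0.
    rewrite /Rintegral integral0_eq// => u /=; rewrite in_itv/= => /andP[xu uy].
    by rewrite gout//; exact: H.
  have := wg _ _ xy; rewrite /W I0 normr_le0 subr_eq0 => /eqP ->.
  by have := FB _ _ xy; rewrite I0; lra.
have W0 x : x <= 0 -> W x = W 0.
  move=> x0; apply: Wcst => // u _ u0; rewrite /= in_itv/= => /andP[u1 _].
  by move: u0; rewrite leNgt u1.
have W1 x : 1 <= x -> W x = W 1.
  move=> x1; apply/esym; apply: Wcst => // u u1 _; rewrite /= in_itv/= => /andP[_].
  by rewrite leNgt u1.
have k0 n : 0 < n.+1%:R^-1 :> R by rewrite invr_gt0.
pose u n x := (s * (W (x + s / n.+1%:R) - W x) * n.+1%:R)%:E.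
have mW : measurable_fun setT (W : T -> R) by exact: nondecreasing_measurable.
have mWk (k : R) : measurable_fun setT ((fun x => W (x + k)) : T -> R).
  by apply: nondecreasing_measurable => // x y xy; rewrite ndW// lerD2r.
have mu_ n : measurable_fun setT (u n : T -> \bar R).
  apply/measurable_EFinP; apply: measurable_funM => //; apply: measurable_funM => //.
  exact: measurable_funB.
have u0 n x : (0 <= u n x)%E.
  rewrite lee_fin mulr_ge0//; case: sE => ->; first by rewrite !mul1r subr_ge0 ndW// lerDl ltW.
  by rewrite !mulN1r opprB subr_ge0 ndW// gerBl ltW.
have Iu n : (\int[mu]_x u n x = (W 1 - W 0)%:E)%E.
  have Ik := integral_increment (k0 n) ndW W0 W1.
  have D0 x : (0 <= (W (x + n.+1%:R^-1) - W x)%:E)%E.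
    by rewrite lee_fin subr_ge0 ndW// lerDl ltW.
  have mD : measurable_fun setT (fun x : T => (W (x + n.+1%:R^-1) - W x)%:E).
    by apply/measurable_EFinP; exact: measurable_funB.
  have -> : (\int[mu]_x u n x =
      \int[mu]_x ((W (x + n.+1%:R^-1) - W x)%:E * n.+1%:R%:E))%E.
    (* Translated by [1 / (n + 1)], the backward quotients become the forward ones. *)
    case: sE => sE; last rewrite -(@ge0_integral_translation (n.+1%:R^-1) (u n))//.
      by apply: eq_integral => x _; rewrite /u sE !mul1r EFinM.
    apply: eq_integral => x _; rewrite /u sE !mulN1r addrK opprB EFinM //.
  by rewrite ge0_integralZr// Ik -EFinM mulrAC mulVf ?mul1r// pnatr_eq0.
pose q x := limn_einf (u^~ x).
have mq : measurable_fun setT (q : T -> \bar R).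
  rewrite (_ : q = (fun x => - limn_esup ((fun n => - u n x)%E)))%E; last first.
    by apply/funext => x; rewrite -[X in limn_esup X]/(-%E \o (u^~ x)) limn_esupN oppeK.
  apply: measurableT_comp => //; apply: measurable_fun_limn_esup => n.
  exact: measurableT_comp.
have q0 x : (0 <= q x)%E.
  rewrite /q limn_einf_lim; apply: lime_ge; first exact: is_cvg_einfs.
  by apply: nearW => n; apply: le_ereal_inf_tmp => _ [k _ <-].
have Iq : (\int[mu]_x q x <= (W 1 - W 0)%:E)%E.
  apply: (le_trans (fatou mu measurableT mu_ (fun n x _ => u0 n x))).
  rewrite (_ : (fun n => _) = cst (W 1 - W 0)%:E) ?is_cvg_limn_einfE ?lim_cst//; last exact/funext.
  exact: cvg_cst.
have locg : locally_integrable setT g.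
  by have := integrable_locally measurableT ig; rewrite patch_setT.
have FTC := FTC1Ny (fun y => igS _ (measurable_itv `]-oo, y])) locg.
have gqp : {ae mu, forall x, (g x)%:E <= q x + p x}%E.
  have FF := ae_filter_ringOfSetsType mu.
  apply: filterS2 wp FTC => x wpx [dF Fg].
  move: (p0 x) wpx; case: (p x) => [c| |] //=; last first.
    by move=> _ _; rewrite addey ?leey//; have := q0 x; case: (q x).
  move=> _ wpx; apply/lee_addgt0Pr => e e0; rewrite -addeA -EFinD -leeBlDr// -EFinB.
  have e20 : 0 < e / 2 by rewrite divr_gt0.
  have [rr rr0 Hr] := derivable_eps dF Fg e20.
  have : \forall n \near \oo, ((g x - (c + e))%:E <= u n x)%E.
    have Hn : \forall n \near \oo, n.+1%:R^-1 < rr.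
      exact: near_infty_natSinv_lt (PosNum rr0).
    apply: filterS2 Hn (wpx _ e20) => n nrr; rewrite lee_fin => wn.
    have hn : `|s / n.+1%:R| = n.+1%:R^-1 by rewrite normrM sn mul1r gtr0_norm.
    have /(Hr _) : 0 < `|s / n.+1%:R| < rr by rewrite hn k0.
    rewrite lee_fin ler_distl => /andP[+ _].
    have sV : s^-1 = s by case: sE => ->; rewrite ?invrN invr1.
    rewrite invfM invrK sV /W.
    have -> : s * (F (x + s / n.+1%:R) - s * w (x + s / n.+1%:R) - (F x - s * w x)) * n.+1%:R =
      (F (x + s / n.+1%:R) - F x) * (s * n.+1%:R) -
       (s * s) * ((w (x + s / n.+1%:R) - w x) * n.+1%:R) by ring.
    by rewrite ss mul1r /F; lra.
  move=> [M _ HM]; apply: (@le_trans _ _ (einfs (u^~ x) M)).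
    by apply: le_ereal_inf_tmp => _ [n /= Mn <-]; exact: HM.
  rewrite /q limn_einf_lim (cvg_lim _ (@cvg_einfs_sup _ _))//.
  by apply: ereal_sup_ubound; exists M.
have mg : measurable_fun setT (g : T -> R) by apply/measurable_EFinP; exact: measurable_int ig.
have [N [mN N0 subN]] := gqp.
(* Additivity of the integral requires measurable functions, and [p] is arbitrary. The positive part
   of [g - q], set to 0 on the exceptional set, is a measurable substitute lying below [p]. *)
pose r := (fun x => maxe ((g x)%:E - q x)%E 0%E) \_ (~` N).
have mr : measurable_fun setT (r : T -> \bar R).
  apply/(measurable_restrictT _ _).1 => //; first exact: measurableC.
  apply: measurable_funTS; apply: measurable_maxe => //.
  by apply: emeasurable_funB => //; exact/measurable_EFinP.
have r0 x : (0 <= r x)%E by rewrite /r patchE; case: ifP => // _; rewrite le_max lexx orbT.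
have rp : (\int[mu]_x r x <= \int[mu]_x p x)%E.
  apply: ge0_le_lower_integral => // x _; rewrite /r patchE; case: ifPn => // xN.
  have : ((g x)%:E <= q x + p x)%E.
    by apply: contrapT => /subN; move: xN; rewrite inE.
  rewrite ge_max p0 andbT; have := q0 x; case: (q x) => [y| |] _ //=; last by rewrite addeNy leNye.
  by rewrite EFinN leeBlDl.
have gqr : (\int[mu]_x (g x)%:E <= \int[mu]_x q x + \int[mu]_x r x)%E.
  rewrite -ge0_integralD//; apply: ae_ge0_le_integral => //.
  - by move=> x _; rewrite lee_fin.
  - exact/measurable_EFinP.
  - by move=> x _; rewrite adde_ge0.
  - exact: emeasurable_funD.
  exists N; split => // x /= /not_implyP[_ gx]; apply: contrapT => xN; apply: gx.
  rewrite /r patchE ifT; last by rewrite inE.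
  have := q0 x; case: (q x) => [y| |] _ //; last by rewrite addye// ?leey// gt_eqF// lt_max ltNy0 orbT.
  have [h|h] := leP ((g x)%:E - y%:E)%E 0%E.
    by rewrite adde0 -sube_le0.
  by rewrite -EFinB -EFinD addrC subrK.
have Ig : (\int[mu]_x (g x)%:E = (F 1 - F 0)%:E)%E.
  rewrite FB// fineK; last by apply: integrable_fin_num => //; exact: igS.
  rewrite [RHS]integral_mkcond; apply: eq_integral => x _; rewrite patchE.
  by case: ifPn => //; rewrite notin_setE => /gout ->.
have := le_trans gqr (leeD Iq rp); rewrite Ig.
case: (\int[mu]_x p x)%E => [c| |]; rewrite ?leNye ?leey// -EFinD !lee_fin /W.
by rewrite mulrBr; lra.
Qed.

End dini.

Section slopes.
Context {R : realType} {X : pmetricType R}.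
Local Notation d := (@mdist R X).
Local Notation BX := (@BX R X).
Hypothesis cX : compact [set: X].
Implicit Types f phi : X -> R.

Lemma lipschitz_cst (c : R) : Defs.lipschitz (fun _ : X => c).
Proof. by exists 0 => x y; rewrite subrr normr0 mul0r. Qed.

Lemma lipschitzD f g : Defs.lipschitz f -> Defs.lipschitz g ->
  Defs.lipschitz (fun x => f x + g x).
Proof.
move=> [L1 fL] [L2 gL]; exists (L1 + L2) => x y; rewrite opprD addrACA mulrDl.
by apply: (le_trans (ler_normD _ _)); exact: lerD.
Qed.

Lemma lipschitzZ (c : R) f : Defs.lipschitz f -> Defs.lipschitz (fun x => c * f x).
Proof.
move=> [L fL]; exists (`|c| * L) => x y; rewrite -mulrBr normrM -mulrA.
by rewrite ler_wpM2l.
Qed.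

Lemma lipschitzB f g : Defs.lipschitz f -> Defs.lipschitz g ->
  Defs.lipschitz (fun x => f x - g x).
Proof.
move=> lf /(lipschitzZ (-1)) lg; have := lipschitzD lf lg.
by under eq_fun do rewrite mulN1r.
Qed.

Lemma lipschitzM f g : Defs.lipschitz f -> Defs.lipschitz g ->
  Defs.lipschitz (fun x => f x * g x).
Proof.
move=> lf lg; have [Mf fM] := lipschitz_bounded cX lf.
have [Mg gM] := lipschitz_bounded cX lg.
have [L1 _ fL] := lipschitz_gt0 lf; have [L2 _ gL] := lipschitz_gt0 lg.
exists (L1 * Mg + Mf * L2) => x y.
have -> : f x * g x - f y * g y = (f x - f y) * g x + f y * (g x - g y) by ring.
rewrite (le_trans (ler_normD _ _))// !normrM mulrDl -mulrA (mulrC Mg) mulrA -(mulrA Mf).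
by apply: lerD; apply: ler_pM.
Qed.

Lemma lipschitz_min f g : Defs.lipschitz f -> Defs.lipschitz g ->
  Defs.lipschitz (fun x => Num.min (f x) (g x)).
Proof.
move=> /lipschitz_gt0[L1 L10 fL] /lipschitz_gt0[L2 L20 gL]; exists (L1 + L2) => x y.
have := fL x y; have := gL x y; have := mdist_ge0 x y; rewrite !ler_norml mulrDl.
move=> d0 /andP[? ?] /andP[? ?]; have ? := mulr_ge0 (ltW L10) d0.
have ? := mulr_ge0 (ltW L20) d0.
by case: (leP (f x) (g x)); case: (leP (f y) (g y)) => *; apply/andP; split; lra.
Qed.

(** For [r1 = 0] this is the supremum whose infimum over [r2] is the slope. A positive [r1] bounds
    the denominators from below, so that a defect divided by [d y x] remains under control. The
    value 0 is adjoined for empty annuli. *)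
Definition annular_sup (N : X -> X -> R) (r1 r2 : R) (x : X) : \bar R :=
  ereal_sup ([set 0%E] `|` [set (N x y / d y x)%:E | y in [set y | r1 < d y x < r2]]).

Definition slope (N : X -> X -> R) (x : X) : \bar R :=
  ereal_inf [set annular_sup N 0 r x | r in [set r : R | 0 < r]].

Definition incr f (x y : X) : R := Num.max (f y - f x) 0.
Definition osc f (x y : X) : R := `|f y - f x|.

Lemma asc_slopeE f : asc_slope f = slope (incr f). Proof. by []. Qed.
Lemma lip_constE f : lip_const f = slope (osc f). Proof. by []. Qed.

Lemma lipschitz_incr f y : Defs.lipschitz f -> Defs.lipschitz (fun x => incr f x y).
Proof.
move=> [L fL]; exists L => x z; apply: le_trans (fL x z).
rewrite /incr; have := ler_norm (f x - f z); have := ler_norm (f z - f x).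
rewrite (distrC (f z)) ler_norml.
by case: (leP (f y - f x) 0); case: (leP (f y - f z) 0) => *; apply/andP; split; lra.
Qed.

Lemma lipschitz_osc f y : Defs.lipschitz f -> Defs.lipschitz (fun x => osc f x y).
Proof.
move=> [L fL]; exists L => x z; apply: le_trans (fL x z); rewrite /osc.
have -> : f x - f z = - ((f y - f x) - (f y - f z)) by ring.
by rewrite normrN; exact: ler_dist_dist.
Qed.

Section slope.
Variable N : X -> X -> R.
Hypothesis lipN : forall y, Defs.lipschitz (fun x => N x y).

Lemma annular_sup_ge0 r1 r2 x : (0 <= annular_sup N r1 r2 x)%E.
Proof. by apply: ereal_sup_ubound; left. Qed.

(** Superlevel sets are open: a witness [y] satisfies three strict inequalities at [x], which say
    that one Lipschitz function is positive at [x], and hence they hold for the same [y] at all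
    nearby points. *)
Lemma measurable_annular_sup r1 r2 : 0 <= r1 ->
  measurable_fun setT (annular_sup N r1 r2 : BX -> \bar R).
Proof.
move=> r10; apply: emeasurable_fun_gt => a; apply: measurable_open; apply/open_mdistP.
have [a0|a0] := ltP a 0.
  by move=> x _; exists 1 => // y _; apply: lt_le_trans (annular_sup_ge0 _ _ _); rewrite lte_fin.
move=> x /= /ereal_sup_gt[_ [->|[y /andP[y1 y2] <-]]].
  by rewrite lte_fin ltNge a0.
rewrite lte_fin => ay.
have y0 := le_lt_trans r10 y1.
have oG : open [set z | 0 < Num.min (N z y - a * d y z) (Num.min (d y z - r1) (r2 - d y z))].
  apply: lipschitz_open_preimage; apply: lipschitz_min.
    by apply: lipschitzB => //; apply: lipschitzZ; exact: lipschitz_mdist.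
  apply: lipschitz_min; apply: lipschitzB; [exact: lipschitz_mdist|exact: lipschitz_cst|
    exact: lipschitz_cst|exact: lipschitz_mdist].
move/open_mdistP : oG => /(_ x)[|e e0 eG].
  by rewrite /= !lt_min !subr_gt0 y1 y2 -ltr_pdivlMr// ay.
exists e => // z /eG; rewrite /= !lt_min !subr_gt0 => /and3P[zN z1 z2].
have z0 := le_lt_trans r10 z1.
apply: (@lt_le_trans _ _ (N z y / d y z)%:E); first by rewrite lte_fin ltr_pdivlMr.
by apply: ereal_sup_ubound; right; exists y => //=; rewrite z1.
Qed.

Lemma le_annular_sup r1 r1' r2 r2' x : r1' <= r1 -> r2 <= r2' ->
  (annular_sup N r1 r2 x <= annular_sup N r1' r2' x)%E.
Proof.
move=> r11 r22; apply: le_ereal_sup => _ [->|[y /= /andP[y1 y2] <-]]; first by left.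
by right; exists y => //=; rewrite (le_lt_trans r11 y1) (lt_le_trans y2 r22).
Qed.

Lemma slope_cvg x :
  (fun n => annular_sup N 0 n.+1%:R^-1 x) @ \oo --> slope N x.
Proof.
have -> : slope N x = ereal_inf (range (fun n => annular_sup N 0 n.+1%:R^-1 x)).
  apply/eqP; rewrite eq_le; apply/andP; split.
    by apply: le_ereal_inf => _ [n _ <-]; exists n.+1%:R^-1 => //=; rewrite invr_gt0.
  apply: le_ereal_inf_tmp => _ [r /= r0 <-].
  have [n nr] := @ltr_add_invr R 0 r r0; rewrite add0r in nr.
  apply: (@le_trans _ _ (annular_sup N 0 n.+1%:R^-1 x)).
    by apply: ereal_inf_lbound; exists n.
  exact: le_annular_sup (ltW nr).
apply: ereal_nonincreasing_cvgn => m n mn; apply: le_annular_sup => //.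
by rewrite lef_pV2 ?posrE// ler_nat.
Qed.

Lemma measurable_slope : measurable_fun setT (slope N : BX -> \bar R).
Proof.
apply: (@emeasurable_fun_cvg _ BX R setT (fun n => annular_sup N 0 n.+1%:R^-1)).
  by move=> n; exact: measurable_annular_sup.
by move=> x _; exact: slope_cvg.
Qed.

Lemma slope_ge0 x : (0 <= slope N x)%E.
Proof. by apply: le_ereal_inf_tmp => _ [r _ <-]; exact: annular_sup_ge0. Qed.

Lemma slope_le_annular r x : 0 < r -> (slope N x <= annular_sup N 0 r x)%E.
Proof. by move=> r0; apply: ereal_inf_lbound; exists r. Qed.

Lemma slope_le (a r : R) x : 0 <= a -> 0 < r ->
  (forall y, 0 < d y x < r -> N x y <= a * d y x) -> (slope N x <= a%:E)%E.
Proof.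
move=> a0 r0 H; apply: (le_trans (slope_le_annular x r0)).
apply: ge_ereal_sup => _ [->|[y /= yr <-]]; rewrite lee_fin//.
by rewrite ler_pdivrMr; [exact: H|case/andP: yr].
Qed.

Lemma slope_lt (a : R) x : (slope N x < a%:E)%E -> N x x <= 0 ->
  exists2 r, 0 < r & forall y, d y x < r -> N x y <= a * d y x.
Proof.
move=> /ereal_inf_lt[_ [r r0 <-] ra] Nx; exists r => // y yr.
have [->|xy] := eqVneq y x; first by rewrite mdistxx mulr0.
have y0 : 0 < d y x by rewrite mdist_gt0.
rewrite -ler_pdivrMr// -lee_fin; apply: le_trans (ltW ra).
by apply: ereal_sup_ubound; right; exists y => //=; rewrite y0.
Qed.

End slope.

Section lipschitz_slopes.
Variables (f : X -> R) (L : R).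
Hypothesis (L0 : 0 <= L) (fL : forall x y, `|f x - f y| <= L * d x y).

Let lipf : Defs.lipschitz f. Proof. by exists L. Qed.

Lemma measurable_asc_slope : measurable_fun setT (asc_slope f : BX -> \bar R).
Proof. by rewrite asc_slopeE; apply: measurable_slope => y; exact: lipschitz_incr. Qed.

Lemma measurable_lip_const : measurable_fun setT (lip_const f : BX -> \bar R).
Proof. by rewrite lip_constE; apply: measurable_slope => y; exact: lipschitz_osc. Qed.

Lemma asc_slope_ge0 x : (0 <= asc_slope f x)%E.
Proof. exact: (slope_ge0 (incr f)). Qed.

Lemma lip_const_ge0 x : (0 <= lip_const f x)%E.
Proof. exact: (slope_ge0 (osc f)). Qed.

Lemma lip_const_le x : (lip_const f x <= L%:E)%E.
Proof. by rewrite lip_constE; apply: (@slope_le _ _ 1) => // y _; exact: fL. Qed.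

Lemma asc_slope_le_lip_const x : (asc_slope f x <= lip_const f x)%E.
Proof.
apply: le_ereal_inf_tmp => _ [r r0 <-].
apply: (le_trans (slope_le_annular (incr f) x r0)).
apply: ge_ereal_sup => _ [->|[y /= yr <-]]; first exact: (annular_sup_ge0 (osc f)).
apply: (@le_trans _ _ (osc f x y / d y x)%:E).
  rewrite lee_fin ler_wpM2r// ?invr_ge0 ?mdist_ge0// /incr /osc.
  by rewrite ge_max ler_norm normr_ge0.
by apply: ereal_sup_ubound; right; exists y.
Qed.

Lemma asc_slope_le x : (asc_slope f x <= L%:E)%E.
Proof. exact: le_trans (asc_slope_le_lip_const x) (lip_const_le x). Qed.

Lemma asc_slopeK x : (fine (asc_slope f x))%:E = asc_slope f x.
Proof.
rewrite fineK// ge0_fin_numE ?asc_slope_ge0//.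
by apply: le_lt_trans (asc_slope_le x) _; rewrite ltry.
Qed.

Lemma lip_constK x : (fine (lip_const f x))%:E = lip_const f x.
Proof.
rewrite fineK// ge0_fin_numE ?lip_const_ge0//.
by apply: le_lt_trans (lip_const_le x) _; rewrite ltry.
Qed.

Lemma asc_slope_eps x e : 0 < e -> exists2 r, 0 < r &
  forall y, d y x < r -> f y - f x <= (fine (asc_slope f x) + e) * d y x.
Proof.
move=> e0; have [||r r0 H] := @slope_lt (incr f) (fine (asc_slope f x) + e) x.
- by rewrite -asc_slopeE -asc_slopeK lte_fin ltrDl.
- by rewrite /incr subrr maxxx.
- by exists r => // y /H; apply: le_trans; rewrite /incr le_max lexx.
Qed.

Lemma lip_const_eps x e : 0 < e -> exists2 r, 0 < r &
  forall y, d y x < r -> `|f y - f x| <= (fine (lip_const f x) + e) * d y x.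
Proof.
move=> e0; have [||r r0 H] := @slope_lt (osc f) (fine (lip_const f x) + e) x.
- by rewrite -lip_constE -lip_constK lte_fin ltrDl.
- by rewrite /osc subrr normr0.
- by exists r => // y /H.
Qed.

End lipschitz_slopes.

Lemma lip_const_le_of (f : X -> R) x (a r : R) : 0 <= a -> 0 < r ->
  (forall y, d y x < r -> `|f y - f x| <= a * d y x) -> (lip_const f x <= a%:E)%E.
Proof. by move=> a0 r0 H; rewrite lip_constE; apply: (slope_le a0 r0) => y /andP[_ /H]. Qed.

End slopes.

(** * The ascending slope is a weak upper gradient *)

Section slope_weak_upper_gradient.
Context {R : realType} {X : pmetricType R}.
Local Notation d := (@mdist R X).
Local Notation BX := (@BX R X).
Local Notation Curves := (@Curves R X).
Local Notation curve := (@curve R X).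
Local Notation mu := (@lebesgue_measure R).
Hypothesis cX : compact [set: X].
Variables (phi : X -> R) (L : R).
Hypothesis (L0 : 0 < L) (phiL : forall x y, `|phi x - phi y| <= L * d x y).

(** Composing with it freezes a curve at its endpoints outside [[0, 1]] and thus extends it to the
    whole line, as the translation argument for Dini derivatives demands. *)
Let clamp (x : R) : R := Num.max 0 (Num.min x 1).

Let clamp01 x : 0 <= clamp x <= 1.
Proof. by rewrite /clamp le_max lexx/= ge_max ler01 ge_min lexx orbT. Qed.

Let clampE x : 0 <= x <= 1 -> clamp x = x.
Proof. by move=> /andP[x0 x1]; rewrite /clamp min_l// max_r. Qed.

Let le_clamp x y : x <= y -> clamp x <= clamp y.
Proof.
move=> xy; rewrite /clamp ge_max !le_max lexx/=.
by rewrite le_min !ge_min xy lexx !orbT.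
Qed.

Let clamp_itv x y u : (`]x, y] `&` `]0, 1])%classic u <-> `]clamp x, clamp y]%classic u.
Proof.
rewrite /setI/= !in_itv/= /clamp le_max gt_max gt_min le_min; split.
  by move=> [/andP[-> ->] /andP[-> ->]]; rewrite /= orbT.
move=> /andP[/andP[u0 xu]]; rewrite leNgt u0/= => /andP[uy u1]; move: xu.
by rewrite (ltNge 1) u1 orbF uy => ->.
Qed.

Lemma mder_ge0 (g : curve) t : 0 <= t <= 1 -> (0 <= mder g t)%E.
Proof.
move=> t01; apply: le_ereal_inf_tmp => _ [r /= r0 <-].
have [h [h0 hr th]] : exists h, [/\ 0 < `|h|, `|h| < r & 0 <= t + h <= 1].
  have m0 : 0 < Num.min (r / 2) (1 / 2) by rewrite lt_min !divr_gt0.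
  have mr : Num.min (r / 2) (1 / 2) < r by rewrite gt_min; apply/orP; left; lra.
  have m1 : Num.min (r / 2) (1 / 2) <= 1 / 2 by rewrite ge_min lexx orbT.
  move: t01 => /andP[t0 t1]; have [t2|t2] := leP t (1 / 2).
    by exists (Num.min (r / 2) (1 / 2)); rewrite gtr0_norm//; split => //; lra.
  by exists (- Num.min (r / 2) (1 / 2)); rewrite normrN gtr0_norm//; split => //; lra.
apply: (@le_trans _ _ (d (g (t + h)) (g t) / `|h|)%:E).
  by rewrite lee_fin divr_ge0// mdist_ge0.
by apply: ereal_sup_ubound; exists h => //=; rewrite h0 hr.
Qed.

Lemma mder_le (g : curve) t (a r : R) : 0 < r ->
  (forall h, 0 < `|h| < r -> 0 <= t + h <= 1 -> d (g (t + h)) (g t) <= a * `|h|) ->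
  (mder g t <= a%:E)%E.
Proof.
move=> r0 H; apply: (@le_trans _ _ (ereal_sup [set (d (g (t + h)) (g t) / `|h|)%:E
      | h in [set h | 0 < `|h| < r /\ 0 <= t + h <= 1]])).
  by apply: ereal_inf_lbound; exists r.
apply: ge_ereal_sup => _ [h /= [hr th] <-]; rewrite lee_fin ler_pdivrMr.
  exact: H.
by case/andP: hr.
Qed.

Lemma mder_lt (g : curve) t (a : R) : (mder g t < a%:E)%E ->
  exists2 r, 0 < r & forall h, 0 < `|h| < r -> 0 <= t + h <= 1 ->
    d (g (t + h)) (g t) <= a * `|h|.
Proof.
move=> /ereal_inf_lt[_ [r r0 <-] ra]; exists r => // h hr th.
rewrite -ler_pdivrMr; last by case/andP: hr.
rewrite -lee_fin; apply: le_trans (ltW ra).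
by apply: ereal_sup_ubound; exists h.
Qed.

Section curve.
Variables (g : curve) (f : R -> R).
Hypothesis intf : mu.-integrable `[0, 1] (EFin \o f).
Hypothesis gf : forall s t, 0 <= s -> s <= t -> t <= 1 ->
  ((d (g s) (g t))%:E <= \int[mu]_(u in `[s, t]) (f u)%:E)%E.

Let G : R -> R := (fun x => L * `|f x|) \_ `]0, 1].
Let w (x : R) : R := phi (g (clamp x)).

Let intG : mu.-integrable setT (EFin \o G).
Proof.
rewrite /G -restrict_EFin; apply/integrable_restrict => //=; rewrite setTI.
have i01 : mu.-integrable `]0, 1] (EFin \o f).
  by apply: integrableS intf => //; exact: subset_itv_oc_cc.
have iZ : mu.-integrable `]0, 1] (fun x => L%:E * (`|f x|%R)%:E)%E.
  by apply: integrableZl => //; exact: integrable_norm.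
exact: iZ.
Qed.

Let G0 x : 0 <= G x.
Proof. by rewrite /G patchE; case: ifP => // _; rewrite mulr_ge0// ltW. Qed.

Let Ld_le x y : x <= y ->
  L * d (g (clamp x)) (g (clamp y)) <= \int[mu]_(u in `]x, y]) G u.
Proof.
move=> xy; have cxy := le_clamp xy.
have /andP[cx0 cx1] := clamp01 x; have /andP[cy0 cy1] := clamp01 y.
have sub : `]clamp x, clamp y] `<=` `[0, 1].
  by move=> u /clamp_itv[_]; exact: subset_itv_oc_cc.
have iC : mu.-integrable `]clamp x, clamp y] (EFin \o f) by exact: integrableS intf.
have iN := integrable_norm iC.
rewrite /G -Rintegral_mkcondr (_ : (`]x, y] `&` `]0, 1])%classic = `]clamp x, clamp y]%classic); last first.
  by apply/seteqP; split => u /clamp_itv.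
rewrite RintegralZl//; rewrite ler_pM2l// -lee_fin fineK; last exact: integrable_fin_num.
apply: (le_trans (gf cx0 cxy cy1)).
have mf : measurable_fun (`]clamp x, clamp y]%classic : set (measurableTypeR R)) f.
  by apply/measurable_EFinP; exact: measurable_int iC.
rewrite -integral_itv_obnd_cbnd; last exact/measurable_EFinP.
by apply: le_integral iC iN _ => // u _; rewrite lee_fin ler_norm.
Qed.

Let p : R -> \bar R := (fun s => asc_slope phi (g s) * mder g s)%E \_ `[0, 1].

Let p0 x : (0 <= p x)%E.
Proof.
rewrite /p patchE; case: ifPn => // /set_mem /=; rewrite in_itv/= => x01.
by rewrite mule_ge0 ?asc_slope_ge0 ?mder_ge0.
Qed.

(** The ascending slope controls increases of [phi] only. Running the curve forward, [s = 1], bounds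
    the rise, and running it backward, [s = -1], bounds the fall; [mder] is two-sided, so the
    integrand is the same. *)
Lemma abs_cont_increment_le s : s = 1 \/ s = -1 ->
  ((s * (phi (g 1) - phi (g 0)))%:E <=
     \int[mu]_(t in `[0%R, 1%R]) (asc_slope phi (g t) * mder g t))%E.
Proof.
move=> sE; rewrite integral_mkcond -/p.
have -> : phi (g 1) - phi (g 0) = w 1 - w 0 by rewrite /w !clampE ?lexx ?ler01.
have sn : `|s| = 1 by case: sE => ->; rewrite ?normrN normr1.
have k0 n : 0 < n.+1%:R^-1 :> R by rewrite invr_gt0.
have igS A : measurable A -> mu.-integrable A (EFin \o G).
  by move=> mA; apply: integrableS intG.
apply: (dini_increment_le sE intG G0) => //.
- by move=> x; rewrite /G patchE; case: ifPn => // /set_mem.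
- move=> x y xy; rewrite -/(w x) -/(w y); apply: le_trans (Ld_le xy).
  by apply: (le_trans (phiL _ _)); rewrite metric_sym.
pose F x := \int[mu]_(u in `]-oo, x]) G u.
have FB x y : x <= y -> F y - F x = \int[mu]_(u in `]x, y]) G u.
  by move=> xy; rewrite /F Rintegral_itvB//; exact: igS.
have locG : locally_integrable setT G.
  by have := integrable_locally measurableT intG; rewrite patch_setT.
have FTC := FTC1Ny (fun y => igS _ (measurable_itv `]-oo, y])) locG.
have FF := ae_filter_ringOfSetsType mu.
have ne (a : R) : {ae mu, forall x, x != a}.
  exists [set a]; split => //; first exact: lebesgue_measure_set1.
  by move=> x /= /negP; rewrite negbK => /eqP.
apply: filterS3 FTC (ne 0) (ne 1) => x [dF _] x0 x1 e e0.
have hn n : `|s / n.+1%:R| = n.+1%:R^-1 by rewrite normrM sn mul1r gtr0_norm.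
have [xin|xout] := boolP (0 <= x <= 1); last first.
  have [r r0 Hr] : exists2 r, 0 < r & forall h, `|h| < r -> clamp (x + h) = clamp x.
    move: xout; rewrite negb_and -!ltNge => /orP[xlt|xgt].
      exists (- x) => [|h]; first by rewrite oppr_gt0.
      rewrite ltr_norml => /andP[_ hx]; rewrite /clamp (max_l (_ : Num.min x 1 <= 0)).
        by rewrite max_l// ge_min; apply/orP; left; lra.
      by rewrite ge_min ltW.
    exists (x - 1) => [|h]; first by rewrite subr_gt0.
    rewrite ltr_norml => /andP[hx _]; rewrite /clamp (min_r (_ : 1 <= x)) ?ltW//.
    by rewrite min_r//; lra.
  apply: filterS (near_infty_natSinv_lt (PosNum r0)) => n nr.
  rewrite /w Hr ?hn// subrr mul0r; apply: adde_ge0; first exact: p0.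
  by rewrite lee_fin ltW.
have {xin x0 x1} x01 : 0 < x < 1.
  by move: xin => /andP[]; rewrite !le_eqVlt (eq_sym 0) (negbTE x0) (negbTE x1) /= => -> ->.
have xI : 0 <= x <= 1 by case/andP: x01 => /ltW -> /ltW ->.
rewrite /p patchE ifT; last by rewrite inE/= in_itv.
have S0 := asc_slope_ge0 phi (g x).
have Sfin := asc_slopeK (ltW L0) phiL (g x).
set S := fine _ in Sfin.
have {}S0 : 0 <= S by rewrite -lee_fin Sfin.
(* Where the primitive of [G] is differentiable the curve has finite metric derivative. This
   excludes an infinite factor in the product with a slope that may vanish. *)
have [r r0 Hr] : exists2 r, 0 < r & forall h, 0 < `|h| < r -> 0 <= x + h <= 1 ->
    d (g (x + h)) (g x) <= ((`|derive1 F x| + 1) / L) * `|h|.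
  have [r r0 Hr] := derivable_eps dF erefl ltr01.
  exists r => // h hr xh; rewrite mulrAC ler_pdivlMr// mulrC.
  have h0 : 0 < `|h| by case/andP: hr.
  have HF : `|F (x + h) - F x| <= (`|derive1 F x| + 1) * `|h|.
    rewrite -ler_pdivrMr// -normf_div -[_ / h](subrK (derive1 F x)) addrC.
    by apply: (le_trans (ler_normD _ _)); rewrite lerD2l; exact: Hr.
  apply: le_trans HF; have [hp|hp] := leP 0 h.
    have := @Ld_le x (x + h); rewrite lerDl hp !clampE// metric_sym -FB ?lerDl// => /(_ isT).
    by move/le_trans; apply; exact: ler_norm.
  have := @Ld_le (x + h) x; rewrite gerDl (ltW hp) !clampE// -FB ?gerDl ?(ltW hp)// => /(_ isT).
  by move/le_trans; apply; rewrite distrC; exact: ler_norm.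
have Mle := mder_le r0 Hr.
have M0 := mder_ge0 g xI.
have Mfin : (fine (mder g x))%:E = mder g x.
  by rewrite fineK// ge0_fin_numE//; apply: le_lt_trans Mle _; rewrite ltry.
set M := fine _ in Mfin.
have {}M0 : 0 <= M by rewrite -lee_fin Mfin.
rewrite -Sfin -Mfin.
(* The excess is [z (S + M + z)], which is at most [z (S + M + 1)] as soon as [z <= 1]. *)
have [z z0 zle] : exists2 z, 0 < z & (S + z) * (M + z) <= S * M + e.
  exists (Num.min 1 (e / (S + M + 1))); first by rewrite lt_min ltr01 divr_gt0// ltr_wpDl// addr_ge0.
  set z := Num.min _ _.
  have z1 : z <= 1 by rewrite ge_min lexx.
  have ze : z <= e / (S + M + 1) by rewrite ge_min lexx orbT.
  have z0 : 0 <= z by rewrite le_min ler01 divr_ge0// ?ltW// ltr_wpDl// addr_ge0.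
  move: ze; rewrite ler_pdivlMr ?ltr_wpDl ?addr_ge0// => ze.
  have : z * z <= z by rewrite ler_piMl.
  by nra.
have [r1 r10 H1] := asc_slope_eps (ltW L0) phiL (g x) z0; rewrite -/S in H1.
have [r2 r20 H2] : exists2 r, 0 < r & forall h, 0 < `|h| < r -> 0 <= x + h <= 1 ->
    d (g (x + h)) (g x) <= (M + z) * `|h|.
  by apply: mder_lt; rewrite -Mfin lte_fin ltrDl.
have Mz : 0 < M + z by rewrite ltr_wpDl.
pose r3 := Num.min (Num.min r2 (r1 / (M + z))) (Num.min x (1 - x)).
have r30 : 0 < r3 by rewrite !lt_min r20 divr_gt0//= subr_gt0.
apply: filterS (near_infty_natSinv_lt (PosNum r30)) => n nr.
have {nr} : `|s / n.+1%:R| < r3 by rewrite hn.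
set h := s / n.+1%:R; rewrite !lt_min => /andP[/andP[h2 h1] /andP[hx h1x]].
have xh : 0 <= x + h <= 1.
  by move: hx h1x; rewrite !ltr_norml => /andP[? ?] /andP[? ?]; apply/andP; split; lra.
have h0 : 0 < `|h| by rewrite hn.
have dh : d (g (x + h)) (g x) <= (M + z) * `|h| by apply: H2 => //; rewrite h0 h2.
have dr1 : d (g (x + h)) (g x) < r1.
  by apply: le_lt_trans dh _; rewrite mulrC -ltr_pdivlMr.
rewrite -EFinM -EFinD lee_fin /w !clampE//; apply: le_trans zle.
rewrite -ler_pdivlMr// -hn -/h.
apply: (le_trans (H1 _ dr1)); rewrite -mulrA; apply: ler_wpM2l => //.
by rewrite addr_ge0// ltW.
Qed.

End curve.

Lemma weak_ug_asc_slope (m : probability BX R) : weak_ug m phi (asc_slope phi).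
Proof.
split; first exact: measurable_asc_slope phiL.
  by move=> x; exact: asc_slope_ge0.
move=> P [[A [mA Aac A1]] _ _].
have [N [mN N0 HN]] := ae_of_full_measure mA A1.
exists N; split => // g /= Hg; apply: HN => /Aac[f [intf gf]]; apply: Hg.
have {}intf : mu.-integrable `[0, 1] (EFin \o f) by exact/integrable_lebesgueP.
have := abs_cont_increment_le intf gf (or_introl erefl).
have := abs_cont_increment_le intf gf (or_intror erefl).
rewrite mul1r mulN1r; case: (lerP 0 (phi (g 1) - phi (g 0))) => h.
  by rewrite ger0_norm.
by rewrite ltr0_norm.
Qed.

End slope_weak_upper_gradient.

(** * Densities and Lipschitz approximation *)

Section densities.
Context d (T : measurableType d) (R : realType).
Local Open Scope ereal_scope.

Lemma exists_finite_measure (mu : set T -> \bar R) : mu set0 = 0 ->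
  (forall A, 0 <= mu A) -> semi_sigma_additive mu -> fin_num_fun mu ->
  exists nu : {finite_measure set T -> \bar R}, (nu : set T -> \bar R) = mu.
Proof.
move=> h0 h1 h2 h3.
pose m1 := isMeasure.Build _ _ _ mu h0 h1 h2.
pose mu1 : {measure set T -> \bar R} := HB.pack mu m1.
pose m2 := @Measure_isFinite.Build _ _ _ mu1 h3.
pose mu2 : {finite_measure set T -> \bar R} := HB.pack mu m1 m2.
by exists mu2.
Qed.

Lemma exists_probability (mu : set T -> \bar R) : mu set0 = 0 ->
  (forall A, 0 <= mu A) -> semi_sigma_additive mu -> mu setT = 1 ->
  exists nu : probability T R, (nu : set T -> \bar R) = mu.
Proof.
move=> h0 h1 h2 h3.
pose m1 := isMeasure.Build _ _ _ mu h0 h1 h2.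
pose mu1 : {measure set T -> \bar R} := HB.pack mu m1.
pose m2 := @Measure_isProbability.Build _ _ _ mu1 h3.
pose mu2 : probability T R := HB.pack mu m1 m2.
by exists mu2.
Qed.

Lemma ge0_integral_density (nu : {finite_measure set T -> \bar R})
  (m : {sigma_finite_measure set T -> \bar R}) (f : T -> R) :
  measurable_fun setT f -> (forall x, (0 <= f x)%R) ->
  (forall A, measurable A -> nu A = \int[m]_(x in A) (f x)%:E) ->
  forall h : T -> \bar R, measurable_fun setT h -> (forall x, 0 <= h x) ->
  \int[nu]_x h x = \int[m]_x (h x * (f x)%:E).
Proof.
move=> mf f0 nuf h mh h0.
have mF : measurable_fun setT (EFin \o f) by exact/measurable_EFinP.
have num : nu `<< m.
  apply/null_content_dominatesP => A mA mA0; rewrite nuf//.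
  apply/eqP; rewrite eq_le integral_ge0 ?andbT; last by move=> x _; rewrite lee_fin.
  have := @integral_abs_eq0 _ _ _ m A (EFin \o f) mA (measurable_funTS mF) mA0.
  by move=> <-; apply: ge0_le_lower_integral => x _ /=; rewrite lee_fin ?ler_norm.
rewrite -(Radon_Nikodym_SigmaFinite.change_of_variables num)//.
have irn := Radon_Nikodym_SigmaFinite.f_integrable num.
apply: ae_eq_integral => //.
- by apply: emeasurable_funM => //; exact: measurable_int irn.
- exact: emeasurable_funM.
apply: ae_eqe_mul2l; apply: integral_ae_eq => // E _ mE.
by rewrite -(Radon_Nikodym_SigmaFinite.f_integral num)// nuf.
Qed.

(** On the set where the Radon-Nikodym derivative exceeds [r], its integral is at most that of [r],
    so this set is null. The minimum with [r] then makes the bound hold everywhere. *)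
Lemma exists_density_le (nu m : {finite_measure set T -> \bar R}) (r : T -> R) :
  m.-integrable setT (EFin \o r) -> (forall x, (0 <= r x)%R) ->
  (forall A, measurable A -> nu A <= \int[m]_(x in A) (r x)%:E) ->
  exists f : T -> R, [/\ measurable_fun setT f, (forall x, (0 <= f x <= r x)%R) &
    forall A, measurable A -> nu A = \int[m]_(x in A) (f x)%:E].
Proof.
move=> ir r0 nur.
have mr : measurable_fun setT r by apply/measurable_EFinP; exact: measurable_int ir.
have num : nu `<< m.
  apply/null_content_dominatesP => A mA mA0.
  apply/eqP; rewrite eq_le measure_ge0 andbT (le_trans (nur A mA))//.
  have mF : measurable_fun setT (EFin \o r) by exact/measurable_EFinP.
  have := @integral_abs_eq0 _ _ _ m A (EFin \o r) mA (measurable_funTS mF) mA0.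
  by move=> <-; apply: ge0_le_lower_integral => x _ /=; rewrite lee_fin ?ler_norm.
pose rn := Radon_Nikodym_SigmaFinite.f nu m.
have irn : m.-integrable setT rn := Radon_Nikodym_SigmaFinite.f_integrable num.
have rn0 x : 0 <= rn x := Radon_Nikodym_SigmaFinite.f_ge0 num x.
have rnf x : rn x \is a fin_num := Radon_Nikodym_SigmaFinite.f_fin_num num x.
have nurn A : measurable A -> nu A = \int[m]_(x in A) rn x.
  exact: (Radon_Nikodym_SigmaFinite.f_integral num).
pose g x := fine (rn x); have gE x : (g x)%:E = rn x by rewrite fineK.
have gE' : EFin \o g = rn by apply/funext => x /=; rewrite gE.
have mg : measurable_fun setT g.
  by apply/measurable_EFinP; rewrite gE'; exact: measurable_int irn.
have g0 x : (0 <= g x)%R by rewrite fine_ge0.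
pose h x := Num.max (g x - r x)%R 0%R.
have mh : measurable_fun setT h.
  by apply: measurable_maxr => //; exact: measurable_funB.
have h0 x : (0 <= h x)%R by rewrite le_max lexx orbT.
pose B := [set x | (r x < g x)%R].
have mB : measurable B.
  have -> : B = [set x | (r x - g x < 0)%R].
    by apply/seteqP; split => x /=; rewrite subr_lt0.
  by apply: measurable_set_lt; exact: measurable_funB.
have ih : \int[m]_x (h x)%:E = 0.
  apply/eqP; rewrite eq_le integral_ge0 ?andbT; last by move=> x _; rewrite lee_fin.
  have -> : \int[m]_x (h x)%:E = \int[m]_(x in B) ((g x)%:E - (r x)%:E).
    rewrite [RHS]integral_mkcond; apply: eq_integral => x _; rewrite patchE.
    rewrite /h; case: ifPn => [/set_mem /= rg|/negP rg].
      by rewrite max_l ?subr_ge0 ?ltW.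
    by rewrite max_r// subr_le0 leNgt; apply/negP => rg'; apply: rg; rewrite inE.
  have igB : m.-integrable B (EFin \o g).
    by rewrite gE'; apply: integrableS irn.
  have irB : m.-integrable B (EFin \o r) by apply: integrableS ir.
  rewrite (integralB_EFin mB igB irB) leeBlDr ?add0e.
    by under eq_integral do rewrite gE; rewrite -nurn//; exact: nur.
  exact: integrable_fin_num irB.
have hae := ge0_integral_eq0_ae mh h0 ih.
exists (fun x => Num.min (g x) (r x)); split.
- exact: measurable_minr.
- by move=> x; rewrite le_min g0 r0/= ge_min lexx orbT.
move=> A mA; rewrite nurn//; apply: ae_eq_integral => //.
- by apply: measurable_funTS; exact: measurable_int irn.
- by apply/measurable_EFinP; apply: measurable_funTS; exact: measurable_minr.
apply: filterS hae => x hx _; rewrite -gE; congr EFin; rewrite min_l//.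
by rewrite -subr_le0 -hx /h le_max lexx.
Qed.

Lemma density_probability (P : probability T R) (f : T -> R) :
  measurable_fun setT f -> (forall x, (0 <= f x)%R) -> \int[P]_x (f x)%:E = 1 ->
  exists Q : probability T R,
    (forall A, Q A = \int[P]_(x in A) (f x)%:E) /\
    (forall h : T -> \bar R, measurable_fun setT h -> (forall x, 0 <= h x) ->
      \int[Q]_x h x = \int[P]_x (h x * (f x)%:E)).
Proof.
move=> mf f0 f1; have F0 x : 0 <= (f x)%:E by rewrite lee_fin.
have [||||Q QE] := @exists_probability (fun A => \int[P]_(x in A) (f x)%:E).
- by rewrite integral_set0.
- by move=> A; apply: integral_ge0.
- by apply: semi_sigma_additive_nng_induced => //; exact/measurable_EFinP.
- by [].
exists Q; split; first by rewrite QE.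
have QE' A : Q A = \int[P]_(x in A) (f x)%:E by rewrite QE.
by apply: ge0_integral_density => // A _; exact: QE'.
Qed.

Lemma pushforward_probability d' (T' : measurableType d') (P : probability T R)
  (phi : T -> T') : measurable_fun setT phi ->
  exists Q : probability T' R,
    (forall A, Q A = P (phi @^-1` A)) /\
    (forall h : T' -> \bar R, measurable_fun setT h -> (forall x, 0 <= h x) ->
      \int[Q]_x h x = \int[P]_x h (phi x)).
Proof.
move=> mphi; pose X : {mfun T >-> T'} := HB.pack phi (isMeasurableFun.Build _ _ _ _ _ mphi).
exists (distribution P X); split => // h mh h0.
by rewrite ge0_integral_pushforward.
Qed.

(** Conditioning on [E]. The identities are stated after multiplication by [P E], which avoids
    inverses of extended reals. *)
Lemma restrict_probability (P : probability T R) (E : set T) :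
  measurable E -> 0 < P E ->
  exists Q : probability T R,
    (forall A, measurable A -> Q A * P E = P (A `&` E)) /\
    (forall h : T -> \bar R, measurable_fun setT h -> (forall x, 0 <= h x) ->
      \int[Q]_x h x * P E = \int[P]_(x in E) h x).
Proof.
move=> mE PE0; have PEf : P E \is a fin_num by exact: fin_num_measure.
have p0 : (0 < fine (P E))%R by rewrite fine_gt0// PE0 -ge0_fin_numE.
have mi : measurable_fun setT (\1_E : T -> R) by exact: measurable_indic.
have H (h : T -> \bar R) : measurable_fun setT h -> (forall x, 0 <= h x) ->
    \int[P]_x (h x * ((fine (P E))^-1 * \1_E x)%:E) * P E = \int[P]_(x in E) h x.
  move=> mh h0; rewrite -{2}(fineK PEf) -ge0_integralZr//; last 3 first.
  - by apply: emeasurable_funM => //; apply/measurable_EFinP; exact: measurable_funM.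
  - by move=> x _; rewrite mule_ge0// lee_fin mulr_ge0 ?invr_ge0 ?(ltW p0)// indicE ler0n.
  - by rewrite lee_fin ltW.
  rewrite [RHS]integral_mkcond; apply: eq_integral => x _.
  rewrite patchE indicE -muleA -EFinM mulrAC mulVf ?gt_eqF// mul1r.
  by case: (x \in E); rewrite ?mule1 ?mule0.
have [||  |Q [QE Qh]] := @density_probability P (fun x => (fine (P E))^-1 * \1_E x)%R.
- exact: measurable_funM.
- by move=> x; rewrite mulr_ge0 ?invr_ge0 ?(ltW p0)// indicE ler0n.
- under eq_integral do rewrite EFinM.
  rewrite ge0_integralZl//; last 2 first.
  - exact/measurable_EFinP.
  - by rewrite lee_fin invr_ge0 ltW.
  by rewrite integral_indic// setIT -[X in (_ * X)%E](fineK PEf) -EFinM mulVf ?gt_eqF.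
exists Q; split; last by move=> h mh h0; rewrite Qh// H.
move=> A mA; have mA1 : measurable_fun setT (fun x => (\1_A x)%:E : \bar R).
  by apply/measurable_EFinP; exact: measurable_indic.
have A0 x : 0 <= (\1_A x : R)%:E by rewrite lee_fin indicE ler0n.
have := Qh _ mA1 A0; rewrite integral_indic// setIT => ->.
by rewrite H// integral_indic// setIC.
Qed.

End densities.

Lemma ereal_cvg0_lt {R : realType} (u : nat -> \bar R) : u @ \oo --> 0%E ->
  forall e : R, 0 < e -> exists n, (u n < e%:E)%E.
Proof.
move=> u0 e e0; have : nbhs (0%E : \bar R) [set x | (x < e%:E)%E].
  by apply: open_nbhs_nbhs; split; [exact: open_ereal_lt_ereal|rewrite /= lte_fin].
by move=> /u0 [n _ /(_ n (leqnn n))]; exists n.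
Qed.

(** * Approximation by Lipschitz functions in weighted L1 *)

Section lipschitz_density.
Context {R : realType} {X : pmetricType R}.
Local Notation d := (@mdist R X).
Local Notation BX := (@BX R X).
Hypothesis cX : compact [set: X].

Lemma open_bigcup_balls : exists (c : nat -> X) (r : nat -> R), forall U : set X, open U ->
  U = \bigcup_(k in [set k | [set y | d (c k) y < r k] `<=` U]) [set y | d (c k) y < r k].
Proof.
have [p Hp] := dense_sequence cX.
pose u k : nat * nat := odflt (0, 0)%N (@choice.unpickle (nat * nat)%type k).
exists (fun k => p (u k).1), (fun k => (u k).2.+1%:R^-1) => U /open_mdistP oU.
apply/seteqP; split=> [x /oU[e e0 eU]|x [k kU /kU]//].
have [n /= ne] := @ltr_add_invr R 0 (e / 2) (divr_gt0 e0 (ltr0Sn _ 1)).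
rewrite add0r in ne.
have [k kx] := Hp x n.+1%:R^-1 (ltac:(by rewrite invr_gt0)).
exists (choice.pickle (k, n)); rewrite /= /u choice.pickleK//= => y /= ky; apply: eU.
have := metric_triangle x (p k) y; rewrite (metric_sym x (p k)).
by move: (n.+1%:R^-1) ne kx ky => q *; lra.
Qed.

(** Every open set is a union of countably many balls taken from one sequence, so balls, complements
    and countable unions already generate the Borel sets. *)
Lemma measurable_BX_ind (D : set (set X)) :
  (forall c r, D [set y | d c y < r]) -> (forall A, D A -> D (~` A)) ->
  (forall F : nat -> set X, (forall i, D (F i)) -> D (\bigcup_i F i)) ->
  forall A : set BX, measurable A -> D A.
Proof.
move=> Db DC DU; have D0 : D set0.
  rewrite (_ : set0 = [set y | d point y < 0])//.
  by apply/seteqP; split => y //=; rewrite ltNge mdist_ge0.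
apply: smallest_sub; first split => //.
- by move=> A DA; rewrite setTD; exact: DC.
have [c [r cr]] := open_bigcup_balls.
move=> U /cr ->; rewrite bigcup_mkcond; apply: DU => k.
by case: ifP.
Qed.

Lemma lipschitz_max (f g : X -> R) : Defs.lipschitz f -> Defs.lipschitz g ->
  Defs.lipschitz (fun x => Num.max (f x) (g x)).
Proof.
move=> /(lipschitzZ (-1)) lf /(lipschitzZ (-1)) lg.
have := lipschitzZ (-1) (lipschitz_min lf lg).
by under eq_fun do rewrite !mulN1r oppr_min !opprK.
Qed.

(** The values of [h] are kept in [[0, 1]] because such functions later serve as cutoffs. *)
Definition approx (m : probability BX R) (w : X -> R) (f : X -> R) :=
  forall e, 0 < e -> exists h : X -> R, [/\ Defs.lipschitz h, (forall x, 0 <= h x <= 1) &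
    (\int[m]_x (`|f x - h x| * w x)%:E <= e%:E)%E].

(** The sets that can be approximated form a sigma-algebra containing the balls: truncated distance
    functions serve for balls, [1 - h] for complements, maxima for finite unions, and dominated
    convergence passes to countable ones. *)
Lemma lipschitz_approx_indic (m : probability BX R) (w : X -> R) :
  m.-integrable setT (EFin \o w : BX -> \bar R) -> (forall x, 0 <= w x) ->
  forall A : set BX, measurable A -> approx m w \1_A.
Proof.
move=> iw w0; have mw : measurable_fun setT (w : BX -> R).
  by apply/measurable_EFinP; exact: measurable_int iw.
suff: forall A : set BX, measurable A -> measurable A /\ approx m w \1_A.
  by move=> H A mA; have [] := H A mA.
have dct (f : nat -> X -> R) (g : X -> R) :
    (forall n, measurable_fun setT (f n : BX -> R)) -> measurable_fun setT (g : BX -> R) ->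
    (forall n x, `|g x - f n x| <= 1) -> (forall x, f n x @[n --> \oo] --> g x) ->
    (fun n => \int[m]_x (`|g x - f n x| * w x)%:E)%E @ \oo --> 0%E.
  move=> mf mg f1 fg.
  have [|||||] := @dominated_convergence _ BX R m setT measurableT
    (fun n x => (`|g x - f n x| * w x)%:E) (cst 0%E) (EFin \o w).
  - move=> n; apply/measurable_EFinP; apply: measurable_funM => //.
    by apply: measurableT_comp => //; exact: measurable_funB.
  - exact: measurable_cst.
  - apply: nearW => x _; apply: cvg_EFin; first exact: nearW.
    rewrite [X in _ --> X](_ : _ = `|g x - g x| * w x); last by rewrite subrr normr0 mul0r.
    by apply: cvgMl; apply: cvg_norm; apply: cvgB => //; exact: cvg_cst.
  - exact: iw.
  - apply: nearW => x n _ /=; rewrite lee_fin normrM normr_id (ger0_norm (w0 x)).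
    by rewrite ler_piMl.
  by move=> _ _; rewrite integral0.
have tri (f g h : X -> R) (a b : R) :
    measurable_fun setT (f : BX -> R) -> measurable_fun setT (g : BX -> R) ->
    measurable_fun setT (h : BX -> R) ->
    (\int[m]_x (`|f x - g x| * w x)%:E <= a%:E)%E ->
    (\int[m]_x (`|g x - h x| * w x)%:E <= b%:E)%E ->
    (\int[m]_x (`|f x - h x| * w x)%:E <= (a + b)%:E)%E.
  move=> mf mg mh fg gh; rewrite EFinD; apply: le_trans (leeD fg gh).
  have mm (u v : BX -> R) : measurable_fun setT u -> measurable_fun setT v ->
      measurable_fun setT (fun x : BX => (`|u x - v x| * w x)%:E).
    move=> mu_ mv; apply/measurable_EFinP; apply: measurable_funM => //.
    by apply: measurableT_comp => //; exact: measurable_funB.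
  have pos (u v : BX -> R) x : (0 <= (`|u x - v x| * w x)%:E)%E.
    by rewrite lee_fin mulr_ge0.
  rewrite -ge0_integralD//; [|exact: mm..].
  apply: ge0_le_lower_integral => // x _.
  rewrite -EFinD lee_fin -mulrDl ler_wpM2r//.
  by rewrite (le_trans _ (ler_normD _ _))// addrA subrK.
have m1 (A : set BX) : measurable A -> measurable_fun setT (\1_A : BX -> R).
  by move=> mA; exact: measurable_indic.
apply: measurable_BX_ind.
- move=> c r; set B := [set y | d c y < r].
  have mB : measurable (B : set BX) by apply: measurable_open; exact: open_mball.
  split => // e e0.
  pose h n y : R := Num.min 1 (Num.max 0 (n.+1%:R * (r - d c y))).
  have lh n : Defs.lipschitz (h n).
    apply: lipschitz_min; first exact: lipschitz_cst.
    apply: lipschitz_max; first exact: lipschitz_cst.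
    by apply: lipschitzZ; apply: lipschitzB; [exact: lipschitz_cst|exact: lipschitz_mdist].
  have h01 n y : 0 <= h n y <= 1.
    by rewrite /h le_min ler01 le_max lexx/= ge_min lexx.
  have cv : (fun n => \int[m]_x (`|\1_B x - h n x| * w x)%:E)%E @ \oo --> 0%E.
  apply: dct.
  + by move=> n; exact: measurable_fun_lipschitz.
  + exact: m1.
  + move=> n y; have /andP[h0 h1] := h01 n y; rewrite indicE ler_norml.
    by case: (y \in B); apply/andP; split; rewrite /=; lra.
  + move=> y; apply: cvg_near_cst; rewrite indicE; case: (boolP (y \in B)) => [/set_mem yB|/negP yB].
      have r0 : 0 < r - d c y by rewrite subr_gt0.
      apply: filterS (near_infty_natSinv_lt (PosNum r0)) => n /ltW/= nr.
      rewrite /h min_l// le_max; apply/orP; right.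
      by rewrite -ler_pdivrMl// mulr1.
    apply: nearW => n; rewrite /h max_l ?min_r//.
    rewrite pmulr_rle0// subr_le0 leNgt; apply/negP => yr; apply: yB.
    by rewrite inE.
  have [n hn] := ereal_cvg0_lt cv e0.
  by exists (h n); split => //; exact: ltW.
- move=> A [mA aA]; split; first exact: measurableC.
  move=> e /aA[h [lh h01 hA]]; exists (fun x => 1 - h x); split.
  + by apply: lipschitzB => //; exact: lipschitz_cst.
  + by move=> x; have /andP[? ?] := h01 x; apply/andP; split; lra.
  + rewrite [leLHS](_ : _ = \int[m]_x (`|\1_A x - h x| * w x)%:E)%E//.
    apply: eq_integral => x _; congr (_ * _)%:E; rewrite !indicE in_setC.
    by case: (x \in A); rewrite /= -normrN; congr `|_|; lra.
move=> F HF; pose U n := \big[setU/set0]_(i < n) F i.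
have mF i : measurable (F i : set BX) by case: (HF i).
have mU n : measurable (U n : set BX) by exact: bigsetU_measurable.
have mUU : measurable (\bigcup_i F i : set BX) by exact: bigcupT_measurable.
split => //; have aU n : approx m w \1_(U n).
  elim: n => [|n IH] e e0.
    exists (fun=> 0); split.
    + exact: lipschitz_cst.
    + by move=> x; rewrite lexx ler01.
    + rewrite integral0_eq ?lee_fin ?ltW// => x _.
      by rewrite /U big_ord0 indicE in_set0 subrr normr0 mul0r.
  have [_ /(_ (e / 2))] := HF n; case; first by rewrite divr_gt0.
  move=> h2 [l2 h201 H2]; have [|h1 [l1 h101 H1]] := IH (e / 2); first by rewrite divr_gt0.
  exists (fun x => Num.max (h1 x) (h2 x)); split; first exact: lipschitz_max.
    move=> x; rewrite le_max ge_max; have /andP[-> ->] := h101 x.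
    by have /andP[_ ->] := h201 x.
  have ml1 := measurable_fun_lipschitz l1; have ml2 := measurable_fun_lipschitz l2.
  have mm (u v : BX -> R) : measurable_fun setT u -> measurable_fun setT v ->
      measurable_fun setT (fun x : BX => (`|u x - v x| * w x)%:E).
    move=> mu_ mv; apply/measurable_EFinP; apply: measurable_funM => //.
    by apply: measurableT_comp => //; exact: measurable_funB.
  rewrite [e]splitr EFinD; apply: le_trans (leeD H1 H2).
  rewrite -ge0_integralD//; last 4 first.
  + by move=> x _; rewrite lee_fin mulr_ge0.
  + by apply: mm => //; exact: m1.
  + by move=> x _; rewrite lee_fin mulr_ge0.
  + by apply: mm => //; exact: m1.
  apply: ge0_le_lower_integral => x _; first by rewrite lee_fin mulr_ge0.
  rewrite -EFinD lee_fin -mulrDl ler_wpM2r//.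
  rewrite /U big_ord_recr/= !indicE in_setU -/(U n).
  have /andP[a0 a1] := h101 x; have /andP[b0 b1] := h201 x.
  have N1 := ler_norm (h1 x); have N2 := ler_norm (h2 x).
  case: (x \in U n); case: (x \in F n) => /=;
    rewrite ?sub0r ?normrN ?(ger0_norm (_ : 0 <= 1 - _)) ?subr_ge0 ?ge_max ?a1 ?b1 ?(ger0_norm a0) ?(ger0_norm b0) //;
    case: (leP (h1 x) (h2 x)) => ?; rewrite ?(ger0_norm a0) ?(ger0_norm b0); lra.
move=> e e0; have e20 : 0 < e / 2 by rewrite divr_gt0.
have cv : (fun n => \int[m]_x (`|\1_(\bigcup_i F i) x - \1_(U n) x| * w x)%:E)%E @ \oo --> 0%E.
apply: dct.
- by move=> n; exact: m1.
- exact: m1.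
- by move=> n x; rewrite !indicE ler_norml; case: (x \in _); case: (x \in _); apply/andP; split; rewrite /=; lra.
- move=> x; apply: cvg_near_cst; rewrite indicE; case: (boolP (x \in _)) => [/set_mem [i _ Fix]|/negP xF].
    exists i.+1 => // n /= ni; rewrite indicE mem_set//.
    by rewrite /U -bigcup_mkord; exists i.
  apply: nearW => n; rewrite indicE memNset// /U -bigcup_mkord => -[i _ Fi].
  by apply: xF; rewrite inE; exists i.
have [n hn] := ereal_cvg0_lt cv e20.
have [h [lh h01 Hh]] := aU n _ e20; exists h; split => //.
rewrite [e]splitr; apply: tri (ltW hn) Hh; [exact: m1|exact: m1|].
exact: measurable_fun_lipschitz.
Qed.

(* Halving: removing [M / 2] times the indicator of [{g >= M / 2}] halves the
   bound on [g]. *)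
Lemma lipschitz_approx_bounded (m : probability BX R) (g : X -> R) (M : R) :
  measurable_fun setT (g : BX -> R) -> (forall x, 0 <= g x <= M) ->
  forall e, 0 < e -> exists2 h : X -> R, Defs.lipschitz h &
    (\int[m]_x `|g x - h x|%:E <= e%:E)%E.
Proof.
move=> mg gM e e0.
suff H n : forall (g : X -> R) (M : R), measurable_fun setT (g : BX -> R) ->
    (forall x, 0 <= g x <= M) -> forall e, 0 < e -> exists2 h : X -> R, Defs.lipschitz h &
    (\int[m]_x `|g x - h x|%:E <= (M / 2 ^+ n + e)%:E)%E.
  have [n Mn] : exists n : nat, M / 2 ^+ n <= e / 2.
    exists (Num.truncn (2 * M / e)).+1.
    rewrite ler_pdivrMr ?exprn_gt0//.
    have Me : 2 * M / e < (Num.truncn (2 * M / e)).+1%:R by rewrite truncnS_gt.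
    have n2 : ((Num.truncn (2 * M / e)).+1%:R <= 2 ^+ (Num.truncn (2 * M / e)).+1 :> R).
      by rewrite -natrX ler_nat ltnW// ltn_expl.
    move: (lt_le_trans Me n2); rewrite ltr_pdivrMr// => /ltW; nra.
  have [h lh Hh] := H n g M mg gM (e / 2) (divr_gt0 e0 (ltr0Sn _ 1)).
  by exists h => //; apply: le_trans Hh _; rewrite lee_fin; lra.
elim: n => [|n IH] {}g {}M {}mg {}gM {}e {}e0.
  exists (fun=> 0); first exact: lipschitz_cst.
  apply: (@le_trans _ _ (\int[m]_x M%:E)%E).
    apply: ge0_le_lower_integral => x _; rewrite lee_fin// subr0.
    by have /andP[g0 ?] := gM x; rewrite ger0_norm.
  by rewrite integral_cst//= probability_setT mule1 expr0 divr1 lee_fin lerDl ltW.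
have M0 : 0 <= M by have /andP[/le_trans h /h] := gM point.
pose B := [set x : BX | - g x <= - (M / 2)].
have mB : measurable B by apply: measurable_set_le; exact: measurableT_comp.
have mi : measurable_fun setT (\1_B : BX -> R) by exact: measurable_indic.
pose g' x := g x - M / 2 * \1_B x.
have mg' : measurable_fun setT (g' : BX -> R).
  by apply: measurable_funB => //; exact: measurable_funM.
have g'M x : 0 <= g' x <= M / 2.
  have /andP[g0 g1] := gM x; rewrite /g' indicE; case: (boolP (x \in B)) => [/set_mem|].
    by rewrite /B/= lerN2 => ?; apply/andP; split; rewrite /=; lra.
  by rewrite notin_setE /B/= lerN2 => /negP; rewrite -ltNge => ?; apply/andP; split; rewrite /=; lra.
have [h1 l1 H1] := IH g' _ mg' g'M _ (divr_gt0 e0 (ltr0Sn _ 1)).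
have i1 : m.-integrable setT (EFin \o (fun=> 1) : BX -> \bar R).
  exact: finite_measure_integrable_cst.
(* The indicator enters with the factor [M / 2], so this accuracy costs at most the remaining
   [e / 2]. *)
have eM : 0 < e / (M + 1) by rewrite divr_gt0// ltr_wpDl.
have [h2 [l2 _ H2]] := lipschitz_approx_indic i1 (fun=> ler01) mB eM.
exists (fun x => h1 x + M / 2 * h2 x).
  by apply: lipschitzD => //; exact: lipschitzZ.
have ml1 := measurable_fun_lipschitz l1; have ml2 := measurable_fun_lipschitz l2.
have mm1 : measurable_fun setT (fun x : BX => `|g' x - h1 x|%:E).
  by apply/measurable_EFinP; apply: measurableT_comp => //; exact: measurable_funB.
have mm2 : measurable_fun setT (fun x : BX => (`|\1_B x - h2 x| * 1)%:E).
  apply/measurable_EFinP; apply: measurable_funM => //.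
  by apply: measurableT_comp => //; exact: measurable_funB.
apply: (@le_trans _ _ (\int[m]_x (`|g' x - h1 x|%:E + (M / 2)%:E * (`|\1_B x - h2 x| * 1)%:E))%E).
  apply: ge0_le_lower_integral => x _; rewrite lee_fin// /g'.
  have M20 : 0 <= M / 2 by rewrite divr_ge0.
  rewrite mulr1 -(ger0_norm M20) -normrM (ger0_norm M20).
  rewrite (le_trans _ (ler_normD _ _))//.
  by rewrite le_eqVlt; apply/orP; left; apply/eqP; congr `|_|; ring.
rewrite ge0_integralD//; last 2 first.
- by move=> x _; rewrite mule_ge0// ?lee_fin ?divr_ge0// mulr_ge0.
- exact: measurable_funeM.
rewrite ge0_integralZl//; last by rewrite lee_fin divr_ge0.
have := leeD H1 (lee_wpmul2l _ H2) => /(_ (M / 2)%:E); rewrite lee_fin divr_ge0// => /(_ isT).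
move=> /le_trans; apply; rewrite -EFinM -EFinD lee_fin exprS.
have -> : M / 2 / 2 ^+ n + e / 2 + M / 2 * (e / (M + 1)) =
   M / (2 * 2 ^+ n) + (e / 2 + (e / 2) * (M / (M + 1))).
  by field; rewrite expf_neq0//= gt_eqF// ltr_wpDl.
rewrite lerD2l; have : M / (M + 1) <= 1 by rewrite ler_pdivrMr ?mul1r ?lerDl ?ler01// ltr_wpDl.
by move=> ?; nra.
Qed.

End lipschitz_density.

(** * Displacement convexity *)

Section curvature_dimension.
Context {R : realType} {X : pmetricType R}.
Local Notation d := (@mdist R X).
Local Notation BX := (@BX R X).
Local Notation Curves := (@Curves R X).
Hypothesis cX : compact [set: X].
Variable m : probability BX R.

(** The left side is the tangent at [a] of the convex function [x ln x]. *)
Lemma xlnx_ge (a x : R) : 0 < a -> 0 <= x -> x * (ln a + 1) - a <= x * ln x.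
Proof.
move=> a0; rewrite le_eqVlt => /orP[/eqP<-|x0]; first by rewrite !mul0r sub0r oppr_le0 ltW.
have ax : 0 < a / x by rewrite divr_gt0.
have : ln (a / x) <= a / x - 1.
  by have := @le_ln1Dx R (a / x - 1); rewrite (addrC 1) subrK; apply; lra.
rewrite ln_div ?posrE// -(ler_pM2l x0) mulrBr mulrBr mulr1 mulrCA divff ?gt_eqF// mulr1.
by rewrite mulrDr mulr1; lra.
Qed.

Lemma measurable_fun_xlnx (f : BX -> R) : measurable_fun setT f ->
  measurable_fun setT (fun x => f x * ln (f x)).
Proof. by move=> mf; apply: measurable_funM => //; apply: measurableT_comp. Qed.

(** The tangent bound is integrated over [A], outside of which the density vanishes almost
    everywhere. The choice [a = 1 / m A] would give Jensen's bound [- ln (m A)]; a free [a] also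
    covers null sets [A]. *)
Lemma Ent_ge (mu : probability BX R) (A : set BX) (a : R) :
  measurable A -> mu A = 1%E -> 0 < a ->
  ((ln a + 1)%:E - a%:E * m A <= Ent m mu)%E.
Proof.
move=> mA A1 a0; apply: le_ereal_inf_tmp => _ [rho [mrho rho0 murho] <-].
have irho : m.-integrable setT (EFin \o rho : BX -> \bar R).
  apply/integrableP; split; first exact/measurable_EFinP.
  have := murho _ measurableT; rewrite probability_setT => E1.
  rewrite (eq_integral (fun x : BX => (rho x)%:E)) -?E1 ?ltry// => x _ /=.
  by rewrite ger0_norm.
have iA : m.-integrable setT (EFin \o \1_A : BX -> \bar R) by exact: integrable_indic.
pose k (x : BX) := rho x * (ln a + 1) - a * \1_A x.
have ik1 : m.-integrable setT (EFin \o (fun x => rho x * (ln a + 1)) : BX -> \bar R).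
  exact: (integrableZr measurableT (ln a + 1) irho).
have ik2 : m.-integrable setT (EFin \o (fun x => a * \1_A x) : BX -> \bar R).
  exact: (integrableZl measurableT a iA).
have Ik : (\int[m]_x (k x)%:E = (ln a + 1)%:E - a%:E * m A)%E.
  rewrite (integralB_EFin measurableT ik1 ik2); congr (_ - _)%E.
    have -> : (\int[m]_x (rho x * (ln a + 1))%:E = \int[m]_x ((rho x)%:E * (ln a + 1)%:E))%E by [].
    by rewrite integralZr// -murho// probability_setT mul1e.
  have -> : (\int[m]_x (a * \1_A x)%:E = \int[m]_x (a%:E * (\1_A x)%:E))%E by [].
  by rewrite integralZl// integral_indic// setIT.
rewrite -Ik; have mrl := measurable_fun_xlnx mrho.
have mk : measurable_fun setT k.
  by apply: measurable_funB; apply: measurable_funM => //; exact: measurable_indic.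
have rhoA : {ae m, forall x : BX, ~ A x -> rho x = 0}.
  have mC : measurable (~` A) by exact: measurableC.
  have I0 : (\int[m]_x (rho x * \1_(~` A) x)%:E = 0)%E.
    have -> : (\int[m]_x (rho x * \1_(~` A) x)%:E = \int[m]_(x in ~` A) (rho x)%:E)%E.
      rewrite [RHS]integral_mkcond; apply: eq_integral => x _; rewrite patchE indicE.
      by case: ifPn; rewrite ?mulr1 ?mulr0.
    by rewrite -murho// probability_setC// A1 subee.
  have m1 : measurable_fun setT (fun x : BX => rho x * \1_(~` A) x).
    by apply: measurable_funM => //; exact: measurable_indic.
  have p1 (x : BX) : 0 <= rho x * \1_(~` A) x by rewrite mulr_ge0// indicE ler0n.
  apply: filterS (ge0_integral_eq0_ae m1 p1 I0).
  by move=> x + nA; rewrite indicE mem_set// mulr1.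
have hk : {ae m, forall x : BX, k x <= rho x * ln (rho x)}.
  apply: filterS rhoA => x rx; rewrite /k indicE; case: (boolP (x \in A)) => [_|/negP xA].
    by rewrite mulr1 xlnx_ge.
  by rewrite rx ?mul0r ?mulr0 ?subr0// => Ax; apply: xA; rewrite inE.
(* Nothing is known about integrability of [rho ln rho], so positive and negative parts are compared
   separately. *)
rewrite integralE [leRHS]integralE; apply: leeB.
  apply: ae_ge0_le_integral => //.
  - by apply: measurable_funepos; exact/measurable_EFinP.
  - by apply: measurable_funepos; exact/measurable_EFinP.
  - apply: filterS hk => x hx _; rewrite !funeposE ge_max le_max lee_fin hx/=.
    by rewrite le_max lexx orbT.
apply: ae_ge0_le_integral => //.
- by apply: measurable_funeneg; exact/measurable_EFinP.
- by apply: measurable_funeneg; exact/measurable_EFinP.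
- apply: filterS hk => x hx _; rewrite !funenegE ge_max le_max leeN2 lee_fin hx/=.
  by rewrite le_max lexx orbT.
Qed.

Lemma Ent_le (mu : probability BX R) (C : R) : 0 < C ->
  (forall A, measurable A -> mu A <= C%:E * m A)%E -> (Ent m mu <= (ln C)%:E)%E.
Proof.
move=> C0 muC.
have iC : m.-integrable setT (EFin \o (fun=> C) : BX -> \bar R).
  exact: finite_measure_integrable_cst.
have [|f [mf fC muf]] := @exists_density_le _ BX R mu m (fun=> C) iC (fun=> ltW C0).
  by move=> A mA; rewrite integral_cst//; exact: muC.
have f0 x : 0 <= f x by case/andP: (fC x).
have fC' x : f x <= C by case/andP: (fC x).
have lnC x : f x * ln (f x) <= f x * ln C.
  have [->|fx] := eqVneq (f x) 0; first by rewrite !mul0r.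
  by apply: ler_wpM2l => //; rewrite ler_ln ?posrE// lt_neqAle eq_sym fx f0.
apply: (@le_trans _ _ (\int[m]_x (f x * ln (f x))%:E)%E).
  by apply: ereal_inf_lbound; exists f.
have i1 : m.-integrable setT (EFin \o f : BX -> \bar R).
  by apply: (bounded_integrable m mf (M := C)) => x; rewrite ger0_norm.
have iC1 : m.-integrable setT (EFin \o (fun x => f x * ln C) : BX -> \bar R).
  exact: (integrableZr measurableT (ln C) i1).
have i2 : m.-integrable setT (EFin \o (fun x => f x * ln (f x)) : BX -> \bar R).
  apply: (bounded_integrable m (measurable_fun_xlnx mf) (M := 1 + C * `|ln C|)) => x.
  have := xlnx_ge ltr01 (f0 x); rewrite ln1 add0r mulr1 => h.
  rewrite ler_norml; apply/andP; split.
    have := f0 x; have := mulr_ge0 (ltW C0) (normr_ge0 (ln C)); lra.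
  apply: (le_trans (lnC x)); rewrite -[leLHS]add0r lerD//.
  apply: (le_trans (ler_wpM2l (f0 x) (ler_norm _))).
  by rewrite ler_wpM2r.
have lnC' (x : BX) : x \in (setT : set BX) -> ((f x * ln (f x))%:E <= (f x * ln C)%:E)%E.
  by rewrite lee_fin.
apply: (le_trans (@le_integral _ BX R m setT measurableT _ _ i2 iC1 lnC')).
rewrite [leLHS](_ : _ = \int[m]_x ((f x)%:E * (ln C)%:E))%E//.
rewrite integralZr// (_ : \int[m]_x (f x)%:E = 1)%E ?mul1e//.
by rewrite -muf//; exact: probability_setT.
Qed.

Lemma Ent_fin_num (mu : probability BX R) (C : R) : 0 < C ->
  (forall A, measurable A -> mu A <= C%:E * m A)%E -> Ent m mu \is a fin_num.
Proof.
move=> C0 muC; rewrite fin_numE; apply/andP; split; apply/negP => /eqP E.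
  have := Ent_ge measurableT (probability_setT mu) ltr01.
  by rewrite E probability_setT mule1 ln1 add0r -EFinB.
by have := Ent_le C0 muC; rewrite E.
Qed.

Lemma W2sq_ge0 (mu nu : set BX -> \bar R) : (0 <= W2sq mu nu)%E.
Proof.
apply: le_ereal_inf_tmp => _ [P _ <-]; apply: integral_ge0 => z _.
by rewrite lee_fin sqr_ge0.
Qed.

Lemma W2sq_le (D : R) (mu nu : set BX -> \bar R) (P : probability (BX * BX)%type R) :
  (forall x y, d x y <= D) -> coupling mu nu P -> (W2sq mu nu <= (D ^+ 2)%:E)%E.
Proof.
move=> dD cP; apply: (@le_trans _ _ (\int[P]_z ((d z.1 z.2) ^+ 2)%:E)%E).
  by apply: ereal_inf_lbound; exists P.
apply: (@le_trans _ _ (\int[P]_z (D ^+ 2)%:E)%E).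
  apply: ge0_le_lower_integral => z _; rewrite lee_fin ?sqr_ge0//.
  by rewrite ler_pXn2r// ?nnegrE ?(le_trans _ (dD z.1 z.2)) ?mdist_ge0.
by rewrite integral_cst//= probability_setT mule1.
Qed.

Lemma measurable_ev_pair s t : 0 <= s <= 1 -> 0 <= t <= 1 ->
  measurable_fun setT (fun g : Curves => (ev s g, ev t g) : BX * BX).
Proof. by move=> s01 t01; apply/measurable_fun_pair; exact: measurable_ev. Qed.

Lemma measurable_fun_mdist_ev s t : 0 <= s <= 1 -> 0 <= t <= 1 ->
  measurable_fun setT (fun g : Curves => d (ev s g) (ev t g)).
Proof.
move=> s01 t01; have mp := measurable_ev_pair s01 t01.
exact: (measurableT_comp (measurable_fun_mdist cX) mp).
Qed.

Lemma measurable_ev_preimage t (A : set BX) : 0 <= t <= 1 -> measurable A ->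
  measurable (ev t @^-1` A : set Curves).
Proof.
by move=> t01 mA; rewrite -[X in measurable X]setTI; exact: measurable_ev.
Qed.

(* If [mu_t] charged [A] more than [C m(A)], then conditioning the plan to
   [{ev t \in A}] produces a measure [mu_t^F] concentrated on [A], with entropy at
   least [ln (1 / m(A))], contradicting displacement convexity. *)
Lemma strongCD_density_bound (K D C0 : R) (mu0 mu1 : probability BX R) :
  strongCD m K -> (forall x y, d x y <= D) -> 0 < C0 ->
  (forall A, measurable A -> mu0 A <= C0%:E * m A)%E ->
  (forall A, measurable A -> mu1 A <= C0%:E * m A)%E ->
  exists2 P : probability Curves R, GeoOpt mu0 mu1 P &
    forall t, 0 <= t <= 1 -> forall A : set BX, measurable A ->
      (P (ev t @^-1` A) <= (C0 * expR (`|K| * D ^+ 2 / 8))%:E * m A)%E.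
Proof.
move=> scd dD C00 muC0 muC1.
have [P geoP HF] := scd _ _ (Ent_fin_num C00 muC0) (Ent_fin_num C00 muC1).
exists P => // t t01 A mA; set C := C0 * _.
have i0 : 0 <= (0 : R) <= 1 by rewrite lexx ler01.
have i1 : 0 <= (1 : R) <= 1 by rewrite lexx ler01.
have Cpos : 0 < C by rewrite mulr_gt0// expR_gt0.
rewrite leNgt; apply/negP => CP.
set E := ev t @^-1` A in CP.
have mE : measurable E by exact: measurable_ev_preimage.
have mAf : m A \is a fin_num by exact: fin_num_measure.
have PEf : P E \is a fin_num by exact: fin_num_measure.
set p := fine (P E); have pE : p%:E = P E by rewrite fineK.
have ma : (fine (m A))%:E = m A by rewrite fineK.
have ma0 : 0 <= fine (m A) by rewrite fine_ge0.
have Cp : C * fine (m A) < p by rewrite -lte_fin EFinM ma pE.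
have p0 : 0 < p by apply: le_lt_trans Cp; rewrite mulr_ge0// ltW.
pose F (g : Curves) : R := p^-1 * \1_E g.
have mi : measurable_fun setT (\1_E : Curves -> R) by exact: measurable_indic.
have mF : measurable_fun setT F by exact: measurable_funM.
have F0 g : 0 <= F g by rewrite mulr_ge0 ?invr_ge0 ?(ltW p0)// indicE ler0n.
have FE (B : set Curves) : measurable B -> (\int[P]_(g in B) (F g)%:E = p^-1%:E * P (E `&` B))%E.
  move=> mB; under eq_integral do rewrite EFinM.
  rewrite ge0_integralZl//; last 2 first.
  - by apply/measurable_EFinP; exact: measurable_funTS.
  - by rewrite lee_fin invr_ge0 ltW.
  by rewrite integral_indic.
have F1 : (\int[P]_g (F g)%:E = 1)%E.
  by rewrite FE// setIT -pE -EFinM mulVf ?gt_eqF.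
have [Q [QE Qh]] := density_probability mF F0 F1.
have nuE s : 0 <= s <= 1 -> exists nu : probability BX R, (nu : set BX -> \bar R) = muF P F s.
  move=> s01; have [nu [nuE _]] := pushforward_probability Q (measurable_ev cX s01).
  by exists nu; apply/funext => B; rewrite nuE QE.
have [nu0 nu0E] := nuE 0 i0; have [nu1 nu1E] := nuE 1 i1; have [nut nutE] := nuE t t01.
have FM : exists M, forall g, F g <= M.
  exists p^-1 => g; rewrite /F indicE ler_piMr ?invr_ge0 ?(ltW p0)//.
  by case: (_ \in _).
have := HF F mF F0 FM F1 t t01; rewrite -nu0E -nu1E -nutE.
have [_ marg _] := geoP.
(* Conditioning on an event of probability [p] multiplies a density bound by at most [1 / p]. *)
have nuC s (nu : probability BX R) (mu : probability BX R) : 0 <= s <= 1 ->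
    (nu : set BX -> \bar R) = muF P F s ->
    (forall B, measurable B -> P (ev s @^-1` B) = mu B) ->
    (forall B, measurable B -> mu B <= C0%:E * m B)%E ->
    (Ent m nu <= (ln (C0 / p))%:E)%E.
  move=> s01 nuE1 Pmu muC; apply: Ent_le; first by rewrite divr_gt0.
  move=> B mB; rewrite nuE1 /muF FE; last exact: measurable_ev_preimage.
  rewrite (mulrC C0) EFinM -muleA lee_wpmul2l ?lee_fin ?invr_ge0 ?(ltW p0)//.
  apply: le_trans (muC _ mB); rewrite -Pmu//; apply: le_measure; rewrite ?inE.
  - by apply: measurableI => //; exact: measurable_ev_preimage.
  - exact: measurable_ev_preimage.
  - by move=> g [].
have e0 := nuC 0 nu0 mu0 i0 nu0E (fun B mB => (marg B mB).1) muC0.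
have e1 := nuC 1 nu1 mu1 i1 nu1E (fun B mB => (marg B mB).2) muC1.
have [c01 [c01E _]] := pushforward_probability Q (measurable_ev_pair i0 i1).
have wD : (W2sq nu0 nu1 <= (D ^+ 2)%:E)%E.
  apply: (W2sq_le dD (P := c01)) => B mB; rewrite !c01E nu0E nu1E /muF -!QE.
  by split; congr (Q _); apply/seteqP; split => g //= [].
have w0 := W2sq_ge0 nu0 nu1.
have wf : (fine (W2sq nu0 nu1))%:E = W2sq nu0 nu1.
  by rewrite fineK// ge0_fin_numE//; apply: le_lt_trans wD _; rewrite ltry.
move: wD w0; rewrite -wf !lee_fin; set w := fine _ => wD w0.
apply/negP; rewrite -ltNge.
have nutA : nut A = 1%E.
  by rewrite nutE /muF FE// setIid -pE -EFinM mulVf ?gt_eqF.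
(* With the tangent taken at [C / p], the assumption [C m(A) < p] makes the lower bound strictly
   larger than [ln (C / p)], which equals [ln (C0 / p)] plus the exponent in [C]. *)
have a0 : 0 < C / p by rewrite divr_gt0.
apply: lt_le_trans (Ent_ge mA nutA a0).
have /andP[t0 t1] := t01.
apply: (@le_lt_trans _ _ ((1 - t) * ln (C0 / p) + t * ln (C0 / p) - K / 2 * t * (1 - t) * w)%:E).
  apply: (@le_trans _ _ (((1 - t)%:E * (ln (C0 / p))%:E + t%:E * (ln (C0 / p))%:E)
     - (K / 2 * t * (1 - t))%:E * w%:E)%E); last exact: lexx.
  apply: leeD2r.
  apply: leeD; first by apply: lee_wpmul2l => //; rewrite lee_fin subr_ge0.
  by apply: lee_wpmul2l => //; rewrite lee_fin.
rewrite -ma -EFinM -EFinB lte_fin.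
have -> : ln (C / p) = ln (C0 / p) + `|K| * D ^+ 2 / 8.
  rewrite (_ : C / p = C0 / p * expR (`|K| * D ^+ 2 / 8)); last by rewrite /C mulrAC.
  by rewrite lnM ?posrE ?expR_gt0 ?divr_gt0// expRK.
have : C / p * fine (m A) < 1 by rewrite mulrAC ltr_pdivrMr// mul1r.
(* This [1 / 4], multiplied by [K / 2], is the origin of the [8] in the exponent. *)
have tt : 0 <= t * (1 - t) <= 1 / 4.
  rewrite mulr_ge0 ?subr_ge0//=; have := sqr_ge0 (t - 1 / 2); rewrite expr2; nra.
have Kw : - (K / 2 * t * (1 - t) * w) <= `|K| * D ^+ 2 / 8.
  have h1 : - (K / 2 * t * (1 - t) * w) <= `|K| / 2 * (t * (1 - t)) * w.
    have := ler_norm (- K); rewrite normrN => hK.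
    have : 0 <= (t * (1 - t)) * w by rewrite mulr_ge0//; case/andP: tt.
    by move=> ?; nra.
  apply: (le_trans h1).
  have -> : `|K| * D ^+ 2 / 8 = `|K| / 2 * (1 / 4) * D ^+ 2 by field.
  apply: ler_pM => //; first by rewrite mulr_ge0 ?divr_ge0//; case/andP: tt.
  by apply: ler_wpM2l; [rewrite divr_ge0|case/andP: tt].
by move: Kw => *; lra.
Qed.

Lemma concentrated_geodesic (P : probability Curves R) :
  concentrated P (geodesic : set Curves) -> P geodesic = 1%E.
Proof.
move=> [A [mA Ag A1]]; apply/eqP; rewrite eq_le probability_le1/=.
  by rewrite -A1; apply: le_measure => //; rewrite inE//; exact: measurable_geodesic.
exact: measurable_geodesic.
Qed.

Lemma ae_geodesic (P : probability Curves R) : concentrated P (geodesic : set Curves) ->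
  {ae P, forall g : Curves, geodesic g}.
Proof.
move=> /concentrated_geodesic; apply: ae_of_full_measure.
exact: measurable_geodesic.
Qed.

(** The speed of a geodesic is constant and at most the bound [D] of the distance, so the kinetic
    energy is at most [D^2]. *)
Lemma geodesic_test_plan (P : probability Curves R) (C : R) :
  concentrated P (geodesic : set Curves) ->
  (forall t, 0 <= t <= 1 -> forall A : set BX, measurable A ->
    (P (ev t @^-1` A) <= C%:E * m A)%E) ->
  test_plan m P.
Proof.
move=> Pg PC; have P1 := concentrated_geodesic Pg.
have mg := @measurable_geodesic _ _ cX.
split; [|have [D D0 dD] := mdist_bounded cX|by exists C].
  by exists geodesic; split => // g; exact: geodesic_abs_cont.
apply: (@le_lt_trans _ _ (\int[P]_g (D ^+ 2)%:E)%E); last first.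
  by rewrite integral_cst//= probability_setT mule1 ltry.
apply: (@ge0_lower_integral_le _ _ _ P (~` geodesic)).
- exact: measurableC.
- by have := probability_setC P mg; rewrite P1 subee.
- exact: measurable_cst.
- move=> g; apply: integral_ge0 => t; rewrite /= in_itv/= => t01.
  by rewrite mule_ge0//; exact: mder_ge0.
- by move=> g; rewrite lee_fin sqr_ge0.
move=> g /contrapT gg.
have -> : (\int[lebesgue_measure]_(t in `[0%R, 1%R]) (mder g t * mder g t) =
    \int[lebesgue_measure]_(t in `[0%R, 1%R]) ((d ((g : curve) 0) ((g : curve) 1)) ^+ 2)%:E)%E.
  apply: eq_integral => t; rewrite inE/= in_itv/= => t01.
  by rewrite (mder_geodesic gg t01) -EFinM.
rewrite integral_cst//= lebesgue_measure_itv/= lte_fin ltr01 -EFinB subr0 mule1 lee_fin.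
by rewrite ler_pXn2r// ?nnegrE ?mdist_ge0// ltW.
Qed.

End curvature_dimension.

(** * Evaluation along geodesic plans *)

Section flow.
Context {R : realType} {X : pmetricType R}.
Local Notation d := (@mdist R X).
Local Notation BX := (@BX R X).
Local Notation Curves := (@Curves R X).
Local Notation curve := (@curve R X).
Local Notation T := (measurableTypeR R).
Hypothesis cX : compact [set: X].
Variable m : probability BX R.

Definition U01 : probability T R := uniform_prob (@ltr01 R).

Lemma integral_U01 (f : T -> \bar R) : measurable_fun setT f -> (forall x, 0 <= f x)%E ->
  (\int[U01]_s f s = \int[lebesgue_measure]_(s in `[0%R, 1%R]) f s)%E.
Proof. by move=> mf f0; rewrite integral_uniform// subr0 invr1 mul1e. Qed.

(* The evaluation [(g, s) |-> g (t s)] is measurable only where [g] is a geodesic,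
   since [Curves] contains all functions [R -> X]. *)
Definition flow (t : R) (z : Curves * T) : BX :=
  if `[< geodesic (z.1 : curve) >] && (0 <= z.2 <= 1) then ev (t * z.2) z.1 else point.

Lemma flowE t (g : Curves) (s : T) : geodesic (g : curve) -> 0 <= s <= 1 ->
  flow t (g, s) = ev (t * s) g.
Proof. by move=> gg s01; rewrite /flow/= s01 andbT; case: asboolP. Qed.

(** The preimage of an open set is, up to a measurable remainder, a countable union of rectangles. A
    geodesic moves by less than [D / (n + 1)] on a time interval of length [1 / (n + 1)]; hence it
    suffices that at the left end of the interval it is in [V n], the closed set of points whose
    ball of radius [D / (n + 1)] is inside [U]. *)
Lemma measurable_flow t : 0 <= t <= 1 -> measurable_fun setT (flow t).
Proof.
move=> t01; apply: measurable_fun_BX => U oU.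
have [D0 D00 dD0] := mdist_bounded cX; pose D := D0 + 1.
have dD x y : d x y < D by rewrite (le_lt_trans (dD0 x y))// ltrDl.
have D0' : 0 < D by rewrite ltr_wpDl// ltW.
have mG := @measurable_geodesic _ _ cX.
have mGI : measurable ((geodesic : set Curves) `*` (`[0, 1]%classic : set T)).
  by apply: measurableX => //; exact: measurable_itv.
pose V n : set X := [set x | forall y, d x y < D / n.+1%:R -> U y].
have mV n : measurable (V n : set BX).
  rewrite -(setCK (V n)); apply: measurableC; apply: measurable_open; apply/open_mdistP.
  move=> x /= /existsNP[y] /not_implyP[xy yU].
  exists (D / n.+1%:R - d x y) => [|z xz]; first by rewrite subr_gt0.
  move=> /(_ y) zy; apply: yU; apply: zy.
  have tr := metric_triangle z x y; rewrite (metric_sym z x) in tr.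
  by move: (D / _) xy xz => q xy xz; lra.
pose A n k : set (Curves * T) :=
  (geodesic `&` ev (t * (k%:R / n.+1%:R)) @^-1` (V n)) `*`
  (`[k%:R / n.+1%:R, k.+1%:R / n.+1%:R]%classic `&` `[0, 1]%classic).
have kn01 n k : (k <= n.+1)%N -> 0 <= (k%:R / n.+1%:R : R) <= 1.
  by move=> kn; rewrite divr_ge0//= ler_pdivrMr// mul1r ler_nat.
have mA n k : (k <= n.+1)%N -> measurable (A n k).
  move=> kn; apply: measurableX; apply: measurableI => //.
  by apply: measurable_ev_preimage => //; apply: mulr_itv01 => //; exact: kn01.
have -> : flow t @^-1` U = (\bigcup_n \bigcup_(k in [set k | (k <= n.+1)%N]) A n k) `|`
    (~` ((geodesic : set Curves) `*` (`[0, 1]%classic : set T)) `&` [set z | U point]).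
  apply/seteqP; split => [[g s]|[g s]].
    rewrite /preimage/= /flow/=; case: asboolP => [gg|ng] /=; last by right; split => // -[].
    case: ifPn => [s01 Ux|/negP s01 Up]; last first.
      by right; split => //= -[_]; rewrite /= in_itv.
    left; move/open_mdistP : oU => /(_ _ Ux)[e e0 eU].
    have [n _ ne] := near_infty_natSinv_lt (PosNum (divr_gt0 e0 (mulr_gt0 (ltr0Sn R 1) D0'))).
    have {}ne := ne n (leqnn n); rewrite /= ltr_pdivlMr ?mulr_gt0// in ne.
    exists n => //; have /andP[s0 s1] := s01.
    have n0 : 0 < n.+1%:R :> R by [].
    have sn0 : 0 <= s * n.+1%:R by rewrite mulr_ge0.
    have /andP[k1 k2] := truncn_itv sn0; set k := Num.truncn _ in k1 k2.
    have kn : (k <= n.+1)%N.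
      by rewrite -(ler_nat R) (le_trans k1)// ler_piMl.
    exists k => //; split; split => //=; last first.
      by rewrite in_itv/= ler_pdivrMr// k1/= ler_pdivlMr// ltW.
    move=> y ky; apply: eU; rewrite /ev in ky *.
    have := metric_triangle (g (t * s)) (g (t * (k%:R / n.+1%:R))) y.
    have : d (g (t * s)) (g (t * (k%:R / n.+1%:R))) < D / n.+1%:R.
      rewrite (gg _ _ (mulr_itv01 t01 s01) (mulr_itv01 t01 (kn01 n k kn))) -mulrBr normrM.
      have /andP[t0 t1] := t01; rewrite (ger0_norm t0) distrC.
      have h1 : `|s - k%:R / n.+1%:R| <= 1 / n.+1%:R.
        have -> : s - k%:R / n.+1%:R = (s * n.+1%:R - k%:R) / n.+1%:R by field.
        rewrite normrM (@gtr0_norm _ n.+1%:R^-1) ?invr_gt0// ler_wpM2r ?invr_ge0//.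
        by rewrite ger0_norm ?subr_ge0// lerBlDl natr1; exact: ltW.
      apply: (@le_lt_trans _ _ (1 * (1 / n.+1%:R) * d (g 0) (g 1))).
        by rewrite ler_wpM2r ?mdist_ge0//; apply: ler_pM.
      by rewrite mul1r mul1r mulrC ltr_pM2r ?invr_gt0.
    have : 2 * (D / n.+1%:R) < e by rewrite mulrA mulrC.
    move: ky; set q := D / _; move=> *; lra.
  move=> [[n _ [k /= kn [[gg Vk] [ks s01]]]]|[nGI Up]]; last first.
    rewrite /preimage/= /flow/=; case: asboolP => [gg|//] /=; case: ifP => // s01.
    by exfalso; apply: nGI; split => //=; rewrite in_itv.
  rewrite /preimage/=; rewrite /= in_itv/= in s01; rewrite flowE//; apply: Vk.
  rewrite /ev (gg _ _ (mulr_itv01 t01 (kn01 n k kn)) (mulr_itv01 t01 s01)) -mulrBr normrM.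
  have /andP[t0 t1] := t01; rewrite (ger0_norm t0).
  have h1 : `|s - k%:R / n.+1%:R| <= 1 / n.+1%:R.
    rewrite /= in_itv/= in ks; case/andP: ks => k1 k2.
    rewrite ger0_norm ?subr_ge0// lerBlDl -mulrDl natr1//.
  apply: (@le_lt_trans _ _ (1 * (1 / n.+1%:R) * d (g 0) (g 1))).
    by rewrite ler_wpM2r ?mdist_ge0//; apply: ler_pM.
  by rewrite mul1r mul1r mulrC ltr_pM2r ?invr_gt0.
apply: measurableU.
  apply: bigcupT_measurable => n; apply: bigcup_measurable => k /= kn; exact: mA.
apply: measurableI; first exact: measurableC.
by case: (pselect (U point)) => Up; [rewrite (_ : [set _ | _] = setT)|rewrite (_ : [set _ | _] = set0)];
  rewrite //; apply/seteqP; split.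
Qed.

Section plan.
Variables (P : probability Curves R) (C : R).
Hypothesis C0 : 0 <= C.
Hypothesis Pg : concentrated P (geodesic : set Curves).
Hypothesis PC : forall t, 0 <= t <= 1 -> forall A : set BX, measurable A ->
  (P (ev t @^-1` A) <= C%:E * m A)%E.

Lemma integral_marginal_le t (h : X -> \bar R) : 0 <= t <= 1 ->
  measurable_fun setT (h : BX -> \bar R) -> (forall x, 0 <= h x)%E ->
  (\int[P]_g h (ev t g) <= C%:E * \int[m]_x h x)%E.
Proof.
move=> t01 mh h0.
have [nu [nuE nuh]] := pushforward_probability P (measurable_ev cX t01).
have iC : m.-integrable setT (EFin \o (fun=> C) : BX -> \bar R).
  exact: finite_measure_integrable_cst.
have [|f [mf fC muf]] := @exists_density_le _ BX R nu m (fun=> C) iC (fun=> C0).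
  move=> A mA; apply: (@le_trans _ _ (P (ev t @^-1` A))); first by rewrite -nuE.
  by rewrite integral_cst//; exact: PC.
rewrite -nuh// (ge0_integral_density mf _ muf)//; last by move=> x; case/andP: (fC x).
rewrite -ge0_integralZl//; apply: ge0_le_lower_integral => x _.
  by rewrite mule_ge0// lee_fin; case/andP: (fC x).
by rewrite muleC lee_wpmul2r// lee_fin; case/andP: (fC x).
Qed.

Lemma integral_flow_le t (h : X -> \bar R) : 0 <= t <= 1 ->
  measurable_fun setT (h : BX -> \bar R) -> (forall x, 0 <= h x)%E ->
  (\int[P \x U01]_z h (flow t z) <= C%:E * \int[m]_x h x)%E.
Proof.
move=> t01 mh h0.
have mf : measurable_fun setT (fun z => h (flow t z)).
  by apply: measurableT_comp => //; exact: measurable_flow.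
rewrite fubini_tonelli2//.
have mG : measurable_fun setT (fubini_G P (fun z : Curves * T => h (flow t z))).
  by apply: measurable_fun_fubini_tonelli_G => // z; exact: h0.
rewrite integral_U01//; last by move=> s; apply: integral_ge0.
apply: (@le_trans _ _ (\int[lebesgue_measure]_(s in `[0%R, 1%R]) (C%:E * \int[m]_x h x)))%E.
  apply: ge0_le_lower_integral => s /=; first by move=> _; apply: integral_ge0.
  rewrite in_itv/= => s01; have ts01 := mulr_itv01 t01 s01.
  apply: le_trans (integral_marginal_le ts01 mh h0).
  apply: ae_ge0_le_integral => //.
  - by apply: (measurableT_comp mf); exact: measurable_pair2.
  - by apply: measurableT_comp => //; exact: measurable_ev.
  - have FF := ae_filter_ringOfSetsType P; have AE := ae_geodesic cX Pg.
    by apply: filterS AE => g gg _; rewrite flowE.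
have I0 : (0 <= C%:E * \int[m]_x h x)%E by rewrite mule_ge0// integral_ge0.
rewrite integral_cst//= lebesgue_measure_itv/= lte_fin ltr01 -EFinB subr0 mule1.
exact: lexx.
Qed.

(** Restriction to [[0, t]] turns [P] into another geodesic plan with the same bound, because its
    marginal at [s] is that of [P] at [t s]. It is thus a test plan, and the upper gradient
    inequality holds for almost all restricted curves, whose speed is [t d]. *)
Lemma ae_restr_upper_gradient t (phi : X -> R) (G : X -> \bar R) : 0 <= t <= 1 ->
  weak_ug m phi G ->
  {ae P, forall g : Curves, ((`|phi (ev 0 g) - phi (ev t g)|)%:E <=
    (t * d (ev 0 g) (ev 1 g))%:E * \int[U01]_s G (flow t (g, s)))%E}.
Proof.
move=> t01 [mG G0 Gneg].
have [Q [QE _]] := pushforward_probability P (measurable_restr cX t01).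
have mg := @measurable_geodesic _ _ cX.
have Qg : concentrated Q (geodesic : set Curves).
  exists geodesic; split => //; rewrite QE; apply/eqP; rewrite eq_le probability_le1/=.
    rewrite -(concentrated_geodesic cX Pg); apply: le_measure; rewrite ?inE//.
      by rewrite -[X in measurable X]setTI; exact: measurable_restr.
    by move=> g gg; exact: geodesic_restr.
  by rewrite -[X in measurable X]setTI; exact: measurable_restr.
have QC s : 0 <= s <= 1 -> forall A : set BX, measurable A ->
    (Q (ev s @^-1` A) <= C%:E * m A)%E.
  by move=> s01 A mA; rewrite QE; apply: (@PC (t * s)) => //; exact: mulr_itv01.
have [N [mN N0 HN]] := Gneg Q (geodesic_test_plan cX Qg QC).
have nP : {ae P, forall g : Curves, ~ N (restr t g)}.
  exists (restr t @^-1` N); split.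
  - by rewrite -[X in measurable X]setTI; exact: measurable_restr.
  - by rewrite -QE.
  - by move=> g /contrapT.
apply: filterS2 nP (ae_geodesic cX Pg) => g gN gg.
have i0 : 0 <= (0 : R) <= 1 by rewrite lexx ler01.
have i1 : 0 <= (1 : R) <= 1 by rewrite lexx ler01.
have H : ((`|phi (restr t g 1) - phi (restr t g 0)|)%:E <=
    \int[lebesgue_measure]_(s in `[0%R, 1%R]) (G (restr t g s) * mder (restr t g) s))%E.
  by apply: contrapT => nH; apply: gN; apply: HN.
have gr := geodesic_restr t01 gg.
rewrite /restr mulr0 mulr1 in H; rewrite distrC; apply: (le_trans H).
have ms : measurable_fun setT (fun s : T => G (flow t (g, s))).
  apply: measurableT_comp => //; apply: measurableT_comp; last exact: measurable_pair1.
  exact: measurable_flow.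
rewrite integral_U01// -ge0_integralZl//; last 2 first.
- exact: measurable_funTS.
- by rewrite lee_fin mulr_ge0 ?mdist_ge0//; case/andP: t01.
apply: ge0_le_lower_integral => s /=; rewrite in_itv/= => s01.
  by rewrite mule_ge0// mder_ge0.
rewrite (mder_geodesic gr s01) flowE// muleC /restr mulr0 mulr1.
by rewrite (geodesic_mdist0 gg t01).
Qed.

End plan.

(** The integrated inequality on which the cost estimate rests. Unlike the pointwise one it survives
    both changes of [G] on [m]-null sets and weak L2 limits, so it is shared by weak upper gradients
    and relaxed slopes. *)
Definition plan_upper_gradient (phi : X -> R) (G : X -> \bar R) :=
  forall (P : probability Curves R) (C t : R), 0 <= C ->
  concentrated P (geodesic : set Curves) ->
  (forall t, 0 <= t <= 1 -> forall A : set BX, measurable A ->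
    (P (ev t @^-1` A) <= C%:E * m A)%E) ->
  0 <= t <= 1 ->
  (\int[P]_g (phi (ev 0 g) - phi (ev t g))%:E <=
    t%:E * \int[P \x U01]_z (G (flow t z) * (d (ev 0 z.1) (ev 1 z.1))%:E))%E.

Lemma measurable_fun_dist01 : measurable_fun setT (fun z : Curves * T => d (ev 0 z.1) (ev 1 z.1)).
Proof.
have i0 : 0 <= (0 : R) <= 1 by rewrite lexx ler01.
have i1 : 0 <= (1 : R) <= 1 by rewrite lexx ler01.
exact: (measurableT_comp (measurable_fun_mdist_ev cX i0 i1) (@measurable_fst _ _ Curves T)).
Qed.

Lemma weak_ug_plan_upper_gradient (phi : X -> R) (G : X -> \bar R) :
  Defs.lipschitz phi -> weak_ug m phi G -> plan_upper_gradient phi G.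
Proof.
move=> lphi wG P C t C0 Pg PC t01; have [mG G0 _] := wG.
have i0 : 0 <= (0 : R) <= 1 by rewrite lexx ler01.
have i1 : 0 <= (1 : R) <= 1 by rewrite lexx ler01.
have mphi := measurable_fun_lipschitz lphi.
have [M phiM] := lipschitz_bounded cX lphi.
have mphit s : 0 <= s <= 1 -> measurable_fun setT (fun g : Curves => phi (ev s g)).
  by move=> s01; apply: (measurableT_comp mphi); exact: measurable_ev.
have mdif : measurable_fun setT (fun g : Curves => phi (ev 0 g) - phi (ev t g)).
  by apply: measurable_funB; exact: mphit.
have /andP[t0 _] := t01.
have mf : measurable_fun setT (fun z : Curves * T =>
    (G (flow t z) * (d (ev 0 z.1) (ev 1 z.1))%:E)%E).
  apply: emeasurable_funM; last by apply/measurable_EFinP; exact: measurable_fun_dist01.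
  by apply: measurableT_comp => //; exact: measurable_flow.
have f0 (z : Curves * T) : (0 <= G (flow t z) * (d (ev 0 z.1) (ev 1 z.1))%:E)%E.
  by rewrite mule_ge0// lee_fin mdist_ge0.
have mGf g : measurable_fun setT (fun s : T => G (flow t (g, s))).
  apply: measurableT_comp => //; apply: measurableT_comp; last exact: measurable_pair1.
  exact: measurable_flow.
rewrite fubini_tonelli1// -ge0_integralZl//; last 2 first.
- exact: measurable_fun_fubini_tonelli_F.
- by move=> g _; apply: integral_ge0.
apply: (@le_trans _ _ (\int[P]_g (`|phi (ev 0 g) - phi (ev t g)|)%:E)%E).
  apply: le_integral => //.
  - by apply: (bounded_integrable P mdif (M := M + M)) => g; rewrite (le_trans (ler_normB _ _))// lerD.
  - apply: (bounded_integrable P _ (M := M + M)); first exact: measurableT_comp.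
    by move=> g; rewrite normr_id (le_trans (ler_normB _ _))// lerD.
  - by move=> g _; rewrite lee_fin ler_norm.
apply: ae_ge0_le_integral => //.
- by apply/measurable_EFinP; exact: measurableT_comp.
- by move=> g _; rewrite mule_ge0//; apply: integral_ge0.
- by apply: measurable_funeM; exact: measurable_fun_fubini_tonelli_F.
have H := ae_restr_upper_gradient Pg PC t01 wG.
apply: filterS H => g Hg _.
apply: (le_trans Hg); rewrite /fubini_F/= ge0_integralZr//; last by rewrite lee_fin mdist_ge0.
by rewrite EFinM -muleA (muleC (d _ _)%:E).
Qed.

End flow.

(** * Transport cost and slopes *)

(** On a compact space all Lipschitz data are bounded; within this class real-valued integrals are
    linear and monotone without integrability side conditions. *)
Definition bmeas d (T : measurableType d) (R : realType) (f : T -> R) :=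
  measurable_fun setT f /\ exists M, forall x, `|f x| <= M.

Section bounded_measurable.
Context d (T : measurableType d) (R : realType).
Implicit Types (f g : T -> R) (P : probability T R).

Lemma bmeas_cst (c : R) : bmeas (fun _ : T => c).
Proof. by split => //; exists `|c|. Qed.

Lemma bmeasD f g : bmeas f -> bmeas g -> bmeas (fun x => f x + g x).
Proof.
move=> [mf [M fM]] [mg [N gN]]; split; first exact: measurable_funD.
by exists (M + N) => x; rewrite (le_trans (ler_normD _ _))// lerD.
Qed.

Lemma bmeasN f : bmeas f -> bmeas (fun x => - f x).
Proof.
move=> [mf [M fM]]; split; first exact: measurableT_comp.
by exists M => x; rewrite normrN.
Qed.

Lemma bmeasB f g : bmeas f -> bmeas g -> bmeas (fun x => f x - g x).
Proof. by move=> bf bg; apply: bmeasD => //; exact: bmeasN. Qed.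

Lemma bmeasM f g : bmeas f -> bmeas g -> bmeas (fun x => f x * g x).
Proof.
move=> [mf [M fM]] [mg [N gN]]; split; first exact: measurable_funM.
by exists (M * N) => x; rewrite normrM ler_pM.
Qed.

Lemma bmeasZ (c : R) f : bmeas f -> bmeas (fun x => c * f x).
Proof. by move=> bf; apply: bmeasM => //; exact: bmeas_cst. Qed.

Lemma bmeas_sqr f : bmeas f -> bmeas (fun x => f x ^+ 2).
Proof. by move=> bf; exact: bmeasM. Qed.

Lemma bmeas_norm f : bmeas f -> bmeas (fun x => `|f x|).
Proof.
move=> [mf [M fM]]; split; first exact: measurableT_comp.
by exists M => x; rewrite normr_id.
Qed.

Lemma bmeas_comp d' (T' : measurableType d') f (h : T' -> T) :
  measurable_fun setT h -> bmeas f -> bmeas (fun x => f (h x)).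
Proof.
move=> mh [mf [M fM]]; split; first exact: measurableT_comp.
by exists M => x.
Qed.

Lemma bmeas_integrable P f : bmeas f -> P.-integrable setT (EFin \o f).
Proof. by move=> [mf [M fM]]; exact: (bounded_integrable P mf (M := M)). Qed.

Lemma bmeas_EFin P f : bmeas f ->
  (\int[P]_x (f x)%:E = (\int[P]_x f x)%R%:E)%E.
Proof.
move=> bf; rewrite /Rintegral fineK//.
exact: (integrable_fin_num measurableT (bmeas_integrable P bf)).
Qed.

Lemma bintD P f g : bmeas f -> bmeas g ->
  \int[P]_x (f x + g x) = \int[P]_x f x + \int[P]_x g x.
Proof. by move=> bf bg; apply: RintegralD => //; exact: bmeas_integrable. Qed.

Lemma bintB P f g : bmeas f -> bmeas g ->
  \int[P]_x (f x - g x) = \int[P]_x f x - \int[P]_x g x.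
Proof. by move=> bf bg; apply: RintegralB => //; exact: bmeas_integrable. Qed.

Lemma bintZ P (c : R) f : bmeas f -> \int[P]_x (c * f x) = c * \int[P]_x f x.
Proof. by move=> bf; apply: RintegralZl => //; exact: bmeas_integrable. Qed.

Lemma bint_cst P (c : R) : \int[P]_(x in setT) c = c.
Proof. by rewrite Rintegral_cst//= probability_setT mulr1. Qed.

Lemma bint_le P f g : bmeas f -> bmeas g -> (forall x, f x <= g x) ->
  \int[P]_x f x <= \int[P]_x g x.
Proof. by move=> bf bg fg; apply: le_Rintegral => //; exact: bmeas_integrable. Qed.

Lemma bint_ge0 P f : (forall x, 0 <= f x) -> 0 <= \int[P]_x f x.
Proof. by move=> f0; exact: Rintegral_ge0. Qed.

Lemma bint_le_ae P f g : bmeas f -> bmeas g -> {ae P, forall x, f x <= g x} ->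
  \int[P]_x f x <= \int[P]_x g x.
Proof.
move=> bf bg fg; rewrite -subr_ge0 -bintB//.
have bh := bmeasB bg bf; have bn := bmeas_norm bh.
rewrite (_ : \int[P]_x (g x - f x) = \int[P]_x `|g x - f x|); first exact: bint_ge0.
rewrite /Rintegral; congr fine; apply: ae_eq_integral => //.
- by apply/measurable_EFinP; case: bh.
- by apply/measurable_EFinP; case: bn.
- have FF := ae_filter_ringOfSetsType P.
  by apply: filterS fg => x fgx _; rewrite ger0_norm// subr_ge0.
Qed.

Lemma bint_eq0_ae P f : bmeas f -> (forall x, 0 <= f x) -> \int[P]_x f x = 0 ->
  {ae P, forall x, f x = 0}.
Proof.
by move=> bf f0 If; apply: ge0_integral_eq0_ae => //; [case: bf|rewrite bmeas_EFin// If].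
Qed.

End bounded_measurable.

Lemma bint_pushforward d (T : measurableType d) d' (T' : measurableType d') (R : realType)
    (P : probability T R) (Q : probability T' R)
    (h : T -> T') (f : T' -> R) : measurable_fun setT h ->
  (forall A, measurable A -> Q A = P (h @^-1` A)) -> bmeas f ->
  \int[Q]_x f x = \int[P]_x f (h x).
Proof.
move=> mh QE bf; rewrite /Rintegral; congr fine.
rewrite (eq_measure_integral (pushforward P h)).
  rewrite integral_pushforward//.
  - by apply/measurable_EFinP; case: bf.
  - by rewrite preimage_setT; exact: (bmeas_integrable P (bmeas_comp mh bf)).
by move=> A mA _; exact: QE.
Qed.

Section optimal_transport.
Context {R : realType} {X : pmetricType R}.
Local Notation d := (@mdist R X).
Local Notation BX := (@BX R X).
Local Notation Curves := (@Curves R X).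
Hypothesis cX : compact [set: X].

Lemma lipschitz_bmeas (f : X -> R) : Defs.lipschitz f -> bmeas (f : BX -> R).
Proof.
move=> lf; split; first exact: measurable_fun_lipschitz.
by have [M fM] := lipschitz_bounded cX lf; exists M.
Qed.

Lemma mdist_bmeas : bmeas (fun z : BX * BX => d z.1 z.2).
Proof.
split; first exact: measurable_fun_mdist.
by have [D D0 dD] := mdist_bounded cX; exists D => z; rewrite ger0_norm ?mdist_ge0.
Qed.

Lemma coupling_bint (mu nu : probability BX R) (Q : probability (BX * BX)%type R)
    (f : BX -> R) : coupling mu nu Q -> bmeas f ->
  \int[Q]_z f z.1 = \int[mu]_x f x /\ \int[Q]_z f z.2 = \int[nu]_x f x.
Proof.
move=> cQ bf; split; apply/esym; apply: bint_pushforward => // A mA.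
  by have [<- _] := cQ A mA; congr (Q _); apply/seteqP; split => -[x y]//= -[].
by have [_ <-] := cQ A mA; congr (Q _); apply/seteqP; split => -[x y]//= -[].
Qed.

Lemma asc_slope_bmeas (f : X -> R) : Defs.lipschitz f ->
  bmeas (fun x : BX => fine (asc_slope f x)).
Proof.
move=> /lipschitz_gt0[L L0 fL]; split.
  by apply: measurableT_comp => //; exact: measurable_asc_slope fL.
exists L => x; rewrite -lee_fin ger0_norm ?fine_ge0 ?asc_slope_ge0//.
by rewrite (asc_slopeK (ltW L0) fL) (asc_slope_le (ltW L0) fL).
Qed.

Lemma lip_const_bmeas (f : X -> R) : Defs.lipschitz f ->
  bmeas (fun x : BX => fine (lip_const f x)).
Proof.
move=> /lipschitz_gt0[L L0 fL]; split.
  by apply: measurableT_comp => //; exact: measurable_lip_const fL.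
exists L => x; rewrite -lee_fin ger0_norm ?fine_ge0 ?lip_const_ge0//.
by rewrite (lip_constK (ltW L0) fL) (lip_const_le (ltW L0) fL).
Qed.

Section potential.
Variables (mu0 mu1 : probability BX R) (phi : X -> R).
Hypothesis pot : kantorovich_potential mu0 mu1 phi.

Definition defect (z : BX * BX) : R := (d z.1 z.2) ^+ 2 / 2 - phi z.1 - ctrans phi z.2.

Lemma potential_lipschitz : Defs.lipschitz phi.
Proof. by case: pot => /(c_concave_lipschitz cX). Qed.

Lemma potential_ubound : exists M, forall x, phi x <= M.
Proof.
have [M phiM] := lipschitz_bounded cX potential_lipschitz.
by exists M => x; exact: le_trans (ler_norm _) (phiM x).
Qed.

Lemma ctrans_potential_lipschitz : Defs.lipschitz (ctrans phi).
Proof. by have [M phiM] := potential_ubound; exact: (ctrans_lipschitz cX phiM). Qed.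

Let bphi := lipschitz_bmeas potential_lipschitz.
Let bpsi := lipschitz_bmeas ctrans_potential_lipschitz.

Lemma defect_ge0 z : 0 <= defect z.
Proof.
have [M phiM] := potential_ubound; have := ctrans_le z.1 z.2 phiM.
by rewrite /defect; lra.
Qed.

Lemma defect_bmeas : bmeas defect.
Proof.
apply: bmeasB; last by apply: (@bmeas_comp _ _ _ _ _ (ctrans phi : BX -> R)).
apply: bmeasB; last by apply: (@bmeas_comp _ _ _ _ _ (phi : BX -> R)).
by apply: bmeasM; [apply: bmeas_sqr; exact: mdist_bmeas|exact: bmeas_cst].
Qed.

Lemma W2sq_potential :
  W2sq mu0 mu1 = (2 * (\int[mu0]_x phi x + \int[mu1]_x ctrans phi x))%:E.
Proof.
have [_] := pot; rewrite (bmeas_EFin mu0 bphi) (bmeas_EFin mu1 bpsi) -EFinD.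
have := W2sq_ge0 mu0 mu1; case: (W2sq mu0 mu1) => [w| |]// _.
  by move=> [->]; rewrite mulrA divff// mul1r.
by rewrite gt0_muley// lte_fin invr_gt0.
Qed.

Definition W2 := fine (W2sq mu0 mu1).

Lemma W2K : W2sq mu0 mu1 = W2%:E.
Proof. by rewrite /W2 W2sq_potential. Qed.

Lemma defect_integral (nu0 nu1 : probability BX R) Q : coupling nu0 nu1 Q ->
  \int[Q]_z defect z = (\int[Q]_z (d z.1 z.2) ^+ 2) / 2
    - \int[nu0]_x phi x - \int[nu1]_x ctrans phi x.
Proof.
move=> cQ; have [<- _] := coupling_bint cQ bphi; have [_ <-] := coupling_bint cQ bpsi.
have bd := bmeas_sqr mdist_bmeas.
have b1 : bmeas (fun z : BX * BX => phi z.1) by apply: (@bmeas_comp _ _ _ _ _ (phi : BX -> R)).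
have b2 : bmeas (fun z : BX * BX => ctrans phi z.2).
  by apply: (@bmeas_comp _ _ _ _ _ (ctrans phi : BX -> R)).
have b0 : bmeas (fun z : BX * BX => (d z.1 z.2) ^+ 2 / 2).
  by apply: bmeasM => //; exact: bmeas_cst.
rewrite bintB//; last exact: bmeasB.
rewrite bintB//; congr (_ - _ - _).
by under eq_Rintegral do rewrite mulrC; rewrite bintZ// mulrC.
Qed.

(** For a coupling of [mu0] and [mu1] the defect integrates to half the excess of the cost over
    [W2sq], so almost minimal cost is the same as small defect. *)
Lemma exists_almost_optimal e : 0 < e -> exists2 Q : probability (BX * BX)%type R,
  coupling mu0 mu1 Q & \int[Q]_z defect z <= e.
Proof.
move=> e0; have [||x [Q cQ <-]] := @lb_ereal_inf_adherent R
  [set (\int[P]_z ((d z.1 z.2) ^+ 2)%:E)%E | P in coupling mu0 mu1] e.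
- by [].
- by rewrite -/(W2sq mu0 mu1) W2K.
rewrite -/(W2sq mu0 mu1) (bmeas_EFin Q (bmeas_sqr mdist_bmeas)) W2sq_potential -EFinD lte_fin.
move=> H; exists Q => //; rewrite (defect_integral cQ); lra.
Qed.

End potential.
End optimal_transport.

(** * The energy of the ascending slope is at most the cost *)

Section transport_cost.
Context {R : realType} {X : pmetricType R}.
Local Notation d := (@mdist R X).
Local Notation BX := (@BX R X).
Local Notation Curves := (@Curves R X).
Hypothesis cX : compact [set: X].

Section slope_bound.
Variables (mu0 mu1 : probability BX R) (phi : X -> R).
Hypothesis pot : kantorovich_potential mu0 mu1 phi.
Local Notation W := (W2 mu0 mu1).
Local Notation defect := (defect phi).

Lemma integral_cost (Q : probability (BX * BX)%type R) : coupling mu0 mu1 Q ->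
  \int[Q]_z (d z.1 z.2) ^+ 2 = W + 2 * \int[Q]_z defect z.
Proof.
move=> cQ; rewrite (defect_integral cX pot cQ).
by rewrite /W2 (W2sq_potential cX pot)/=; lra.
Qed.

(** [potential_slope] divided by [d y x], which lies between [a] and [r] on the annulus: the
    quadratic term leaves [r / 2], and the defect is divided by at least [a]. *)
Lemma annular_sup_defect a r x z : 0 < a -> 0 < r ->
  (annular_sup (incr phi) a r x <= (d x z + r / 2 + a^-1 * defect (x, z))%:E)%E.
Proof.
move=> a0 r0; have e0 := defect_ge0 cX pot (x, z).
apply: ge_ereal_sup => _ [->|[y /= /andP[ay yr] <-]]; rewrite lee_fin.
  by rewrite !addr_ge0// ?mdist_ge0 ?divr_ge0 ?mulr_ge0 ?invr_ge0// ltW.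
have y0 : 0 < d y x by exact: lt_trans ay.
have [M phiM] := potential_ubound cX pot.
have H := potential_slope x y z phiM.
rewrite ler_pdivrMr// /incr; have ea : d y x * (a^-1 * defect (x, z)) >= defect (x, z).
  by rewrite mulrA ler_peMl// ler_pdivlMr// mul1r ltW.
rewrite ge_max; apply/andP; split; last first.
  by rewrite mulr_ge0 ?mdist_ge0// !addr_ge0// ?mdist_ge0 ?divr_ge0 ?mulr_ge0 ?invr_ge0// ltW.
have : d y x * (d x z + d y x / 2) <= d y x * (d x z + r / 2).
  by rewrite ler_pM2l// lerD2l ler_pM2r// ltW.
rewrite /defect/= in ea *; move: ea H; rewrite /defect/=.
set q := a^-1 * _; rewrite (mulrC _ (d y x)) !mulrDr => *; lra.
Qed.

(** Only the integral of the defect [e] is small, so its square is made linear by [e <= E]. Here [k]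
    is the inverse of the inner radius. *)
Lemma sqr_le_cost (a b k e r D E : R) : 0 < r -> r <= 1 -> 0 < k -> 0 <= D ->
  0 <= a -> 0 <= b -> b <= D -> e <= E -> 0 <= e -> a <= b + r / 2 + k * e ->
  a * a <= b ^+ 2 + r * (D + 1) + k * (2 * D + 1 + k * E) * e.
Proof.
move=> r0 r1 k0 D0 a0 b0 bD eE e0 H.
have h1 : a * a <= (b + r / 2 + k * e) * (b + r / 2 + k * e) by exact: ler_pM.
apply: (le_trans h1).
have kn : 0 <= k * e by rewrite mulr_ge0// ltW.
have h2 : (k * e) * (k * e) <= (k * e) * (k * E) by rewrite ler_wpM2l// ler_pM2l.
have h3 : (k * e) * (2 * b + r) <= (k * e) * (2 * D + 1) by rewrite ler_wpM2l//; lra.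
have h4 : r * b <= r * D by rewrite ler_wpM2l// ltW.
have h5 : r * r <= r by rewrite ler_piMr// ltW.
have -> : (b + r / 2 + k * e) * (b + r / 2 + k * e) =
  b ^+ 2 + r * b + r * r / 4 + (k * e) * (2 * b + r) + (k * e) * (k * e) by field.
have -> : b ^+ 2 + r * (D + 1) + k * (2 * D + 1 + k * E) * e =
  b ^+ 2 + r * D + r + (k * e) * (2 * D + 1) + (k * e) * (k * E) by ring.
by move: h2 h3 h4 h5 r0; move: (_ * (k * e)) (_ * (k * E)) (_ * (2 * b + r)) (_ * (2 * D + 1))
  (r * b) (r * D) (r * r) (b ^+ 2) => *; lra.
Qed.

(** Both radii stay fixed while the defect of the coupling tends to 0; the factor [c] in front of
    the defect depends on [k] and would blow up if the inner radius shrank at the same time. *)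
Lemma annular_sup_integral k r D : 0 < r -> r <= 1 -> (forall x y, d x y <= D) ->
  (\int[mu0]_x (annular_sup (incr phi) k.+1%:R^-1 r x *
                annular_sup (incr phi) k.+1%:R^-1 r x) <= (W + r * (D + 1))%:E)%E.
Proof.
move=> r0 r1 dD; set k' : R := k.+1%:R; have k0 : 0 < k'^-1 by rewrite invr_gt0.
have K0 : 0 < k' by [].
have [mD [E dE]] := defect_bmeas cX pot.
have lphi := potential_lipschitz cX pot.
set A := annular_sup (incr phi) k'^-1 r.
have A0 x : (0 <= A x)%E by exact: annular_sup_ge0.
have Ale x : (A x <= (D + r / 2 + k' * E)%:E)%E.
  apply: (le_trans (annular_sup_defect x x k0 r0)).
  rewrite lee_fin invrK; apply: lerD; first by rewrite lerD2r.
  by rewrite ler_pM2l// (le_trans (ler_norm _)).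
pose a (x : BX) := fine (A x).
have aE x : A x = (a x)%:E.
  by rewrite fineK// ge0_fin_numE// (le_lt_trans (Ale x))// ltry.
have a0 x : 0 <= a x by rewrite -lee_fin -aE.
have ba : bmeas a.
  split; first by apply: measurableT_comp => //; apply: measurable_annular_sup;
    [move=> y; exact: lipschitz_incr|exact: ltW].
  by exists (D + r / 2 + k' * E) => x; rewrite ger0_norm// -lee_fin -aE.
under eq_integral do rewrite aE -EFinM.
have ba2 : bmeas (fun x => a x * a x) by exact: bmeasM.
rewrite (bmeas_EFin mu0 ba2) lee_fin; apply/ler_addgt0Pr => e e0.
pose c := k' * (2 * D + 1 + k' * E).
have D0 : 0 <= D by exact: le_trans (mdist_ge0 point point) (dD _ _).
have E0 : 0 <= E by apply: le_trans (dE (point, point)); exact: normr_ge0.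
have c0 : 0 <= c by rewrite /c !(mulr_ge0, addr_ge0)// ltW.
have c20 : 0 < c + 2 by rewrite ltr_wpDl.
(* The defect is counted [c] times from the squared bound and twice more from the excess of the cost
   over [W]. *)
have [Q cQ He] := exists_almost_optimal cX pot (divr_gt0 e0 c20).
have [<- _] := coupling_bint cQ ba2.
have bd := defect_bmeas cX pot; have b2 := bmeas_sqr (mdist_bmeas cX).
have bcd : bmeas (fun z => c * defect z) by exact: bmeasZ.
apply: (@le_trans _ _ (\int[Q]_z ((d z.1 z.2) ^+ 2 + r * (D + 1) + c * defect z))).
  apply: bint_le.
  - exact: (bmeas_comp (@measurable_fst _ _ BX BX) ba2).
  - by apply: bmeasD => //; apply: bmeasD => //; exact: bmeas_cst.
  move=> [x z] /=; have := annular_sup_defect x z k0 r0; rewrite -/A aE lee_fin invrK.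
  have := defect_ge0 cX pot (x, z); have := le_trans (ler_norm _) (dE (x, z)).
  have := dD x z; have := mdist_ge0 x z; have := a0 x; rewrite /c.
  by move=> *; apply: sqr_le_cost => //; exact: ltW.
rewrite bintD//; last by apply: bmeasD => //; exact: bmeas_cst.
rewrite bintD//; last exact: bmeas_cst.
rewrite bint_cst bintZ// (integral_cost cQ).
have : (c + 2) * \int[Q]_z defect z <= e by rewrite mulrC -ler_pdivlMr.
move: (\int[Q]_z _) => I; lra.
Qed.

(** Monotone convergence lets the inner radius tend to 0 with the outer one fixed. Each point of the
    punctured ball lies in one of the annuli, so the root of the limit bounds the slope. *)
Lemma asc_slope_integral_le :
  (\int[mu0]_x (asc_slope phi x * asc_slope phi x) <= W2sq mu0 mu1)%E.
Proof.
have [D D0 dD] := mdist_bounded cX; rewrite (W2K cX pot).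
have lphi := potential_lipschitz cX pot; have [L L0 phiL] := lipschitz_gt0 lphi.
have S0 x := asc_slope_ge0 phi x.
apply/lee_addgt0Pr => e e0; rewrite -EFinD.
pose r := Num.min 1 (e / (D + 1)).
have D1 : 0 < D + 1 by rewrite ltr_wpDl// ltW.
have r0 : 0 < r by rewrite lt_min ltr01 divr_gt0.
have r1 : r <= 1 by rewrite ge_min lexx.
have re : r * (D + 1) <= e by rewrite -ler_pdivlMr// ge_min lexx orbT.
pose A k := annular_sup (incr phi) k.+1%:R^-1 r.
have A0 k x : (0 <= A k x)%E by exact: annular_sup_ge0.
have mA k : measurable_fun setT (A k : BX -> \bar R).
  by apply: measurable_annular_sup; [move=> y; exact: lipschitz_incr|rewrite invr_ge0].
have ndA x : {homo (fun k => (A k x * A k x)%E) : n m' / (n <= m')%N >-> (n <= m')%E}.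
  move=> n k nk; have H : (A n x <= A k x)%E.
    by apply: le_annular_sup => //; rewrite lef_pV2 ?posrE// ler_nat.
  by apply: lee_pmul.
have cvA : (\int[mu0]_x (A k x * A k x) @[k --> \oo] -->
    \int[mu0]_x (limn (fun k => A k x * A k x)))%E.
  apply: (@cvg_monotone_convergence _ BX R mu0 setT measurableT (fun k x => A k x * A k x))%E.
  - by move=> n; exact: emeasurable_funM.
  - by move=> n x _; rewrite mule_ge0.
  - by move=> x _; exact: ndA.
apply: (@le_trans _ _ (\int[mu0]_x (limn (fun k => A k x * A k x)))%E); last first.
  apply: (cvge_to_le cvA); near=> k.
  by apply: (le_trans (annular_sup_integral k r0 r1 dD)); rewrite lee_fin lerD2l.
apply: ge0_le_lower_integral => x _; first by rewrite mule_ge0.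
have -> := cvg_lim _ (ereal_nondecreasing_cvgn (ndA x)); last by [].
set u := ereal_sup _; have Au k : (A k x * A k x <= u)%E by apply: ereal_sup_ubound; exists k.
have u0 : (0 <= u)%E by apply: le_trans (Au 0%N); rewrite mule_ge0.
move: u u0 Au => [u| |]// u0 Au; last by rewrite leey.
rewrite lee_fin in u0; pose s := Num.sqrt u; have s0 : 0 <= s by exact: sqrtr_ge0.
have As k : (A k x <= s%:E)%E.
  have := Au k; have := A0 k x; case: (A k x) => [a| |]//=; rewrite ?mulyy ?leye_eq//.
  rewrite -EFinM !lee_fin => a0; rewrite -expr2 => /ler_wsqrtr.
  by rewrite sqrtr_sqr ger0_norm.
suff Ss : (asc_slope phi x <= s%:E)%E.
  apply: (@le_trans _ _ (s%:E * s%:E)%E); first exact: lee_pmul.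
  by rewrite -EFinM lee_fin -expr2 sqr_sqrtr.
rewrite asc_slopeE; apply: (slope_le s0 r0) => y /andP[y0 yr].
rewrite -ler_pdivrMr// -lee_fin.
have [k _ /(_ k (leqnn k)) /= ky] := near_infty_natSinv_lt (PosNum y0).
apply: le_trans (As k); apply: ereal_sup_ubound; right; exists y => //=.
by rewrite ky yr.
Unshelve. all: by end_near. Qed.

End slope_bound.
End transport_cost.

Lemma tail_le d (T : measurableType d) (R : realType) (P : probability T R) (f : T -> R) e :
  measurable_fun setT f -> 0 < e -> exists n : nat, (P [set x | n%:R < f x]%R <= e%:E)%E.
Proof.
move=> mf e0; pose F n := [set x | n%:R < f x].
have mF n : measurable (F n).
  rewrite (_ : F n = ~` [set x | f x <= n%:R]); first by apply: measurableC; exact: measurable_set_le.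
  by apply/seteqP; split => x /=; rewrite /F/= ltNge => /negP.
have F0 : \bigcap_n F n = set0.
  apply/seteqP; split => // x H; have := H (Num.truncn `|f x|).+1 I.
  rewrite /F/= => H1; have := lt_trans (truncnS_gt `|f x|) H1.
  by rewrite ltNge ler_norm.
have cv : P \o F @ \oo --> 0%E.
  rewrite -(measure0 P) -F0; apply: nonincreasing_cvg_mu => //.
  - by rewrite (le_lt_trans (probability_le1 _ _))// ltry.
  - by rewrite F0.
  - move=> n k nk; apply/subsetPset => x /=; rewrite /F/=; apply: le_lt_trans.
    by rewrite ler_nat.
have [n Hn] := ereal_cvg0_lt cv e0; rewrite /= in Hn.
by exists n; exact: ltW.
Qed.

Lemma U01_itv (R : realType) : @U01 R `[0, 1]%classic = 1%E.
Proof.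
have mi : measurable (`[0, 1]%classic : set (measurableTypeR R)) by [].
rewrite -(setIT `[0, 1]%classic) -integral_indic// integral_U01//; last first.
  by apply/measurable_EFinP; exact: measurable_indic.
rewrite integral_indic// setIid; have := @lebesgue_measure_itv R `[0, 1].
by rewrite /= lte_fin ltr01 -EFinB subr0.
Qed.

(** * Estimates along geodesic plans with bounded marginals *)

Section plans.
Context {R : realType} {X : pmetricType R}.
Local Notation d := (@mdist R X).
Local Notation BX := (@BX R X).
Local Notation Curves := (@Curves R X).
Local Notation T := (measurableTypeR R).
Hypothesis cX : compact [set: X].

Lemma ev_bmeas t (f : BX -> R) : 0 <= t <= 1 -> bmeas f -> bmeas (fun g : Curves => f (ev t g)).
Proof. by move=> t01; apply: bmeas_comp; exact: measurable_ev. Qed.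

Lemma flow_bmeas t (f : BX -> R) : 0 <= t <= 1 -> bmeas f ->
  bmeas (fun z : Curves * T => f (flow t z)).
Proof. by move=> t01; apply: bmeas_comp; exact: measurable_flow. Qed.

Lemma dist01_bmeas : bmeas (fun g : Curves => d (ev 0 g) (ev 1 g)).
Proof.
split; first by apply: measurable_fun_mdist_ev => //; rewrite lexx ler01.
by have [D D0 dD] := mdist_bounded cX; exists D => z; rewrite ger0_norm ?mdist_ge0.
Qed.

Lemma bint_fst (P : probability Curves R) (f : Curves -> R) : bmeas f ->
  \int[(P \x U01)%E]_z f z.1 = \int[P]_g f g.
Proof.
move=> bf; apply/esym; apply: bint_pushforward => // A mA.
rewrite (_ : _ @^-1` A = A `*` setT); last by apply/seteqP; split => -[x y]//= -[].
apply: (@etrans _ _ (P A * @U01 R setT)%E); first by rewrite probability_setT mule1.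
by apply/esym; exact: product_measure1E.
Qed.

Lemma ae_flow (P : probability Curves R) : concentrated P (geodesic : set Curves) ->
  {ae (P \x @U01 R)%E, forall z, geodesic z.1 /\ 0 <= z.2 <= 1}.
Proof.
move=> /(concentrated_geodesic cX) P1; have mg := @measurable_geodesic _ _ cX.
apply: (@ae_of_full_measure _ _ _ _ [set z : Curves * T | geodesic z.1 /\ 0 <= z.2 <= 1]).
  rewrite (_ : [set _ | _] = geodesic `*` `[0, 1]%classic); first exact: measurableX.
  by apply/seteqP; split => -[x y] []/=; rewrite ?in_itv.
rewrite (_ : [set _ | _] = (geodesic : set Curves) `*` (`[0, 1]%classic : set T)); last first.
  by apply/seteqP; split => -[x y] []/=; rewrite ?in_itv.
apply: (@etrans _ _ (P geodesic * @U01 R `[0%R, 1%R]%classic)%E).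
  exact: product_measure1E.
by rewrite P1 mul1e U01_itv.
Qed.

(** [t0] is chosen before the plan. Up to a small error in L1 of [m], which the marginal bound
    transfers to every plan with constant [C], the function [g] is Lipschitz, and a geodesic moves
    by at most [t D] up to time [t]. *)
Lemma flow_integral_cvg (m : probability BX R) (g : BX -> R) C e : bmeas g -> (forall x, 0 <= g x) ->
  0 <= C -> 0 < e -> exists2 t0 : R, 0 < t0 & forall (P : probability Curves R) t,
    concentrated P (geodesic : set Curves) ->
    (forall t, 0 <= t <= 1 -> forall A : set BX, measurable A ->
      (P (ev t @^-1` A) <= C%:E * m A)%E) ->
    0 <= t <= 1 -> t <= t0 ->
    \int[(P \x U01)%E]_z g (flow t z) <= \int[P]_g' g (ev 0 g') + e.
Proof.
move=> [mg [M gM]] g0 C0 e0; have bg : bmeas g by split => //; exists M.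
have i0 : 0 <= (0 : R) <= 1 by rewrite lexx ler01.
(* Replacing [g] by [h], at time 0 and along the flow, costs at most [e / 4] each time after
   multiplication by [C]; the motion of [h] costs the other [e / 2]. *)
have C1 : 0 < 4 * (C + 1) by rewrite mulr_gt0// ltr_wpDl.
have [|h lh gh] := lipschitz_approx_bounded cX m mg (M := M) _ (divr_gt0 e0 C1).
  by move=> x; rewrite g0 (le_trans (ler_norm _) (gM x)).
have bh := lipschitz_bmeas cX lh; have bgh := bmeas_norm (bmeasB bg bh).
have [L L0 hL] := lipschitz_gt0 lh; have [D D0 dD] := mdist_bounded cX.
have LD : 0 < 2 * (L * D) by rewrite !mulr_gt0.
exists (e / (2 * (L * D))); first by rewrite divr_gt0.
move=> P t Pg PC t01 tt.
have K : C * (e / (4 * (C + 1))) <= e / 4.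
  rewrite mulrA ler_pdivrMr// mulrC (_ : e / 4 * _ = e * (C + 1)); last by field.
  by rewrite ler_pM2l//; lra.
have I1 : \int[(P \x U01)%E]_z `|g (flow t z) - h (flow t z)| <= e / 4.
  apply: le_trans K; rewrite -lee_fin -bmeas_EFin; last first.
    exact: (flow_bmeas t01 bgh).
  apply: (le_trans (integral_flow_le cX C0 Pg PC (h := fun x => (`|g x - h x|)%:E) t01 _ _)).
  - by apply/measurable_EFinP; case: bgh.
  - by move=> x; rewrite lee_fin.
  - by rewrite EFinM lee_wpmul2l// lee_fin.
have I2 : \int[P]_g' `|g (ev 0 g') - h (ev 0 g')| <= e / 4.
  apply: le_trans K; rewrite -lee_fin -bmeas_EFin; last first.
    exact: (ev_bmeas i0 bgh).
  apply: (le_trans (integral_marginal_le cX C0 PC (h := fun x => (`|g x - h x|)%:E) i0 _ _)).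
  - by apply/measurable_EFinP; case: bgh.
  - by move=> x; rewrite lee_fin.
  - by rewrite EFinM lee_wpmul2l// lee_fin.
have b0 := ev_bmeas i0 bg; have b0h := ev_bmeas i0 bh; have b0gh := ev_bmeas i0 bgh.
have bt := flow_bmeas t01 bg; have bth := flow_bmeas t01 bh; have btgh := flow_bmeas t01 bgh.
have I3 : \int[(P \x U01)%E]_z h (flow t z) <= \int[P]_g' h (ev 0 g') + L * D * t.
  have bL : bmeas (fun g' : Curves => h (ev 0 g') + L * D * t).
    by apply: bmeasD => //; exact: bmeas_cst.
  have -> : \int[P]_g' h (ev 0 g') + L * D * t = \int[P]_g' (h (ev 0 g') + L * D * t).
    by rewrite bintD ?bint_cst//; exact: bmeas_cst.
  rewrite -(bint_fst P bL); apply: bint_le_ae => //.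
    exact: (bmeas_comp (@measurable_fst _ _ Curves T) bL).
  have FF := ae_filter_ringOfSetsType (P \x @U01 R)%E.
  have AE := ae_flow Pg; apply: filterS AE => -[γ s] /= [gg s01].
  rewrite flowE// -lerBlDl; apply: (le_trans (ler_norm _)); apply: (le_trans (hL _ _)).
  have ts := mulr_itv01 t01 s01; rewrite -mulrA ler_pM2l//.
  have /andP[t0 t1] := t01; have /andP[s0 s1] := s01.
  rewrite /ev (gg _ _ ts i0) sub0r normrN ger0_norm ?mulr_ge0// mulrC ler_pM ?mdist_ge0 ?mulr_ge0//.
  by rewrite ler_piMr.
have I4 : L * D * t <= e / 2.
  by move: tt; rewrite ler_pdivlMr// => ?; lra.
have I5 : \int[(P \x U01)%E]_z g (flow t z) <=
    \int[(P \x U01)%E]_z h (flow t z) + \int[(P \x U01)%E]_z `|g (flow t z) - h (flow t z)|.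
  rewrite -bintD//; apply: bint_le => //; first exact: bmeasD.
  by move=> z; rewrite -lerBlDl ler_norm.
have I6 : \int[P]_g' h (ev 0 g') <=
    \int[P]_g' g (ev 0 g') + \int[P]_g' `|g (ev 0 g') - h (ev 0 g')|.
  rewrite -bintD//; apply: bint_le => //; first exact: bmeasD.
  by move=> z; rewrite -lerBlDl distrC ler_norm.
move: I1 I2 I3 I4 I5 I6; clear.
move: (\int[_]_z _) (\int[_]_z _) (\int[_]_z _) (\int[P]_g _) (\int[P]_g _) (\int[P]_g _) => *.
lra.
Qed.

(** With [I] the cost and [E] the defect of the plan, [(t - t^2 / 2) I - E] is at most the drop of
    [phi], and Young's inequality bounds the drop by [t / 2] times the sum of the energy and [I].
    Moving [I] to the left leaves the factor [t (1 - t) / 2]. *)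
Lemma plan_cost_le (m : probability BX R) (mu0 mu1 : probability BX R) (phi : X -> R)
    (G : BX -> R) (P : probability Curves R) C t :
  kantorovich_potential mu0 mu1 phi -> bmeas G -> (forall x, 0 <= G x) ->
  plan_upper_gradient m phi (fun x => (G x)%:E) -> 0 <= C ->
  concentrated P (geodesic : set Curves) ->
  (forall t, 0 <= t <= 1 -> forall A : set BX, measurable A ->
    (P (ev t @^-1` A) <= C%:E * m A)%E) -> 0 <= t <= 1 ->
  (1 - t) * t * \int[P]_g (d (ev 0 g) (ev 1 g)) ^+ 2 <=
    2 * \int[P]_g defect phi (ev 0 g, ev 1 g) + t * \int[(P \x U01)%E]_z (G (flow t z)) ^+ 2.
Proof.
move=> pot bG G0 UG C0 Pg PC t01.
have i0 : 0 <= (0 : R) <= 1 by rewrite lexx ler01.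
have i1 : 0 <= (1 : R) <= 1 by rewrite lexx ler01.
have := UG P C t C0 Pg PC t01.
have bd := dist01_bmeas; have bd2 := bmeas_sqr bd.
have bphi := lipschitz_bmeas cX (potential_lipschitz cX pot).
have b0 := ev_bmeas i0 bphi; have bt := ev_bmeas t01 bphi.
have bGt := flow_bmeas t01 bG; have bG2 := bmeas_sqr bGt.
have bd1 := bmeas_comp (@measurable_fst _ _ Curves T) bd.
have bd12 := bmeas_sqr bd1.
have be : bmeas (fun g : Curves => defect phi (ev 0 g, ev 1 g)).
  exact: (bmeas_comp (measurable_ev_pair cX i0 i1) (defect_bmeas cX pot)).
rewrite (bmeas_EFin P (bmeasB b0 bt)); under eq_integral do rewrite -EFinM.
rewrite (bmeas_EFin _ (bmeasM bGt bd1)) -EFinM lee_fin => H1.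
have H2 : \int[(P \x U01)%E]_z (G (flow t z) * d (ev 0 z.1) (ev 1 z.1)) <=
    2^-1 * (\int[(P \x U01)%E]_z (G (flow t z)) ^+ 2 + \int[P]_g (d (ev 0 g) (ev 1 g)) ^+ 2).
  rewrite -(bint_fst P bd2) -bintD// -bintZ; last exact: bmeasD.
  apply: bint_le.
  - exact: bmeasM.
  - by apply: bmeasZ; exact: bmeasD.
  - move=> z; have := sqr_ge0 (G (flow t z) - d (ev 0 z.1) (ev 1 z.1)).
    by rewrite sqrrB; move: (G _ ^+ 2) (d _ _ ^+ 2) (_ * _) => *; lra.
have H3 : \int[P]_g ((t - t ^+ 2 / 2) * (d (ev 0 g) (ev 1 g)) ^+ 2 - defect phi (ev 0 g, ev 1 g))
    <= \int[P]_g (phi (ev 0 g) - phi (ev t g)).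
  apply: bint_le_ae; [by apply: bmeasB => //; exact: bmeasZ|exact: bmeasB|].
  have FF := ae_filter_ringOfSetsType P; have AE := ae_geodesic cX Pg.
  have [M phiM] := potential_ubound cX pot.
  by apply: filterS AE => g gg; have := potential_drop phiM gg t01; rewrite mulrC.
rewrite (bintB P (bmeasZ _ bd2) be) (bintZ P _ bd2) in H3.
have H1' : \int[P]_g (phi (ev 0 g) - phi (ev t g)) <=
  t * \int[(P \x U01)%E]_z (G (flow t z) * d (ev 0 z.1) (ev 1 z.1)) by exact: H1.
have /andP[t0 t1] := t01; have := ler_wpM2l t0 H2; move: H1' H3; clear.
do 5 move: (Rintegral _ _ _) => ?; lra.
Qed.

(** The coupling is conditioned on [E0 * E1], whose mass is at least [1 - e], hence at least
    [1 / 2]; the latter gives the factor 2 in the bounds on the marginals. *)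
Lemma restrict_coupling (mu0 mu1 : probability BX R) (Q : probability (BX * BX)%type R)
    (E0 E1 : set BX) e :
  coupling mu0 mu1 Q -> measurable E0 -> measurable E1 -> 0 <= e <= 2^-1 ->
  (mu0 (~` E0) + mu1 (~` E1) <= e%:E)%E ->
  exists (Q' : probability (BX * BX)%type R) (nu0 nu1 : probability BX R),
    [/\ coupling nu0 nu1 Q',
      forall f, bmeas f -> (forall z, 0 <= f z) ->
        \int[Q']_z f z <= (1 + 2 * e) * \int[Q]_z f z,
      forall f M, bmeas f -> (forall z, 0 <= f z <= M) ->
        \int[Q]_z f z - M * e <= \int[Q']_z f z,
      forall A, measurable A -> (nu0 A <= 2%:E * mu0 (A `&` E0))%E &
      forall A, measurable A -> (nu1 A <= 2%:E * mu1 (A `&` E1))%E].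
Proof.
move=> cQ mE0 mE1 /andP[e0 e2] He; pose E := E0 `*` E1.
have mE : measurable E by exact: measurableX.
have fQ : Q E \is a fin_num by rewrite fin_num_measure.
have QEc : (Q (~` E) <= e%:E)%E.
  apply: le_trans He.
  have sub : ~` E `<=` (~` E0 `*` setT) `|` (setT `*` ~` E1).
    move=> [x y] /= nE; have [xE|xE] := pselect (E0 x); last by left.
    by right; split => // yE; apply: nE.
  have m0 : measurable (~` E0 `*` [set: BX]) by apply: measurableX => //; exact: measurableC.
  have m1 : measurable ([set: BX] `*` ~` E1) by apply: measurableX => //; exact: measurableC.
  apply: (le_trans (le_measure _ _ _ sub)); rewrite ?inE.
  - exact: measurableC.
  - exact: measurableU.
  apply: (le_trans (measureU2 _ m0 m1)).
  have [q0 _] := cQ _ (measurableC mE0); have [_ q1] := cQ _ (measurableC mE1).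
  by rewrite -q0 -q1.
pose p := fine (Q E); have pE : Q E = p%:E by rewrite fineK.
have p1 : p <= 1 by rewrite -lee_fin -pE probability_le1.
have pe : 1 - e <= p.
  move: QEc; rewrite probability_setC// pE -EFinB lee_fin; lra.
have p0 : 0 < p by lra.
have p2 : 2^-1 <= p by lra.
(* For [e <= 1 / 2] the inverse of [1 - e] is at most [1 + 2 e]. *)
have pe1 : 1 <= p * (1 + 2 * e).
  apply: (@le_trans _ _ ((1 - e) * (1 + 2 * e))); last by rewrite ler_wpM2r//; lra.
  have : 0 <= e * (1 - 2 * e) by rewrite mulr_ge0//; lra.
  by lra.
have QE0 : (0 < Q E)%E by rewrite pE lte_fin.
have [Q' [Q'E Q'f]] := restrict_probability mE QE0.
have [nu0 [nu0E _]] := pushforward_probability Q' (@measurable_fst _ _ BX BX).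
have [nu1 [nu1E _]] := pushforward_probability Q' (@measurable_snd _ _ BX BX).
have fstE A : fst @^-1` A = A `*` [set: BX] :> set (BX * BX).
  by apply/seteqP; split => -[x y]//= -[].
have sndE A : snd @^-1` A = [set: BX] `*` A :> set (BX * BX).
  by apply/seteqP; split => -[x y]//= -[].
have bound (nu mu : probability BX R) (F : set BX) (A : set BX) B :
    measurable A -> measurable F -> measurable B -> nu A = Q' B -> (Q (B `&` E) <= mu F)%E -> (nu A <= 2%:E * mu F)%E.
  move=> mA mF mB nuB QB; have := Q'E B mB; rewrite pE.
  have fn : nu A \is a fin_num by rewrite fin_num_measure.
  have fm : mu F \is a fin_num by rewrite fin_num_measure.
  have nuB' : Q' B = (fine (nu A))%:E by rewrite -nuB fineK.
  rewrite nuB' -EFinM => H; move: QB; rewrite -H -(fineK fn) -(fineK fm) -EFinM !lee_fin.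
  have a0 : 0 <= fine (nu A) by rewrite fine_ge0.
  rewrite /=; move: (fine _) (fine _) a0 => b a b0 ab.
  by have := ler_wpM2l b0 p2; lra.
exists Q', nu0, nu1; split.
- by move=> A mA; rewrite -fstE -sndE; split; rewrite ?nu0E ?nu1E.
- move=> f bf f0; have [mf _] := bf.
  have mF : measurable_fun setT (EFin \o f) by exact/measurable_EFinP.
  have F0 z : (0 <= (EFin \o f) z)%E by rewrite lee_fin.
  have H := Q'f _ mF F0; rewrite pE (bmeas_EFin Q' bf) in H.
  have : (\int[Q]_(x in E) (f x)%:E <= \int[Q]_x (f x)%:E)%E.
    by apply: ge0_subset_integral => // x _; rewrite lee_fin.
  rewrite -H (bmeas_EFin Q bf) -EFinM lee_fin.
  have := bint_ge0 Q f0; have := bint_ge0 Q' f0.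
  move: (\int[Q]_z _) (\int[Q']_z _) => a b b0 a0 ab.
  apply: (@le_trans _ _ (b * (p * (1 + 2 * e)))); first by rewrite ler_peMr.
  by rewrite mulrA mulrC ler_wpM2l//; lra.
- move=> f M bf fM; have [mf _] := bf.
  have f0 z : 0 <= f z by case/andP: (fM z).
  have M0 : 0 <= M by case/andP: (fM point) => ? ?; exact: (le_trans (f0 point)).
  have mF : measurable_fun setT (EFin \o f) by exact/measurable_EFinP.
  have F0 z : (0 <= (EFin \o f) z)%E by rewrite lee_fin.
  have H := Q'f _ mF F0; rewrite pE (bmeas_EFin Q' bf) in H.
  have : (\int[Q]_x (f x)%:E <= \int[Q]_(x in E) (f x)%:E + (M * e)%:E)%E.
    rewrite -(setUv E) ge0_integral_setU//=.
    + apply: leeD => //; apply: (@le_trans _ _ (\int[Q]_(x in ~` E) M%:E)%E).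
        apply: ge0_le_lower_integral => x _; first by rewrite lee_fin.
        by rewrite lee_fin; case/andP: (fM x).
      rewrite integral_cst//=; last exact: measurableC.
      by rewrite EFinM lee_wpmul2l.
    + exact: measurableC.
    + by rewrite setUv; exact/measurable_EFinP.
    + by move=> x _; rewrite lee_fin.
    + by rewrite /disj_set setICr.
  rewrite -H (bmeas_EFin Q bf) -EFinM -EFinD lee_fin.
  have := bint_ge0 Q' f0.
  move: (\int[Q]_z _) (\int[Q']_z _) => a b b0 ab.
  by have : b * p <= b by [rewrite ler_piMr]; lra.
- move=> A mA; have mB : measurable (A `*` [set: BX]) by exact: measurableX.
  have mAE : measurable (A `&` E0) by exact: measurableI.
  apply: (bound _ _ _ _ _ mA mAE mB); first by rewrite nu0E// fstE.
  have [<- _] := cQ _ mAE; apply: le_measure; rewrite ?inE.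
  + exact: measurableI.
  + exact: measurableX.
  + by move=> [x y] /= [[Ax _] [Ex _]].
- move=> A mA; have mB : measurable ([set: BX] `*` A) by exact: measurableX.
  have mAE : measurable (A `&` E1) by exact: measurableI.
  apply: (bound _ _ _ _ _ mA mAE mB); first by rewrite nu1E// sndE.
  have [_ <-] := cQ _ mAE; apply: le_measure; rewrite ?inE.
  + exact: measurableI.
  + exact: measurableX.
  + by move=> [x y] /= [[_ Ay] [_ Ey]].
Qed.

Lemma geoopt_coupling (nu0 nu1 : probability BX R) (P : probability Curves R) :
  GeoOpt nu0 nu1 P -> exists Q : probability (BX * BX)%type R, coupling nu0 nu1 Q /\
    forall f, bmeas f -> \int[Q]_z f z = \int[P]_g f (ev 0 g, ev 1 g).
Proof.
move=> [_ PE _].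
have i0 : 0 <= (0 : R) <= 1 by rewrite lexx ler01.
have i1 : 0 <= (1 : R) <= 1 by rewrite lexx ler01.
have mp := measurable_ev_pair cX i0 i1.
have [Q [QE _]] := pushforward_probability P mp; exists Q; split.
  move=> A mA; have [P0 P1] := PE A mA; split.
    rewrite -P0 QE.
    by congr (P _); apply/seteqP; split => g //= -[].
  rewrite -P1 QE.
  by congr (P _); apply/seteqP; split => g //= -[].
by move=> f bf; exact: bint_pushforward.
Qed.

End plans.

(** * The cost is at most the energy of an upper gradient *)

Section transport_bound.
Context {R : realType} {X : pmetricType R}.
Local Notation d := (@mdist R X).
Local Notation BX := (@BX R X).
Local Notation Curves := (@Curves R X).
Local Notation T := (measurableTypeR R).
Hypothesis cX : compact [set: X].

(** The factor 2 comes from conditioning, and the summand 1 keeps the constant positive when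
    [n = 0], so that its logarithm bounds an entropy. *)
Lemma density_truncation (m mu nu : probability BX R) (f : BX -> R) (n : R) :
  0 <= n -> measurable_fun setT f -> (forall x, 0 <= f x) ->
  (forall A : set BX, measurable A -> mu A = (\int[m]_(x in A) (f x)%:E)%E) ->
  (forall A, measurable A -> (nu A <= 2%:E * mu (A `&` [set x | (f x <= n)%R]))%E) ->
  forall A, measurable A -> (nu A <= (2 * n + 1)%:E * m A)%E.
Proof.
move=> n0 mf f0 muE nuE A mA; apply: (le_trans (nuE A mA)).
have mF : measurable [set x | f x <= n] by exact: measurable_set_le.
have mAF : measurable (A `&` [set x | f x <= n]) by exact: measurableI.
apply: (@le_trans _ _ (2%:E * (n%:E * m A))%E); last first.
  by rewrite muleA lee_wpmul2r// -EFinM lee_fin; lra.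
rewrite lee_wpmul2l ?lee_fin// muE//.
apply: (@le_trans _ _ (\int[m]_(x in A `&` [set x | (f x <= n)%R]) n%:E)%E).
  by apply: ge0_le_lower_integral => x [_ /= fx]; rewrite lee_fin.
rewrite integral_cst// lee_wpmul2l ?lee_fin//; apply: le_measure; rewrite ?inE//.
Qed.

(** [I] and [E] are cost and defect of the geodesic plan, [F] and [A] the energies of [G] along the
    flow and at time 0, and [J] the energy for [mu0]. Cost and defect are [d'] and [q'] for the
    restricted coupling, [dQ] and [q] for the original one; [p] is the dual value for the restricted
    marginals, and [D] bounds the squared distance. *)
Lemma cost_arith (I E F A J q q' d' dQ p D W t e : R) :
  0 < e -> e <= 2^-1 -> 0 < t -> t <= e -> 0 <= D -> 0 <= W ->
  q <= t * e -> (1 - t) * t * I <= 2 * E + t * F -> F <= A + e -> A <= (1 + 2 * e) * J ->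
  q' <= 2 * q -> I <= d' -> q' = d' / 2 - p -> E = I / 2 - p -> 0 <= E ->
  dQ - D * e <= d' -> dQ = W + 2 * q -> 0 <= q -> 0 <= I ->
  W <= J + e * (W + D + 9 + 2 * J).
Proof.
move=> e0 e2 t0 te D0 W0 qt H1 H2 H3 H4 H5 H6 H7 H8 H9 H10 q0 I0.
have Eq : E <= 2 * (t * e) by lra.
have h1 : (1 - t) * I <= 4 * e + F.
  rewrite -(ler_pM2l t0); have : t * ((1 - t) * I) = (1 - t) * t * I by ring.
  move=> ->; apply: (le_trans H1); lra.
have h2 : W - D * e - e <= I.
  have : t * e <= 2^-1 * e by rewrite ler_pM2r//; lra.
  by lra.
have h3 : (1 - e) * I <= (1 - t) * I by rewrite ler_wpM2r//; lra.
have h4 : (1 - e) * (W - D * e - e) <= (1 - e) * I by rewrite ler_wpM2l//; lra.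
have h5 : W - D * e - e - e * W <= (1 - e) * (W - D * e - e).
  have : 0 <= e * (D * e + e) by rewrite mulr_ge0 ?addr_ge0 ?mulr_ge0// ltW.
  by lra.
by lra.
Qed.

(* The order of choices matters: first the truncation level [n] of the densities,
   uniformly in the coupling, then the time [t], and only then the accuracy of the
   almost optimal coupling. *)
Lemma W2sq_le_upper_gradient (m : probability BX R) (K : R) (f0 f1 : X -> R)
    (mu0 mu1 : probability BX R) (phi : X -> R) (G : BX -> R) :
  strongCD m K -> prob_density m f0 -> prob_density m f1 ->
  (forall A : set BX, measurable A -> mu0 A = (\int[m]_(x in A) (f0 x)%:E)%E) ->
  (forall A : set BX, measurable A -> mu1 A = (\int[m]_(x in A) (f1 x)%:E)%E) ->
  kantorovich_potential mu0 mu1 phi -> bmeas G -> (forall x, 0 <= G x) ->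
  plan_upper_gradient m phi (fun x => (G x)%:E) ->
  (W2sq mu0 mu1 <= \int[mu0]_x (G x * G x)%:E)%E.
Proof.
move=> scd [mf0 f00 _] [mf1 f10 _] mu0E mu1E pot bG G0 UG.
have bG2 := bmeas_sqr bG; have [D D0 dD] := mdist_bounded cX.
rewrite (W2K cX pot) (bmeas_EFin mu0 bG2) lee_fin.
set W := W2 mu0 mu1; set J := \int[mu0]_x _.
have J0 : 0 <= J by apply: bint_ge0 => x; exact: sqr_ge0.
have W0 : 0 <= W by rewrite -lee_fin -(W2K cX pot) W2sq_ge0.
have i0 : 0 <= (0 : R) <= 1 by rewrite lexx ler01.
have i1 : 0 <= (1 : R) <= 1 by rewrite lexx ler01.
apply/ler_addgt0Pr => e e0.
have K0 : 0 < W + D ^+ 2 + 9 + 2 * J by have := sqr_ge0 D; lra.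
pose r := Num.min 2^-1 (e / (W + D ^+ 2 + 9 + 2 * J)).
have r0 : 0 < r by rewrite lt_min invr_gt0 ltr0n divr_gt0.
have r2 : r <= 2^-1 by rewrite ge_min lexx.
have rK : r * (W + D ^+ 2 + 9 + 2 * J) <= e by rewrite -ler_pdivlMr// ge_min lexx orbT.
have [n0 Hn0] := tail_le mu0 mf0 (divr_gt0 r0 (ltr0Sn _ 1)).
have [n1 Hn1] := tail_le mu1 mf1 (divr_gt0 r0 (ltr0Sn _ 1)).
have compl (f : X -> R) (a : R) : ~` [set x : BX | f x <= a] = [set x : BX | a < f x].
  by apply/seteqP; split => x /=; rewrite ltNge => /negP.
have mE0 : measurable [set x : BX | f0 x <= n0%:R] by exact: measurable_set_le.
have mE1 : measurable [set x : BX | f1 x <= n1%:R] by exact: measurable_set_le.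
have small : (mu0 (~` [set x : BX | (f0 x <= n0%:R)%R]) +
    mu1 (~` [set x : BX | (f1 x <= n1%:R)%R]) <= r%:E)%E.
  by rewrite !compl (splitr r) EFinD leeD.
pose C0 : R := Num.max (2 * n0%:R + 1) (2 * n1%:R + 1).
have C00 : 0 < C0 by rewrite lt_max ltr_wpDl// mulr_ge0.
pose C := C0 * expR (`|K| * D ^+ 2 / 8).
have CC0 : 0 <= C by rewrite mulr_ge0 ?expR_ge0// ltW.
have [t0 t00 Ht0] := flow_integral_cvg cX m bG2 (fun x => sqr_ge0 (G x)) CC0 r0.
pose t := Num.min t0 r.
have tp : 0 < t by rewrite lt_min t00.
have tt0 : t <= t0 by rewrite ge_min lexx.
have tr : t <= r by rewrite ge_min lexx orbT.
have t01 : 0 <= t <= 1 by rewrite ltW//=; lra.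
have [Q cQ eQ] := exists_almost_optimal cX pot (mulr_gt0 tp r0).
have r01 : 0 <= r <= 2^-1 by rewrite ltW.
have [Q' [nu0 [nu1 [cQ' upQ loQ nu0E nu1E]]]] := restrict_coupling cQ mE0 mE1 r01 small.
have nuC0 A : measurable A -> (nu0 A <= C0%:E * m A)%E.
  move=> mA; have H := density_truncation (ler0n _ n0) mf0 f00 mu0E nu0E mA.
  apply: (le_trans H).
  by rewrite lee_wpmul2r// lee_fin le_max lexx.
have nuC1 A : measurable A -> (nu1 A <= C0%:E * m A)%E.
  move=> mA; have H := density_truncation (ler0n _ n1) mf1 f10 mu1E nu1E mA.
  apply: (le_trans H).
  by rewrite lee_wpmul2r// lee_fin le_max lexx orbT.
have [P gP PC] := strongCD_density_bound cX scd dD C00 nuC0 nuC1.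
have [Pg PE PW] := gP.
have [QP [cQP QPf]] := geoopt_coupling cX gP.
have bd2 := bmeas_sqr (mdist_bmeas cX); have be := defect_bmeas cX pot.
have H1 := plan_cost_le cX pot bG G0 UG CC0 Pg PC t01.
have H2 := Ht0 P t Pg PC t01 tt0.
have H3 : \int[P]_g (G (ev 0 g)) ^+ 2 <= (1 + 2 * r) * J.
  have bG1 := bmeas_comp (@measurable_fst _ _ BX BX) bG2.
  have := upQ _ bG1 (fun z => sqr_ge0 _).
  have [-> _] := coupling_bint cQ bG2; have [-> _] := coupling_bint cQ' bG2.
  have [<- _] := coupling_bint cQP bG2.
  by rewrite QPf.
have H4 : \int[Q']_z defect phi z <= 2 * \int[Q]_z defect phi z.
  apply: (le_trans (upQ _ be (defect_ge0 cX pot))); rewrite ler_wpM2r//; last by lra.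
  by apply: bint_ge0 => z; exact: (defect_ge0 cX pot).
have IP : \int[QP]_z (d z.1 z.2) ^+ 2 = \int[P]_g (d (ev 0 g) (ev 1 g)) ^+ 2 by rewrite QPf.
have eP : \int[QP]_z defect phi z = \int[P]_g defect phi (ev 0 g, ev 1 g) by rewrite QPf.
(* The geodesic plan is optimal for the restricted marginals and [Q'] is one of their couplings. As
   both have the same dual value, the defect of the plan is at most that of [Q']. *)
have H5 : \int[P]_g (d (ev 0 g) (ev 1 g)) ^+ 2 <= \int[Q']_z (d z.1 z.2) ^+ 2.
  rewrite -lee_fin -(bmeas_EFin Q' bd2) -(bmeas_EFin P (bmeas_sqr (dist01_bmeas cX))) PW.
  by apply: ereal_inf_lbound; exists Q'.
have H6 := defect_integral cX pot cQ'; have H7 := defect_integral cX pot cQP.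
have H8 : 0 <= \int[QP]_z defect phi z by apply: bint_ge0 => z; exact: (defect_ge0 cX pot).
have H9 : \int[Q]_z (d z.1 z.2) ^+ 2 - D ^+ 2 * r <= \int[Q']_z (d z.1 z.2) ^+ 2.
  apply: loQ => // z; rewrite sqr_ge0/= ler_sqr ?nnegrE ?mdist_ge0//; exact: ltW.
have H10 := integral_cost cX pot cQ.
have H11 : 0 <= \int[Q]_z defect phi z by apply: bint_ge0 => z; exact: (defect_ge0 cX pot).
rewrite -/W in H10; rewrite IP eP in H7 H8.
have H12 : 0 <= \int[P]_g (d (ev 0 g) (ev 1 g)) ^+ 2 by apply: bint_ge0 => g; exact: sqr_ge0.
apply: (le_trans (cost_arith r0 r2 tp tr (sqr_ge0 D) W0 eQ H1 H2 H3 H4 H5 _ _ H8 H9 H10 H11 H12)).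
- by rewrite H6 -addrA -opprD.
- by rewrite H7 -addrA -opprD.
- by rewrite lerD2l.
Qed.

End transport_bound.

(** * Weak convergence in L2 *)

Section square_integrable.
Context {R : realType} {X : pmetricType R}.
Local Notation BX := (@BX R X).
Variable m : probability BX R.
Implicit Types (f g : X -> R).

Lemma L2_le f g : measurable_fun setT (f : BX -> R) -> L2 m g ->
  (forall x, `|f x| <= `|g x|) -> L2 m f.
Proof.
move=> mf [mg g2] fg; split => //; apply: le_lt_trans g2.
apply: ge0_le_lower_integral => x _; rewrite lee_fin ?sqr_ge0//.
by rewrite -(real_normK (num_real (f x))) -(real_normK (num_real (g x))) ler_sqr ?nnegrE.
Qed.

Lemma bmeas_L2 f : bmeas (f : BX -> R) -> L2 m f.
Proof.
move=> bf; split; first by case: bf.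
by rewrite (bmeas_EFin m (bmeas_sqr bf)) ltry.
Qed.

Lemma measurable_sqr f : measurable_fun setT (f : BX -> R) ->
  measurable_fun setT (fun x : BX => ((f x) ^+ 2)%:E).
Proof. by move=> mf; apply/measurable_EFinP; exact: measurable_funX. Qed.

Lemma L2D f g : L2 m f -> L2 m g -> L2 m (fun x => f x + g x).
Proof.
move=> [mf f2] [mg g2]; split; first exact: measurable_funD.
have mf2 := measurable_sqr mf; have mg2 := measurable_sqr mg.
apply: (@le_lt_trans _ _ (\int[m]_x (2%:E * ((f x) ^+ 2)%:E + 2%:E * ((g x) ^+ 2)%:E)))%E.
  apply: ge0_le_lower_integral => x _; first by rewrite lee_fin sqr_ge0.
  rewrite -!EFinM -EFinD lee_fin; have := sqr_ge0 (f x - g x); rewrite sqrrB sqrrD.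
  by move: (f x ^+ 2) (g x ^+ 2) (f x * g x) => a b c; rewrite !mulr2n; lra.
rewrite ge0_integralD//.
- rewrite !ge0_integralZl//; try by move=> x _; rewrite lee_fin sqr_ge0.
  by apply: lte_add_pinfty; apply: lte_mul_pinfty.
- by move=> x _; rewrite -EFinM lee_fin mulr_ge0 ?sqr_ge0.
- exact: measurable_funeM.
- by move=> x _; rewrite -EFinM lee_fin mulr_ge0 ?sqr_ge0.
- exact: measurable_funeM.
Qed.

Lemma L2M_integrable f g : L2 m f -> L2 m g ->
  m.-integrable setT (fun x : BX => (f x * g x)%:E).
Proof.
move=> Lf Lg; have [_ fg2] := L2D Lf Lg; have [mf f2] := Lf; have [mg g2] := Lg.
have mf2 := measurable_sqr mf; have mg2 := measurable_sqr mg.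
apply/integrableP; split; first by apply/measurable_EFinP; exact: measurable_funM.
apply: (@le_lt_trans _ _ (\int[m]_x (((f x) ^+ 2)%:E + ((g x) ^+ 2)%:E)))%E.
  apply: ge0_le_lower_integral => x _; first by rewrite abse_ge0.
  rewrite -EFinD /= lee_fin normrM.
  have := sqr_ge0 (`|f x| - `|g x|); rewrite sqrrB !real_normK ?num_real//.
  have := sqr_ge0 (f x); have := sqr_ge0 (g x).
  by move: (f x ^+ 2) (g x ^+ 2) (`|f x| * `|g x|) => a b c; rewrite !mulr2n; lra.
rewrite ge0_integralD//; first exact: lte_add_pinfty.
- by move=> x _; rewrite lee_fin sqr_ge0.
- by move=> x _; rewrite lee_fin sqr_ge0.
Qed.

Lemma L2Z (c : R) f : L2 m f -> L2 m (fun x => c * f x).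
Proof.
move=> [mf f2]; split; first exact: measurable_funM.
under eq_integral do rewrite exprMn EFinM.
rewrite ge0_integralZl//; last 3 first.
- exact: measurable_sqr.
- by move=> x _; rewrite lee_fin sqr_ge0.
- by rewrite lee_fin sqr_ge0.
by apply: lte_mul_pinfty => //; rewrite lee_fin sqr_ge0.
Qed.

Lemma L2B f g : L2 m f -> L2 m g -> L2 m (fun x => f x - g x).
Proof.
move=> Lf Lg; have := L2D Lf (L2Z (-1) Lg).
by rewrite (_ : (fun x => _) = (fun x => f x - g x))//; apply/funext => x; rewrite mulN1r.
Qed.

Lemma L2_norm f : L2 m f -> L2 m (fun x => `|f x|).
Proof.
move=> Lf; apply: (L2_le _ Lf); first by case: Lf => mf _; exact: measurableT_comp.
by move=> x; rewrite normr_id.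
Qed.

Lemma L2_bmeasM f g : L2 m f -> bmeas (g : BX -> R) -> L2 m (fun x => f x * g x).
Proof.
move=> Lf [mg [M gM]]; have [mf _] := Lf; apply: (L2_le _ (L2Z M Lf)).
  exact: measurable_funM.
move=> x; rewrite !normrM mulrC ler_wpM2r//.
by apply: (le_trans (gM x)); exact: ler_norm.
Qed.

Lemma L2_max0 f : L2 m f -> L2 m (fun x => Num.max (f x) 0).
Proof.
move=> Lf; have [mf _] := Lf; apply: (L2_le _ Lf); first exact: measurable_maxr.
by move=> x; case: (leP (f x) 0) => fx; rewrite ?normr0.
Qed.

Lemma L2_int_EFin f g : L2 m f -> L2 m g ->
  (\int[m]_x (f x * g x)%:E = (\int[m]_x (f x * g x))%R%:E)%E.
Proof.
move=> Lf Lg; rewrite /Rintegral fineK//.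
exact: (integrable_fin_num measurableT (L2M_integrable Lf Lg)).
Qed.

Lemma weakL2_cvgP (hn : nat -> X -> R) h v : weakL2_cvg m hn h -> L2 m h -> L2 m v ->
  (fun n => \int[m]_x (hn n x * v x)) @ \oo --> \int[m]_x (h x * v x).
Proof.
by move=> wh Lh Lv; have := wh v Lv; rewrite (L2_int_EFin Lh Lv) => /fine_cvg.
Qed.

(** The test function is the indicator of the set where [h] is negative. *)
Lemma L2_ge0_ae h : L2 m h -> (forall v, bmeas (v : BX -> R) -> (forall x, 0 <= v x) ->
  0 <= \int[m]_x (h x * v x)) -> {ae m, forall x : BX, 0 <= h x}.
Proof.
move=> Lh H; have [mh _] := Lh.
pose v (x : X) : R := \1_[set x : BX | h x < 0] x.
have mA : measurable [set x : BX | h x < 0] by exact: measurable_set_lt.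
have bv : bmeas (v : BX -> R).
  split; first exact: measurable_indic.
  by exists 1 => x; rewrite /v indicE; case: (x \in _); rewrite ?normr1 ?normr0.
have v0 x : 0 <= v x by rewrite /v indicE.
have Lhv := L2_bmeasM Lh bv.
have nv x : 0 <= - (h x * v x).
  rewrite /v indicE; have [/set_mem/= h0|_] := boolP (x \in _); last by rewrite mulr0 oppr0.
  by rewrite mulr1 oppr_ge0 ltW.
have I0 : (\int[m]_x (- (h x * v x))%:E = 0)%E.
  apply/eqP; rewrite eq_le; apply/andP; split; last first.
    by apply: integral_ge0 => x _; rewrite lee_fin.
  have iv := L2M_integrable Lh (bmeas_L2 bv).
  under eq_integral do rewrite EFinN.
  rewrite integralN; last exact: integrable_add_def.
  by rewrite (L2_int_EFin Lh (bmeas_L2 bv)) -EFinN lee_fin oppr_le0 H.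
have mn : measurable_fun setT (fun x : BX => - (h x * v x)).
  by apply: measurableT_comp => //; apply: measurable_funM => //; case: bv.
have FF := ae_filter_ringOfSetsType m.
apply: filterS (ge0_integral_eq0_ae mn nv I0) => x.
rewrite /v indicE; have [/set_mem/= h0|/negP nh _] := boolP (x \in _).
  by rewrite mulr1 => /eqP; rewrite oppr_eq0 lt_eqF.
by rewrite leNgt; apply/negP => h0; apply: nh; rewrite inE.
Qed.

End square_integrable.

(** * A countable algebra of sets that is dense for all finite measures *)

Section algebra_of_balls.
Context d (T : measurableType d) (R : realType).
Variable B : nat -> set T.
Hypothesis mB : forall n, measurable (B n).

(** Finite trees code the algebra generated by the [B n]: a node denotes the complement of the union
    of its children. There are countably many trees, so the algebra can be enumerated. *)
Fixpoint tree_set (t : GenTree.tree nat) : set T :=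
  match t with
  | GenTree.Leaf n => B n
  | GenTree.Node _ s => ~` (foldr (fun t A => tree_set t `|` A) set0 s)
  end.

Lemma tree_setC t : tree_set (GenTree.Node 0 [:: t]) = ~` tree_set t.
Proof. by rewrite /= setU0. Qed.

Lemma tree_setU t u :
  tree_set (GenTree.Node 0 [:: GenTree.Node 0 [:: t; u]]) = tree_set t `|` tree_set u.
Proof. by rewrite tree_setC /= setU0 setCK. Qed.

Lemma measurable_tree_set : forall t, measurable (tree_set t).
Proof.
fix IH 1 => -[n|k s]; first exact: mB.
apply: measurableC; elim: s => [|t s IHs] /=; first exact: measurable0.
by apply: measurableU.
Qed.

Variable nu : {finite_measure set T -> \bar R}.

Definition tree_approx (A : set T) :=
  measurable A /\ forall e, 0 < e -> exists t, (nu (A `+` tree_set t) < e%:E)%E.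

Lemma measurableY (A C : set T) : measurable A -> measurable C -> measurable (A `+` C).
Proof. by move=> mA mC; apply: measurableU; apply: measurableD. Qed.

Lemma tree_approxB n : tree_approx (B n).
Proof.
split => // e e0; exists (GenTree.Leaf n); rewrite /= setYK measure0 lte_fin//.
Qed.

Lemma tree_approxC A : tree_approx A -> tree_approx (~` A).
Proof.
move=> [mA HA]; split; first exact: measurableC.
move=> e /HA[t At]; exists (GenTree.Node 0 [:: t]); rewrite tree_setC.
rewrite (_ : _ `+` _ = A `+` tree_set t)//.
by rewrite /setY !setDE !setCK; apply/seteqP; split => x /=; tauto.
Qed.

Lemma tree_approxU A C : tree_approx A -> tree_approx C -> tree_approx (A `|` C).
Proof.
move=> [mA HA] [mC HC]; split; first exact: measurableU.
move=> e e0; have e20 : 0 < e / 2 by rewrite divr_gt0.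
have [t At] := HA _ e20; have [u Cu] := HC _ e20.
exists (GenTree.Node 0 [:: GenTree.Node 0 [:: t; u]]); rewrite tree_setU.
have m1 : measurable (A `+` tree_set t) by apply: measurableY => //; exact: measurable_tree_set.
have m2 : measurable (C `+` tree_set u) by apply: measurableY => //; exact: measurable_tree_set.
apply: (@le_lt_trans _ _ (nu ((A `+` tree_set t) `|` (C `+` tree_set u)))).
  apply: le_measure; rewrite ?inE.
  - by apply: measurableY; apply: measurableU => //; exact: measurable_tree_set.
  - exact: measurableU.
  - by rewrite /setY => x /=; tauto.
apply: (le_lt_trans (measureU2 _ m1 m2)).
by rewrite (splitr e) EFinD; apply: lteD.
Qed.

Lemma tree_approx0 : tree_approx set0.
Proof.
split => // e e0; exists (GenTree.Node 0 [:: GenTree.Node 0 [::]]).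
by rewrite tree_setC /= setCK setYK measure0 lte_fin.
Qed.

(** What a finite union leaves out of the whole union decreases to the empty set, so its measure
    tends to 0; a finite union is then approximated by a tree. *)
Lemma tree_approx_bigcup (F : nat -> set T) : (forall i, tree_approx (F i)) ->
  tree_approx (\bigcup_i F i).
Proof.
move=> HF; have mF i : measurable (F i) by case: (HF i).
have mU : measurable (\bigcup_i F i) by exact: bigcupT_measurable.
split => // e e0; have e20 : 0 < e / 2 by rewrite divr_gt0.
pose V n := \bigcup_(i < n) F i.
have HV n : tree_approx (V n).
  elim: n => [|n IH]; first by rewrite /V bigcup_mkord big_ord0; exact: tree_approx0.
  by rewrite /V bigcup_mkord big_ord_recr/= -bigcup_mkord; exact: tree_approxU.
have mV n : measurable (V n) by case: (HV n).
pose W n := \bigcup_i F i `\` V n.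
have mW n : measurable (W n) by exact: measurableD.
have W0 : \bigcap_n W n = set0.
  apply/seteqP; split => // x Hx; have [[i _ Fi] _] := Hx 0%N I.
  by have [_] := Hx i.+1 I; apply; exists i => /=.
have cv : nu \o W @ \oo --> 0%E.
  rewrite -(measure0 nu) -W0; apply: nonincreasing_cvg_mu => //.
  - by rewrite -ge0_fin_numE// fin_num_measure.
  - by rewrite W0.
  - move=> n k nk; apply/subsetPset => x [Fx Vx]; split => // -[i /= ik Fi]; apply: Vx.
    by exists i => //=; rewrite (leq_trans ik).
have [n Hn] := ereal_cvg0_lt cv e20; rewrite /= in Hn.
have [_ /(_ _ e20)[t Ht]] := HV n; exists t.
have m2 : measurable (V n `+` tree_set t) by apply: measurableY => //; exact: measurable_tree_set.
apply: (@le_lt_trans _ _ (nu (W n `|` (V n `+` tree_set t)))).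
  apply: le_measure; rewrite ?inE.
  - by apply: measurableY => //; exact: measurable_tree_set.
  - exact: measurableU.
  - move=> x [[Ux tx]|[tx Ux]].
      by have [Vx|Vx] := pselect (V n x); [right; left|left].
    by right; right; split => // -[i _ Fi]; apply: Ux; exists i.
apply: (le_lt_trans (measureU2 _ (mW n) m2)).
by rewrite (splitr e) EFinD; apply: lteD.
Qed.

End algebra_of_balls.

Section weak_compactness.
Context {R : realType} {X : pmetricType R}.
Local Notation d := (@mdist R X).
Local Notation BX := (@BX R X).
Hypothesis cX : compact [set: X].

(** The sequence is fixed before the measure. Convergence of integrals over countably many sets can
    therefore be arranged first and extended afterwards with whatever measure dominates. *)
Lemma countable_algebra : exists E : nat -> set BX, (forall j, measurable (E j)) /\
  forall (nu : {finite_measure set BX -> \bar R}) (A : set BX), measurable A ->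
  forall e, 0 < e -> exists j, (nu (A `+` E j) < e%:E)%E.
Proof.
have [c [r Hcr]] := open_bigcup_balls cX.
pose B k : set BX := [set y | d (c k) y < r k].
have mB k : measurable (B k) by apply: measurable_open; exact: open_mball.
pose E j := tree_set B (odflt (GenTree.Leaf 0) (@choice.unpickle (GenTree.tree nat) j)).
exists E; split => [j|nu A mA e e0]; first exact: measurable_tree_set.
suff [_ /(_ e e0)[t Ht]] : tree_approx B nu A by exists (choice.pickle t); rewrite /E choice.pickleK.
move: A mA; apply: (measurable_BX_ind cX (D := tree_approx B nu)).
- move=> x s; rewrite (Hcr _ (open_mball x s)) bigcup_mkcond.
  apply: tree_approx_bigcup => // k; case: ifPn => _; first exact: tree_approxB.
  exact: tree_approx0.
- by move=> A; exact: tree_approxC.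
- by move=> F; exact: tree_approx_bigcup.
Qed.

End weak_compactness.

(** * Weak subsequential limits of dominated sequences *)

Section weak_extraction.
Context {R : realType} {X : pmetricType R}.
Local Notation d := (@mdist R X).
Local Notation BX := (@BX R X).
Hypothesis cX : compact [set: X].
Variable m : probability BX R.

Lemma indic_bmeas (A : set BX) : measurable A -> bmeas (\1_A : BX -> R).
Proof.
move=> mA; split; first exact: measurable_indic.
by exists 1 => x; rewrite indicE; case: (x \in _); rewrite ?normr1 ?normr0.
Qed.

Lemma integral_indicM (f : BX -> R) (A : set BX) : measurable A ->
  (\int[m]_x (f x * \1_A x)%:E = \int[m]_(x in A) (f x)%:E)%E.
Proof.
move=> mA; rewrite [RHS]integral_mkcond; apply: eq_integral => x _.
rewrite patchE indicE; case: (x \in A); first by rewrite mulr1.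
by rewrite mulr0.
Qed.

Section nonnegative.
Variables (kn rn : nat -> X -> R) (r : X -> R).
Hypothesis bkn : forall n, bmeas (kn n : BX -> R).
Hypothesis brn : forall n, bmeas (rn n : BX -> R).
Hypothesis kr : forall n x, 0 <= kn n x <= rn n x.
Hypothesis Lr : L2 m r.
Hypothesis r0 : forall x, 0 <= r x.
Hypothesis rnr : weakL2_cvg m rn r.

Let ir : m.-integrable setT (EFin \o r : BX -> \bar R).
Proof.
have := L2M_integrable Lr (bmeas_L2 m (@bmeas_cst _ BX R 1)).
by apply: eq_integrable => // x _; rewrite mulr1.
Qed.

Let mr : measurable_fun setT (r : BX -> R). Proof. by case: Lr. Qed.

Lemma density_measure : exists lam : {finite_measure set BX -> \bar R},
  forall A, lam A = (\int[m]_(x in A) (r x)%:E)%E.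
Proof.
have F0 x : (0 <= (r x)%:E)%E by rewrite lee_fin.
have [||||Q QE] := @exists_finite_measure _ BX R (fun A => \int[m]_(x in A) (r x)%:E)%E.
- by rewrite integral_set0.
- by move=> A; apply: integral_ge0.
- by apply: semi_sigma_additive_nng_induced => //; exact/measurable_EFinP.
- move=> A mA; apply: integrable_fin_num => //; exact: integrableS ir.
by exists Q => A; rewrite QE.
Qed.

Local Notation I n A := (\int[m]_x (kn n x * \1_A x)).

Lemma near_rn (v : X -> R) e : L2 m v -> 0 < e ->
  \forall n \near \oo, \int[m]_x (rn n x * v x) <= \int[m]_x (r x * v x) + e.
Proof.
move=> Lv e0; have := weakL2_cvgP rnr Lr Lv.
move=> /cvgrPdist_le/(_ _ e0); apply: filterS => n; rewrite ler_norml => /andP[h _].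
by move: h; lra.
Qed.

Lemma ultra_limit : exists (U : set_system nat) (nu : set X -> R),
  [/\ UltraFilter U, \oo `<=` U, forall A, 0 <= nu A &
    forall A : set BX, measurable A -> (fun n => I n A) @ U --> nu A /\
      nu A <= \int[m]_x (r x * \1_A x)].
Proof.
have [U [UU sU]] := @ultraFilterLemma nat \oo _.
exists U.
have H (A : set X) : exists l : R, 0 <= l /\ (measurable (A : set BX) ->
    (fun n => I n A) @ U --> l /\ l <= \int[m]_x (r x * \1_A x)).
  have [mA|nA] := pselect (measurable (A : set BX)); last by exists 0.
  have b1 := indic_bmeas mA; have L1 := bmeas_L2 m b1.
  have i0 x : 0 <= \1_A x :> R by rewrite indicE.
  have I0 n : 0 <= I n A by apply: bint_ge0 => x; rewrite mulr_ge0//; case/andP: (kr n x).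
  have In e : 0 < e -> \forall n \near \oo, I n A <= \int[m]_x (r x * \1_A x) + e.
    move=> e0; apply: filterS (near_rn L1 e0) => n; apply: le_trans.
    apply: bint_le; [exact: bmeasM|exact: bmeasM|move=> x].
    by rewrite ler_wpM2r//; case/andP: (kr n x).
  have K := @segment_compact R 0 (\int[m]_x (r x * \1_A x) + 1).
  have FU : ProperFilter U by exact: ultra_proper.
  have [|l [/= lB ll]] := K ((fun n => I n A) @ U) (fmap_proper_filter _ FU).
    by apply: sU; apply: filterS (In 1 ltr01) => n In1; rewrite /= in_itv/= I0.
  have cl : (fun n => I n A) @ U --> l.
    move=> B nB; have [//|UB] := in_ultra_setVsetC ((fun n => I n A) @^-1` B) UU.
    by have [x [nx Bx]] := ll (~` B) B UB nB.
  move: lB;  rewrite in_itv/= => /andP[l0 _]; exists l; split => // _; split => //.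
  apply/ler_addgt0Pr => e e0.
  by apply: (cvgr_to_le cl); apply: sU; exact: In.
have [nu Hnu] := choice H.
by exists nu; split => // A; [case: (Hnu A)|move=> mA; case: (Hnu A) => _ /(_ mA)].
Qed.

(** The set function [nu] inherits finite additivity from the integrals, and the bound by the
    measure [lam] with density [r] makes it countably additive; [k] is its density. The ultrafilter
    is then traded for a sequence of indices that is adequate on the algebra [E]. *)
Lemma exists_limit_density : exists (s : nat -> nat) (k : X -> R),
  [/\ forall n, (n <= s n)%N, measurable_fun setT (k : BX -> R), forall x, 0 <= k x <= r x &
    exists E : nat -> set BX, [/\ forall j, measurable (E j),
      forall (nu : {finite_measure set BX -> \bar R}) (A : set BX), measurable A ->
        forall e, 0 < e -> exists j, (nu (A `+` E j) < e%:E)%E &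
      forall j, (fun n => I (s n) (E j)) @ \oo --> \int[m]_x (k x * \1_(E j) x)]].
Proof.
have [U [nu [UU sU nu0 nuU]]] := ultra_limit.
have FU : ProperFilter U by exact: ultra_proper.
have [lam lamE] := density_measure.
have Lr1 (A : set BX) (mA : measurable A) := L2_int_EFin Lr (bmeas_L2 m (indic_bmeas mA)).
have nulam (A : set BX) : measurable A -> ((nu A)%:E <= lam A)%E.
  move=> mA; have [_ h] := nuU A mA.
  by rewrite lamE -integral_indicM// Lr1// lee_fin.
have nuD (A C : set BX) : measurable A -> measurable C -> A `&` C = set0 ->
    nu (A `|` C) = nu A + nu C.
  move=> mA mC AC; have [hA _] := nuU A mA; have [hC _] := nuU C mC.
  have [hU _] := nuU _ (measurableU _ _ mA mC).
  apply: (cvg_unique _ hU); first exact: norm_hausdorff.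
  rewrite (_ : (fun n => _) = (fun n => I n A + I n C)); first exact: cvgD.
  apply/funext => n; have bA := indic_bmeas mA; have bC := indic_bmeas mC.
  rewrite -bintD; [|exact: bmeasM|exact: bmeasM].
  apply: eq_Rintegral => x _; rewrite -mulrDr; congr (_ * _).
  rewrite !indicE in_setU; have [xA|xA] := boolP (x \in A); have [xC|xC] := boolP (x \in C);
    rewrite /= ?addr0 ?add0r//.
  have : (A `&` C) x by split; exact: set_mem.
  by rewrite AC.
have n0 : nu set0 = 0.
  have := nuD _ _ measurable0 measurable0 (set0I _); rewrite setU0 => /eqP.
  by rewrite -subr_eq0 opprD addrA subrr sub0r oppr_eq0 => /eqP.
have sadd : semi_sigma_additive (fun A : set BX => (nu A)%:E).
  move=> F mF tF mU; pose V n := \bigcup_(i < n) F i; pose W n := \bigcup_i F i `\` V n.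
  have mV n : measurable (V n) by apply: bigcup_measurable => i _.
  have mW n : measurable (W n) by exact: measurableD.
  have VS n : nu (V n) = \sum_(0 <= i < n) nu (F i).
    elim: n => [|n IH]; first by rewrite /V bigcup_mkord big_ord0 n0 big_nil.
    rewrite /V bigcup_mkord big_ord_recr/= -bigcup_mkord nuD//.
    - by rewrite big_nat_recr//= IH.
    - exact: mV.
    apply/seteqP; split => // x [[i /= ni Fi] Fn].
    have := tF i n Logic.I Logic.I; move=> /(_ (ex_intro _ x (conj Fi Fn))) ein.
    by rewrite ein ltnn in ni.
  have W0 : \bigcap_n W n = set0.
    apply/seteqP; split => // x Hx; have [[i _ Fi] _] := Hx 0%N Logic.I.
    by have [_] := Hx i.+1 Logic.I; apply; exists i => /=.
  have cvW : lam \o W @ \oo --> 0%E.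
    rewrite -(measure0 lam) -W0; apply: nonincreasing_cvg_mu => //.
    + by rewrite -ge0_fin_numE// fin_num_measure.
    + by rewrite W0.
    + move=> n k nk; apply/subsetPset => x [Fx Vx]; split => // -[i /= ik Fi]; apply: Vx.
      by exists i => //=; rewrite (leq_trans ik).
  have cvnW : (fun n => (nu (W n))%:E) @ \oo --> 0%E.
    apply: (squeeze_cvge _ (cvg_cst _) cvW); apply: nearW => n.
    by rewrite lee_fin nu0/=; exact: nulam.
  rewrite (_ : (fun n => _) = (fun n => (nu (\bigcup_i F i) - nu (W n))%:E)); last first.
    apply/funext => n; rewrite sumEFin -VS; congr EFin.
    have : nu (V n `|` W n) = nu (V n) + nu (W n).
      by apply: nuD => //; rewrite /W setDE setICA setICr setI0.
    rewrite /W setDUK; last by move=> x [i _ Fi]; exists i.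
    by move=> ->; rewrite addrK.
  rewrite -[X in _ --> X]sube0 [X in X%:E]/= .
  under eq_fun do rewrite EFinB.
  by apply: cvgeB => //; exact: cvg_cst.
have h1 : (nu set0)%:E = 0%E by rewrite n0.
have h2 (A : set BX) : (0 <= (nu A)%:E)%E by rewrite lee_fin.
have h3 : fin_num_fun (fun A : set BX => (nu A)%:E) by [].
have [num numE] := @exists_finite_measure _ BX R (fun A => (nu A)%:E) h1 h2 sadd h3.
have numA A : num A = (nu A)%:E by rewrite numE.
have [|k [mk kr' numk]] := @exists_density_le _ BX R num m r ir r0.
  by move=> A mA; rewrite numA -lamE; exact: nulam.
have k0 x : 0 <= k x by case/andP: (kr' x).
have Lk : L2 m k.
  by apply: (L2_le mk Lr) => x; rewrite !ger0_norm//; case/andP: (kr' x).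
have nuk (A : set BX) : measurable A -> nu A = \int[m]_x (k x * \1_A x).
  move=> mA; apply: EFin_inj; rewrite -numA numk// -integral_indicM//.
  by rewrite (L2_int_EFin Lk (bmeas_L2 m (indic_bmeas mA))).
have [E [mE dE]] := countable_algebra cX.
(* Finitely many conditions, each true on a set of the ultrafilter, hold on a common set of the
   ultrafilter, which is nonempty. *)
have near_N N : exists n, (N <= n)%N /\
    forall j, (j < N)%N -> `|nu (E j) - I n (E j)| < N.+1%:R^-1.
  suff H M : \forall n \near U, (N <= n)%N /\
      forall j, (j < M)%N -> `|nu (E j) - I n (E j)| < N.+1%:R^-1.
    exact: (filter_ex (H N)).
  elim: M => [|M IH].
    have UN : \forall n \near U, (N <= n)%N by apply: sU; exists N.
    by apply: filterS UN => n Nn; split.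
  have [/cvgrPdist_lt/(_ N.+1%:R^-1 _) cv _] := nuU _ (mE M).
  have {}cv := cv ltac:(by rewrite invr_gt0).
  apply: filterS2 IH cv => n [Nn IH] cvn; split => // j; rewrite ltnS leq_eqVlt => /orP[/eqP->//|].
  exact: IH.
have [s Hs] := choice near_N.
exists s, k; split => //; first by move=> n; case: (Hs n).
exists E; split => // j; rewrite -nuk//; apply/cvgrPdist_lt => e e0.
near=> n; have [_ /(_ j) H] := Hs n; apply: (lt_trans (H _)).
  by near: n; exists j.+1.
by near: n; exact: (near_infty_natSinv_lt (PosNum e0)).
Unshelve. all: by end_near. Qed.

Lemma L2_intD f v w : L2 m f -> L2 m v -> L2 m w ->
  \int[m]_x (f x * (v x + w x)) = \int[m]_x (f x * v x) + \int[m]_x (f x * w x).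
Proof.
move=> Lf Lv Lw; under eq_Rintegral do rewrite mulrDr.
by apply: RintegralD => //; exact: L2M_integrable.
Qed.

Lemma L2_intZ f v (c : R) : L2 m f -> L2 m v ->
  \int[m]_x (f x * (c * v x)) = c * \int[m]_x (f x * v x).
Proof.
move=> Lf Lv; under eq_Rintegral do rewrite mulrCA.
by apply: RintegralZl => //; exact: L2M_integrable.
Qed.

Lemma L2_int_le f g v : L2 m f -> L2 m g -> L2 m v -> (forall x, f x <= g x) ->
  (forall x, 0 <= v x) -> \int[m]_x (f x * v x) <= \int[m]_x (g x * v x).
Proof.
move=> Lf Lg Lv fg v0; apply: le_Rintegral => //; [exact: L2M_integrable|exact: L2M_integrable|].
by move=> x _; rewrite ler_wpM2r.
Qed.

Lemma L2_int_dist f v w : L2 m f -> L2 m v -> L2 m w -> (forall x, 0 <= f x) ->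
  `|\int[m]_x (f x * v x) - \int[m]_x (f x * w x)| <= \int[m]_x (f x * `|v x - w x|).
Proof.
move=> Lf Lv Lw f0; have Ln := L2_norm (L2B Lv Lw).
have H v' w' : L2 m v' -> L2 m w' -> (forall x, `|v' x - w' x| = `|v x - w x|) ->
    \int[m]_x (f x * v' x) - \int[m]_x (f x * w' x) <= \int[m]_x (f x * `|v x - w x|).
  move=> Lv' Lw' E; rewrite lerBlDr -L2_intD//.
  apply: le_Rintegral => //; [exact: L2M_integrable|exact: L2M_integrable (L2D _ _)|].
  by move=> x _; rewrite ler_wpM2l// -lerBlDr -E ler_norm.
rewrite ler_norml lerNl opprB !H// => x; exact: distrC.
Qed.

Section limit.
Variables (s : nat -> nat) (k : X -> R).
Hypothesis sN : forall n, (n <= s n)%N.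
Hypothesis mk : measurable_fun setT (k : BX -> R).
Hypothesis kr' : forall x, 0 <= k x <= r x.

Let k0 x : 0 <= k x. Proof. by case/andP: (kr' x). Qed.
Let Lk : L2 m k.
Proof.
by apply: (L2_le mk Lr) => x; rewrite !ger0_norm//; case/andP: (kr' x).
Qed.
Let Lkn n : L2 m (kn n). Proof. exact: bmeas_L2. Qed.
Let Lrn n : L2 m (rn n). Proof. exact: bmeas_L2. Qed.
Let kn0 n x : 0 <= kn n x. Proof. by case/andP: (kr n x). Qed.

Definition good (v : X -> R) := L2 m v /\
  (fun n => \int[m]_x (kn (s n) x * v x)) @ \oo --> \int[m]_x (k x * v x).

(** Errors are measured with the weight [r]: it dominates [k], and the integrals of [kn] are
    dominated by those of [rn], which converge to those of [r]. The error is therefore small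
    uniformly in all large indices. *)
Lemma good_approx v : L2 m v ->
  (forall e, 0 < e -> exists2 w, good w & \int[m]_x (r x * `|v x - w x|) <= e) -> good v.
Proof.
move=> Lv H; split => //; apply/cvgrPdist_le => e e0.
have e40 : 0 < e / 4 by rewrite divr_gt0.
have [w [Lw cw] rw] := H _ e40; have Ln := L2_norm (L2B Lv Lw).
have [N _ HN] := near_rn Ln e40.
move/cvgrPdist_le : cw => /(_ _ e40) cw.
near=> n.
have h1 : `|\int[m]_x (k x * w x) - \int[m]_x (kn (s n) x * w x)| <= e / 4 by near: n; exact: cw.
have h2 : \int[m]_x (rn (s n) x * `|v x - w x|) <= e / 4 + e / 4.
  apply: le_trans (lerD rw (lexx _)); apply: HN => /=.
  by rewrite (leq_trans _ (sN n))//; near: n; exists N.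
have h3 := L2_int_dist Lk Lv Lw k0.
have h4 := L2_int_dist (Lkn (s n)) Lv Lw (kn0 (s n)).
have h5 : \int[m]_x (k x * `|v x - w x|) <= e / 4.
  by apply: le_trans rw; apply: L2_int_le => // x; case/andP: (kr' x).
have h6 : \int[m]_x (kn (s n) x * `|v x - w x|) <= e / 4 + e / 4.
  by apply: le_trans h2; apply: L2_int_le => // x; case/andP: (kr (s n) x).
have {}h3 := le_trans h3 h5; have {}h4 := le_trans h4 h6.
move: h1 h3 h4; rewrite !ler_norml.
move: (\int[m]_x _) (\int[m]_x _) (\int[m]_x _) (\int[m]_x _) => a b c d'.
by move=> /andP[? ?] /andP[? ?] /andP[? ?]; apply/andP; split; lra.
Unshelve. all: by end_near. Qed.

Lemma goodD v w : good v -> good w -> good (fun x => v x + w x).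
Proof.
move=> [Lv cv] [Lw cw]; split; first exact: L2D.
rewrite L2_intD//; under eq_fun do rewrite (L2_intD (Lkn _) Lv Lw).
exact: cvgD.
Qed.

Lemma goodZ (c : R) v : good v -> good (fun x => c * v x).
Proof.
move=> [Lv cv]; split; first exact: L2Z.
rewrite L2_intZ//; under eq_fun do rewrite (L2_intZ _ (Lkn _) Lv).
by apply: cvgMr.
Qed.

Variable E : nat -> set BX.
Hypothesis mE : forall j, measurable (E j).
Hypothesis dE : forall (nu : {finite_measure set BX -> \bar R}) (A : set BX), measurable A ->
  forall e, 0 < e -> exists j, (nu (A `+` E j) < e%:E)%E.
Hypothesis cE : forall j, (fun n => I (s n) (E j)) @ \oo --> \int[m]_x (k x * \1_(E j) x).

(** Density of the algebra is used for the measure with density [r], whose value on a symmetric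
    difference is exactly the weighted distance of the indicators. *)
Lemma good_indic (A : set BX) : measurable A -> good \1_A.
Proof.
move=> mA; apply: good_approx; first exact: bmeas_L2 (indic_bmeas mA).
move=> e e0; have [lam lamE] := density_measure.
have [j Hj] := dE lam mA e0.
exists \1_(E j); first by split; [exact: bmeas_L2 (indic_bmeas (mE j))|exact: cE].
have mY : measurable (A `+` E j) by exact: measurableY.
have YE x : `|\1_A x - \1_(E j) x| = \1_(A `+` E j) x :> R.
  rewrite !indicE /setY in_setU !in_setD.
  by case: (x \in A); case: (x \in E j); rewrite /= ?subrr ?subr0 ?sub0r ?normrN ?normr0 ?normr1.
under eq_Rintegral do rewrite YE.
rewrite -lee_fin -(L2_int_EFin Lr (bmeas_L2 m (indic_bmeas mY))) integral_indicM// -lamE.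
exact: ltW.
Qed.

Lemma good_bounded v M : measurable_fun setT (v : BX -> R) -> (forall x, 0 <= v x <= M) -> good v.
Proof.
move=> mv vM.
have M0 : 0 <= M by have /andP[/le_trans h /h] := vM point.
have bounded_L2 w (N : R) : measurable_fun setT (w : BX -> R) -> (forall x, `|w x| <= N) -> L2 m w.
  by move=> mw wN; apply: bmeas_L2; split => //; exists N.
suff H n : forall v M, measurable_fun setT (v : BX -> R) -> (forall x, 0 <= v x <= M) ->
    exists2 w, good w & forall x, `|v x - w x| <= M / 2 ^+ n.
  apply: good_approx.
    by apply: (bounded_L2 _ M) => // x; have /andP[v0 ?] := vM x; rewrite ger0_norm.
  move=> e e0; pose J := \int[m]_x (r x * 1).
  have J0 : 0 <= J by apply: bint_ge0 => x; rewrite mulr1.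
  pose N := (Num.truncn (M * J / e)).+1.
  have MN : M / 2 ^+ N * J <= e.
    rewrite mulrAC ler_pdivrMr ?exprn_gt0//.
    have Me : M * J / e < N%:R by rewrite truncnS_gt.
    have n2 : (N%:R <= 2 ^+ N :> R) by rewrite -natrX ler_nat ltnW// ltn_expl.
    by move: (lt_le_trans Me n2); rewrite ltr_pdivrMr// (mulrC (2 ^+ N)) => /ltW.
  have [w gw vw] := H N v M mv vM; exists w => //; apply: le_trans MN.
  have L1 := bmeas_L2 m (@bmeas_cst _ BX R 1); have [Lw _] := gw.
  have Lv : L2 m v.
    by apply: (bounded_L2 _ M) => // x; have /andP[v0 ?] := vM x; rewrite ger0_norm.
  rewrite -(L2_intZ _ Lr L1); apply: le_Rintegral => //.
  - exact: L2M_integrable (L2_norm (L2B Lv Lw)).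
  - exact: L2M_integrable (L2Z _ L1).
  - by move=> x _; rewrite ler_wpM2l// mulr1.
clear bounded_L2 M0 mv vM v M; elim: n => [|n IH] v M mv vM.
  exists (fun=> 0) => [|x]; last first.
    by have /andP[v0 ?] := vM x; rewrite subr0 ger0_norm// expr0 divr1.
  have := goodZ 0 (good_indic measurable0).
  by rewrite (_ : (fun x => _) = fun=> 0)//; apply/funext => x; rewrite mul0r.
pose B := [set x : BX | - v x <= - (M / 2)].
have mB : measurable B by apply: measurable_set_le; exact: measurableT_comp.
have mi : measurable_fun setT (\1_B : BX -> R) by exact: measurable_indic.
pose v' x := v x - M / 2 * \1_B x.
have mv' : measurable_fun setT (v' : BX -> R).
  by apply: measurable_funB => //; exact: measurable_funM.
have v'M x : 0 <= v' x <= M / 2.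
  have /andP[g0 g1] := vM x; rewrite /v' indicE; case: (boolP (x \in B)) => [/set_mem|].
    by rewrite /B/= lerN2 => ?; apply/andP; split; rewrite /=; lra.
  by rewrite notin_setE /B/= lerN2 => /negP; rewrite -ltNge => ?; apply/andP; split; rewrite /=; lra.
have [w gw vw] := IH _ _ mv' v'M.
exists (fun x => w x + M / 2 * \1_B x); first by apply: goodD => //; apply: goodZ; exact: good_indic.
move=> x; have := vw x; rewrite /v' exprS invfM mulrA.
by rewrite (_ : v x - M / 2 * \1_B x - w x = v x - (w x + M / 2 * \1_B x))//; ring.
Qed.

Lemma good_ge0 v : L2 m v -> (forall x, 0 <= v x) -> good v.
Proof.
move=> Lv v0; have [mv _] := Lv; apply: good_approx => // e e0.
pose w (j : nat) (x : X) := Num.min (v x) j%:R.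
have mw j : measurable_fun setT (w j : BX -> R) by exact: measurable_minr.
have gw j : good (w j).
  by apply: (good_bounded (M := j%:R)) => // x; rewrite le_min v0 ler0n/= ge_min lexx orbT.
have w0 j x : 0 <= w j x by rewrite le_min v0 ler0n.
have wv j x : w j x <= v x by rewrite ge_min lexx.
have Lvw j : L2 m (fun x => `|v x - w j x|) by apply: L2_norm; apply: L2B => //; case: (gw j).
have cv : (fun j => \int[m]_x (r x * `|v x - w j x|)%:E)%E @ \oo --> 0%E.
  have [|||||] := @dominated_convergence _ BX R m setT measurableT
    (fun j x => (r x * `|v x - w j x|)%:E) (cst 0%E) (fun x => (r x * v x)%:E).
  - move=> j; apply/measurable_EFinP; apply: measurable_funM => //.
    by case: (Lvw j).
  - exact: measurable_cst.
  - apply: nearW => x _; apply: cvg_near_cst; exists (Num.truncn (v x)).+1 => // j /= vj.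
    rewrite /w min_l ?subrr ?normr0 ?mulr0//.
    by apply/ltW/(lt_le_trans (truncnS_gt _)); rewrite ler_nat.
  - exact: L2M_integrable.
  - apply: nearW => x j _ /=; rewrite lee_fin ger0_norm ?mulr_ge0// ler_wpM2l//.
    by rewrite ger0_norm ?subr_ge0// lerBlDr lerDl.
  by move=> _ _; rewrite integral0.
have [j Hj] := ereal_cvg0_lt cv e0; exists (w j) => //.
by rewrite -lee_fin -L2_int_EFin//; exact: ltW.
Qed.

Lemma good_L2 v : L2 m v -> good v.
Proof.
move=> Lv; have gp : good (fun x => Num.max (v x) 0).
  by apply: good_ge0; [exact: L2_max0|move=> x; rewrite le_max lexx orbT].
have gn : good (fun x => Num.max (-1 * v x) 0).
  by apply: good_ge0; [exact: L2_max0 (L2Z _ Lv)|move=> x; rewrite le_max lexx orbT].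
have := goodD gp (goodZ (-1) gn); rewrite (_ : (fun x => _) = v)//.
by apply/funext => x; rewrite !mulN1r; case: (leP (v x) 0); case: (leP (- v x) 0) => *; lra.
Qed.

End limit.

Lemma weak_extraction_ge0 : exists (s : nat -> nat) (k : X -> R),
  [/\ forall n, (n <= s n)%N, L2 m k, forall x, 0 <= k x <= r x &
    weakL2_cvg m (fun n => kn (s n)) k].
Proof.
have [s [k [sN mk kr' [E [mE dE cE]]]]] := exists_limit_density.
have Lk : L2 m k.
  apply: (L2_le mk Lr) => x; have /andP[k0 kx] := kr' x.
  by rewrite !ger0_norm.
exists s, k; split => // v Lv.
have [_ cv] := good_L2 sN mk kr' mE dE cE Lv.
rewrite (L2_int_EFin Lk Lv).
under eq_fun do rewrite (L2_int_EFin (bmeas_L2 m (bkn _)) Lv).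
by apply: cvg_EFin; [exact: nearW|exact: cv].
Qed.

End nonnegative.

(** A weak limit of nonnegative functions is nonnegative almost everywhere, so [r] may be replaced
    by its positive part; then the case of a nonnegative [r] applies. *)
Lemma weak_extraction (kn rn : nat -> X -> R) (r : X -> R) :
  (forall n, bmeas (kn n : BX -> R)) -> (forall n, bmeas (rn n : BX -> R)) ->
  (forall n x, 0 <= kn n x <= rn n x) -> L2 m r -> weakL2_cvg m rn r ->
  exists (s : nat -> nat) (k : X -> R),
  [/\ forall n, (n <= s n)%N, L2 m k, {ae m, forall x : BX, k x <= r x} &
    weakL2_cvg m (fun n => kn (s n)) k].
Proof.
move=> bkn brn kr Lr rnr; pose r' x := Num.max (r x) 0.
have r0 : {ae m, forall x : BX, 0 <= r x}.
  apply: L2_ge0_ae => // v bv v0.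
  have cv := weakL2_cvgP rnr Lr (bmeas_L2 m bv).
  apply: (cvgr_to_ge cv); apply: nearW => n; apply: bint_ge0 => x.
  by rewrite mulr_ge0//; have /andP[/le_trans h /h] := kr n x.
have FF := ae_filter_ringOfSetsType m.
have Lr' : L2 m r' by exact: L2_max0.
have rnr' : weakL2_cvg m rn r'.
  move=> v Lv; have := rnr v Lv.
  rewrite (_ : (\int[m]_x (r x * v x)%:E)%E = (\int[m]_x (r' x * v x)%:E)%E)//.
  have [mv _] := Lv; have [mr _] := Lr; have [mr' _] := Lr'.
  apply: ae_eq_integral => //.
  - by apply/measurable_EFinP; exact: measurable_funM.
  - by apply/measurable_EFinP; exact: measurable_funM.
  - by apply: filterS r0 => x rx _; rewrite /r' max_l.
have r'0 x : 0 <= r' x by rewrite le_max lexx orbT.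
have [s [k [sN Lk kr' wk]]] := weak_extraction_ge0 bkn brn kr Lr' r'0 rnr'.
exists s, k; split => //; apply: filterS r0 => x rx.
by have /andP[_] := kr' x; rewrite /r' max_l.
Qed.

End weak_extraction.

(** * Relaxed slopes *)

Section slope_comparison.
Context {R : realType} {X : pmetricType R}.
Local Notation d := (@mdist R X).
Local Notation BX := (@BX R X).
Hypothesis cX : compact [set: X].

Lemma mcshane_extension (phi : X -> R) (F : set X) (a : R) : 0 <= a ->
  Defs.lipschitz phi -> F !=set0 ->
  (forall x y, F x -> F y -> `|phi x - phi y| <= a * d x y) ->
  exists psi : X -> R, (forall x y, `|psi x - psi y| <= a * d x y) /\
    forall x, F x -> psi x = phi x.
Proof.
move=> a0 lphi [z Fz] phiF; have [M phiM] := lipschitz_bounded cX lphi.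
pose V x := [set phi y - a * d x y | y in F].
have V0 x : V x !=set0 by exists (phi z - a * d x z), z.
have Vb x : has_ubound (V x).
  exists M => _ [y _ <-]; have := le_trans (ler_norm _) (phiM y).
  by have := mulr_ge0 a0 (mdist_ge0 x y); lra.
have H x y : sup (V x) - sup (V y) <= a * d x y.
  rewrite lerBlDr; apply: ge_sup => // _ [u Fu <-].
  have h : phi u - a * d y u <= sup (V y) by apply: ub_le_sup => //; exists u.
  have := ler_wpM2l a0 (metric_triangle y x u); rewrite mulrDr (metric_sym y x); lra.
exists (fun x => sup (V x)); split => [x y|x Fx].
  by rewrite ler_norml H andbT lerNl opprB metric_sym H.
apply/eqP; rewrite eq_le; apply/andP; split.
  apply: ge_sup => // _ [y Fy <-]; have := phiF y x Fy Fx.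
  by rewrite metric_sym => /(le_trans (ler_norm _)); lra.
by apply: ub_le_sup => //; exists x => //; rewrite mdistxx mulr0 subr0.
Qed.

(* Replacing [phi] by the extension [psi] of its restriction to [F] where
   [|phi - psi| <= e] makes the slope at most [a] at every point of [F]. *)
Lemma exists_small_slope_approx (phi : X -> R) (F : set X) (a L e : R) : 0 <= a -> 0 < L ->
  (forall x y, `|phi x - phi y| <= L * d x y) ->
  (forall x y, F x -> F y -> `|phi x - phi y| <= a * d x y) -> 0 < e ->
  exists theta : X -> R, [/\ forall x y, `|theta x - theta y| <= (2 * L + a) * d x y,
    forall x, `|theta x - phi x| <= e & forall x, F x -> (lip_const theta x <= a%:E)%E].
Proof.
move=> a0 L0 phiL phiF e0.
have [->|/set0P F0] := eqVneq F set0.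
  exists phi; split => // [x y|x].
    by apply: (le_trans (phiL x y)); rewrite ler_wpM2r ?mdist_ge0//; lra.
  by rewrite subrr normr0 ltW.
have lphi : Defs.lipschitz phi by exists L.
have [psi [psia psiF]] := mcshane_extension a0 lphi F0 phiF.
pose w x := phi x - psi x.
have wL x y : `|w x - w y| <= (L + a) * d x y.
  rewrite /w (_ : _ - _ = (phi x - phi y) - (psi x - psi y)); last by ring.
  by rewrite (le_trans (ler_normB _ _))// mulrDl lerD.
(* Clamping the difference [phi - psi] to [[-e, e]] before subtracting it from [phi] keeps the
   result within [e] of [phi] and makes it equal to [psi] wherever the difference is smaller than
   [e], in particular near [F]. *)
pose c (v : R) := Num.max (- e) (Num.min v e).
have c1 u v : `|c u - c v| <= `|u - v|.
  suff H a1 b1 : c a1 <= c b1 + `|a1 - b1|.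
    by rewrite ler_norml lerBlDl H andbT lerNl opprB lerBlDl distrC H.
  have ab : a1 <= b1 + `|a1 - b1| by rewrite -lerBlDl ler_norm.
  have mM : Num.min a1 e <= Num.min b1 e + `|a1 - b1|.
    case: (leP b1 e) => _; first by apply: le_trans ab; rewrite ge_min lexx.
    by rewrite (@le_trans _ _ e) ?ge_min ?lexx ?orbT// lerDl.
  rewrite {1}/c ge_max; apply/andP; split.
    by rewrite -[leLHS]addr0 lerD// /c le_max lexx.
  by apply: (le_trans mM); rewrite lerD2r /c le_max lexx orbT.
have ce v : `|c v| <= e.
  rewrite /c ler_norml le_max lexx/= ge_max ge_min lexx orbT andbT.
  by rewrite (le_trans _ (ltW e0))// oppr_le0 ltW.
have cid v : `|v| < e -> c v = v.
  by rewrite ltr_norml /c => /andP[h1 h2]; rewrite min_l ?max_r//; exact: ltW.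
pose th x := phi x - c (w x).
have La : 0 < L + a by rewrite ltr_pwDl.
exists th; split.
- move=> x y; rewrite (_ : th x - th y = (phi x - phi y) - (c (w x) - c (w y))); last by rewrite /th; ring.
  rewrite (le_trans (ler_normB _ _))//; have := phiL x y; have := le_trans (c1 (w x) (w y)) (wL x y).
  lra.
- by move=> x; rewrite /th addrAC subrr sub0r normrN.
- move=> x Fx; have wx : w x = 0 by rewrite /w psiF// subrr.
  apply: (@lip_const_le_of _ _ _ _ _ (e / (L + a))) => //; first by rewrite divr_gt0.
  move=> y yx; have thE u : d u x < e / (L + a) -> th u = psi u.
    move=> ux; have wu : `|w u| < e.
      by have := wL u x; rewrite wx subr0 => /le_lt_trans; apply; rewrite mulrC -ltr_pdivlMr.
    by rewrite /th (cid _ wu) /w; ring.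
  rewrite (thE y yx) (thE x); last by rewrite mdistxx divr_gt0.
  by have := psia y x.
Qed.

(** A Leibniz rule: the increment of [eta] multiplies the difference of the two functions. In the
    application both approximate [phi], so this last term vanishes in the limit. *)
Lemma lip_const_comb (eta psi th : X -> R) (x : X) (Le : R) : 0 <= Le ->
  (forall x, 0 <= eta x <= 1) -> (forall x y, `|eta x - eta y| <= Le * d x y) ->
  Defs.lipschitz psi -> Defs.lipschitz th ->
  fine (lip_const (fun y => (1 - eta y) * psi y + eta y * th y) x) <=
  (1 - eta x) * fine (lip_const psi x) + eta x * fine (lip_const th x) + Le * `|psi x - th x|.
Proof.
move=> Le0 eta01 etaL lpsi lth.
have leta : Defs.lipschitz eta by exists Le.
have l1eta : Defs.lipschitz (fun y => 1 - eta y) by apply: lipschitzB => //; exact: lipschitz_cst.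
have lchi : Defs.lipschitz (fun y => (1 - eta y) * psi y + eta y * th y).
  by apply: lipschitzD; exact: (lipschitzM cX).
have [L1 L10 h1] := lipschitz_gt0 lpsi; have [L2 L20 h2] := lipschitz_gt0 lth.
have [L3 L30 h3] := lipschitz_gt0 lchi; have /andP[e0 e1] := eta01 x.
set A := fine (lip_const psi x); set B := fine (lip_const th x).
have A0 : 0 <= A by rewrite fine_ge0// lip_const_ge0.
have B0 : 0 <= B by rewrite fine_ge0// lip_const_ge0.
rewrite -lee_fin (lip_constK (ltW L30) h3); apply/lee_addgt0Pr => e e_0; rewrite -EFinD.
pose e' := e / (2 * (1 + Le)).
have e'0 : 0 < e' by rewrite divr_gt0// mulr_gt0// ltr_pwDl.
have e'E : e' + Le * e' <= e.
  rewrite -[X in X + _]mul1r -mulrDl /e' (_ : _ * _ = e / 2); last by field; lra.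
  lra.
have [r1 r10 H1] := lip_const_eps (ltW L10) h1 x e'0.
have [r2 r20 H2] := lip_const_eps (ltW L20) h2 x e'0.
have LL : 0 < L1 + L2 by rewrite addr_gt0.
apply: (@lip_const_le_of _ _ _ _ _ (Num.min (Num.min r1 r2) (e' / (L1 + L2)))).
- by rewrite !addr_ge0// ?mulr_ge0 ?subr_ge0// ltW.
- by rewrite !lt_min r10 r20 divr_gt0.
move=> y; rewrite !lt_min => /andP[/andP[y1 y2] y3].
have {H1}H1 := H1 y y1; have {H2}H2 := H2 y y2.
rewrite (_ : _ - _ = (1 - eta x) * (psi y - psi x) + eta x * (th y - th x)
    + (eta y - eta x) * (th y - psi y)); last by ring.
have k1 : `|(1 - eta x) * (psi y - psi x)| <= (1 - eta x) * ((A + e') * d y x).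
  by rewrite normrM (ger0_norm (_ : 0 <= 1 - eta x)) ?subr_ge0// ler_wpM2l// subr_ge0.
have k2 : `|eta x * (th y - th x)| <= eta x * ((B + e') * d y x).
  by rewrite normrM (ger0_norm e0) ler_wpM2l.
have k3 : `|th y - psi y| <= `|psi x - th x| + e'.
  rewrite (_ : th y - psi y = - (psi x - th x) + ((th y - th x) - (psi y - psi x))); last by ring.
  rewrite (le_trans (ler_normD _ _))// normrN lerD2l (le_trans (ler_normB _ _))//.
  apply: (le_trans (lerD (h2 y x) (h1 y x))).
  by rewrite -mulrDl mulrC (addrC L2) -ler_pdivlMr//; exact: ltW.
have k4 : `|(eta y - eta x) * (th y - psi y)| <= Le * d y x * (`|psi x - th x| + e').
  by rewrite normrM ler_pM.
apply: (le_trans (ler_normD _ _)); apply: (le_trans (lerD (ler_normD _ _) (lexx _))).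
apply: (le_trans (lerD (lerD k1 k2) k4)).
rewrite (_ : (1 - eta x) * ((A + e') * d y x) + eta x * ((B + e') * d y x) +
  Le * d y x * (`|psi x - th x| + e') = ((1 - eta x) * A + eta x * B + Le * `|psi x - th x| + (e' + Le * e')) * d y x);
  last by ring.
by rewrite ler_wpM2r ?mdist_ge0// lerD2l.
Qed.

Lemma L2_int_amgm (m : probability BX R) (f g : X -> R) (c : R) : 0 < c -> L2 m f -> L2 m g ->
  \int[m]_x (f x * g x) <= (2 * c)^-1 * \int[m]_x (f x * f x) + c / 2 * \int[m]_x (g x * g x).
Proof.
move=> c0 Lf Lg; have i1 := L2M_integrable (L2Z (2 * c)^-1 Lf) Lf.
have i2 := L2M_integrable (L2Z (c / 2) Lg) Lg.
rewrite -RintegralZl//; last exact: L2M_integrable.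
rewrite -RintegralZl//; last exact: L2M_integrable.
have [e1 e2] : (forall x, (2 * c)^-1 * (f x * f x) = ((2 * c)^-1 * f x) * f x) /\
   (forall x, c / 2 * (g x * g x) = (c / 2 * g x) * g x) by split=> x; rewrite mulrA.
under [X in _ <= X + _]eq_Rintegral do rewrite e1.
under [X in _ <= _ + X]eq_Rintegral do rewrite e2.
rewrite -RintegralD//; apply: le_Rintegral => //.
- exact: L2M_integrable.
- exact: (integrableD measurableT i1 i2).
move=> x _; rewrite -e1 -e2 -(ler_pM2l (mulr_gt0 (ltr0Sn R 1) c0)).
have := sqr_ge0 (f x - c * g x); rewrite sqrrB.
rewrite (_ : 2 * c * ((2 * c)^-1 * (f x * f x) + c / 2 * (g x * g x)) =
  f x ^+ 2 + (c * g x) ^+ 2); last by field; rewrite gt_eqF.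
rewrite (_ : 2 * c * (f x * g x) = f x * (c * g x) *+ 2); last by rewrite mulr2n; ring.
lra.
Qed.

(** Young's inequality with weight [c = e / (V + 1)] makes the part of the fixed function [v] at
    most [e / 2]; then the squared norm of [u n] is required to be at most [e c]. *)
Lemma L2_cvg0_weak (m : probability BX R) (u : nat -> X -> R) (v : X -> R) :
  (forall n, L2 m (u n)) -> L2 m v ->
  (fun n => \int[m]_x ((u n x) ^+ 2)%:E)%E @ \oo --> 0%E ->
  (fun n => \int[m]_x (u n x * v x)) @ \oo --> (0 : R).
Proof.
move=> Lu Lv u0; apply/cvgrPdist_le => e e0.
pose V := \int[m]_x (v x * v x).
have V0 : 0 <= V by apply: bint_ge0 => x; rewrite -expr2 sqr_ge0.
have V1 : 0 < V + 1 by rewrite ltr_wpDl.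
pose c := e / (V + 1); have c0 : 0 < c by rewrite divr_gt0.
have := u0; move=> /fine_cvgP[_ /cvgrPdist_le/(_ (e * c) (mulr_gt0 e0 c0)) K].
near=> n.
have H : \int[m]_x (u n x * u n x) <= e * c.
  have Hn : `|0 - fine (\int[m]_x ((u n x) ^+ 2)%:E)| <= e * c by near: n; exact: K.
  by move: Hn; rewrite sub0r normrN; apply: le_trans; exact: ler_norm.
have cV : c * V <= e by rewrite /c mulrAC ler_pdivrMr// ler_pM2l// lerDl.
have bnd A : A <= e * c -> (2 * c)^-1 * A + c / 2 * V <= e.
  move=> Ac; have : (2 * c)^-1 * A <= e / 2.
    have E : 2 * c * (e / 2) = e * c by field.
    by rewrite ler_pdivrMl ?E// mulr_gt0.
  by move: cV; rewrite (mulrAC c); lra.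
rewrite sub0r normrN ler_norml; apply/andP; split; last first.
  exact: le_trans (L2_int_amgm c0 (Lu n) Lv) (bnd _ H).
rewrite lerNl; have Ln := L2Z (-1) (Lu n).
have -> : - (\int[m]_x (u n x * v x)) = (\int[m]_x ((-1 * u n x) * v x)).
  under [RHS]eq_Rintegral do rewrite -mulrA.
  by rewrite RintegralZl// ?mulN1r//; exact: L2M_integrable.
apply: le_trans (L2_int_amgm c0 Ln Lv) (bnd _ _).
by under eq_Rintegral do rewrite !mulN1r mulrNN.
Unshelve. all: by end_near. Qed.

Lemma sqrrB_le (p q w : R) : q ^+ 2 <= w -> (p - q) ^+ 2 <= 2 * p ^+ 2 + 2 * w.
Proof. by move=> qw; have := sqr_ge0 (p + q); rewrite sqrrD sqrrB; lra. Qed.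

Lemma L2_cvg0_le (m : probability BX R) (f g : nat -> X -> R) :
  (forall n, measurable_fun setT (f n : BX -> R)) ->
  (forall n x, (g n x) ^+ 2 <= 2 * (f n x) ^+ 2 + 2 * n.+1%:R^-1) ->
  (fun n => \int[m]_x ((f n x) ^+ 2)%:E)%E @ \oo --> 0%E ->
  (fun n => \int[m]_x ((g n x) ^+ 2)%:E)%E @ \oo --> 0%E.
Proof.
move=> mf gf f0.
have cv : (fun n => 2%:E * \int[m]_x ((f n x) ^+ 2)%:E + (2 * n.+1%:R^-1)%:E)%E @ \oo --> 0%E.
  rewrite -[X in _ --> X]adde0; apply: cvgeD => //.
    by rewrite -[X in _ --> X](mule0 2%:E); apply: cvgeZl.
  apply: cvg_EFin; first exact: nearW.
  have h : (fun n => 2 * n.+1%:R^-1) @ \oo --> (2 * 0 : R) by apply: cvgMr; exact: cvg_harmonic.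
  by rewrite mulr0 in h; exact: h.
apply: (squeeze_cvge _ (cvg_cst _) cv); apply: nearW => n; apply/andP; split.
  by apply: integral_ge0 => x _; rewrite lee_fin sqr_ge0.
have mf2 := measurable_sqr (mf n).
rewrite -ge0_integralZl//; last by move=> x _; rewrite lee_fin sqr_ge0.
have c0 : 0 <= 2 * n.+1%:R^-1 :> R by rewrite mulr_ge0.
apply: (@le_trans _ _ (\int[m]_x (2%:E * ((f n x) ^+ 2)%:E + (2 * n.+1%:R^-1)%:E))%E).
  by apply: ge0_le_lower_integral => x _; rewrite -?EFinM -?EFinD lee_fin ?sqr_ge0.
rewrite ge0_integralD//.
- by rewrite leeD2l// integral_cst//= probability_setT mule1.
- by move=> x _; rewrite -EFinM lee_fin mulr_ge0 ?sqr_ge0.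
- exact: measurable_funeM.
Qed.

Lemma ge_id_cvg_infty (s : nat -> nat) : (forall n, (n <= s n)%N) -> s @ \oo --> \oo.
Proof.
move=> sn A [N _ NA]; exists N => // n /= Nn; apply: NA => /=.
exact: leq_trans (sn n).
Qed.

Section comparison.
Variables (m : probability BX R) (phi : X -> R) (L : R).
Hypothesis L0 : 0 < L.
Hypothesis phiL : forall x y, `|phi x - phi y| <= L * d x y.
Variables (F : set X) (a : R).
Hypothesis a0 : 0 <= a.
Hypothesis mF : measurable (F : set BX).
Hypothesis phiF : forall x y, F x -> F y -> `|phi x - phi y| <= a * d x y.

Let lphi : Defs.lipschitz phi. Proof. by exists L. Qed.
Let C := 2 * L + a.
(** The bound on the slope of the approximations of [phi] adapted to [F]: it is [a] on [F] and their
    global Lipschitz constant elsewhere. *)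
Let slopeF (x : X) : R := C - 2 * L * \1_F x.

Lemma slopeF_in x : F x -> slopeF x = a.
Proof. by move=> Fx; rewrite /slopeF /C indicE mem_set//= mulr1; ring. Qed.

Lemma slopeF_bound x : 0 <= slopeF x <= C.
Proof.
have L20 : 0 <= 2 * L by rewrite mulr_ge0// ltW.
have [Fx|nFx] := pselect (F x); first by rewrite slopeF_in// a0 /C lerDr.
by rewrite /slopeF indicE memNset//= mulr0 subr0 lexx andbT addr_ge0.
Qed.

Lemma slopeF_bmeas : bmeas (slopeF : BX -> R).
Proof.
by apply: bmeasB; [exact: bmeas_cst|apply: bmeasZ; exact: indic_bmeas].
Qed.

(** A relaxing sequence is glued by [eta] to the approximations [th n], which converge uniformly to
    [phi]. The Leibniz rule dominates the slopes [kn] by [rn], which converges weakly to the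
    combination of [Gt] and [slopeF]; extraction gives a weak limit of the slopes below it. *)
Lemma relaxed_slope_comb (G eta : X -> R) : relaxed_slope m phi G ->
  Defs.lipschitz eta -> (forall x, 0 <= eta x <= 1) ->
  relaxed_slope m phi (fun x => (1 - eta x) * G x + eta x * slopeF x).
Proof.
move=> [LG [Gt [psi [LGt GtG lpsi psi0 psiG]]]] leta eta01.
have [Le Le0 etaL] := lipschitz_gt0 leta.
have l1eta : Defs.lipschitz (fun y => 1 - eta y) by apply: lipschitzB => //; exact: lipschitz_cst.
have bS := slopeF_bmeas; have be := lipschitz_bmeas cX leta; have b1e := lipschitz_bmeas cX l1eta.
have Hth n : exists theta : X -> R, [/\ forall x y, `|theta x - theta y| <= C * d x y,
    forall x, `|theta x - phi x| <= n.+1%:R^-1 & forall x, F x -> (lip_const theta x <= a%:E)%E].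
  by apply: exists_small_slope_approx; rewrite ?invr_gt0.
have [th /all_and3[thC thphi thF]] := choice Hth.
have C0 : 0 < C by rewrite ltr_pwDl// mulr_gt0.
have lth n : Defs.lipschitz (th n) by exists C.
have thS n x : fine (lip_const (th n) x) <= slopeF x.
  rewrite -lee_fin (lip_constK (ltW C0) (thC n)).
  have [Fx|nFx] := pselect (F x); first by rewrite slopeF_in// thF.
  rewrite /slopeF indicE memNset//= mulr0 subr0; exact: lip_const_le (ltW C0) (thC n) _.
pose chi n x := (1 - eta x) * psi n x + eta x * th n x.
have lchi n : Defs.lipschitz (chi n) by apply: lipschitzD; exact: (lipschitzM cX).
pose kn n x := fine (lip_const (chi n) x).
pose Dpsi n x := fine (lip_const (psi n) x).
have bkn n : bmeas (kn n : BX -> R) by exact: lip_const_bmeas.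
have bD n : bmeas (Dpsi n : BX -> R) by exact: lip_const_bmeas.
pose u n x := `|psi n x - th n x|.
have bu n : bmeas (u n : BX -> R).
  by apply: bmeas_norm; apply: bmeasB; exact: lipschitz_bmeas.
pose rn n x := (Dpsi n x * (1 - eta x) + slopeF x * eta x) + Le * u n x.
have brn n : bmeas (rn n : BX -> R).
  by apply: bmeasD; [apply: bmeasD; exact: bmeasM|exact: bmeasZ].
have kr n x : 0 <= kn n x <= rn n x.
  rewrite fine_ge0 ?lip_const_ge0//=.
  apply: (le_trans (lip_const_comb x (ltW Le0) eta01 etaL (lpsi n) (lth n))).
  rewrite /rn lerD2r mulrC lerD2l mulrC ler_wpM2r//; by case/andP: (eta01 x).
have th2 n x : (th n x - phi x) ^+ 2 <= n.+1%:R^-1.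
  rewrite -(real_normK (num_real _)) expr2 -[leRHS]mulr1 ler_pM//.
  by rewrite (le_trans (thphi n x))// invf_le1// ler1n.
have u2 : (fun n => \int[m]_x ((u n x) ^+ 2)%:E)%E @ \oo --> 0%E.
  apply: (L2_cvg0_le _ _ psi0) => [n|n x]; first by apply: measurable_funB; exact: measurable_fun_lipschitz.
  rewrite /u real_normK ?num_real//.
  rewrite (_ : psi n x - th n x = (psi n x - phi x) - (th n x - phi x)); last by ring.
  exact: sqrrB_le.
pose r x := Gt x * (1 - eta x) + slopeF x * eta x.
have Lr : L2 m r by apply: L2D; [exact: L2_bmeasM|exact: bmeas_L2 (bmeasM bS be)].
have rnr : weakL2_cvg m rn r.
  move=> v Lv; have [mv _] := Lv.
  have Lv1 : L2 m (fun x => v x * (1 - eta x)) by exact: L2_bmeasM.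
  have c1 := weakL2_cvgP psiG LGt Lv1.
  have c2 := L2_cvg0_weak (fun n => bmeas_L2 m (bu n)) Lv u2.
  rewrite (L2_int_EFin Lr Lv); under eq_fun do rewrite (L2_int_EFin (bmeas_L2 m (brn _)) Lv).
  apply: cvg_EFin; first exact: nearW.
  pose K := \int[m]_x (slopeF x * eta x * v x).
  have E1 f : L2 m f -> \int[m]_x ((f x * (1 - eta x) + slopeF x * eta x) * v x) =
      \int[m]_x (f x * (v x * (1 - eta x))) + K.
    move=> Lf; rewrite /K.
    have <- : \int[m]_x (f x * (1 - eta x) * v x) = \int[m]_x (f x * (v x * (1 - eta x))).
      by apply: eq_Rintegral => x _; ring.
    under eq_Rintegral do rewrite mulrDl.
    apply: RintegralD => //; apply: L2M_integrable => //; first exact: L2_bmeasM.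
    exact: bmeas_L2 (bmeasM bS be).
  rewrite (_ : \int[m]_x (r x * v x) = \int[m]_x (Gt x * (v x * (1 - eta x))) + K + Le * 0); last first.
    by rewrite mulr0 addr0 -E1.
  rewrite (_ : _ \o _ = (fun n => \int[m]_x (Dpsi n x * (v x * (1 - eta x))) + K +
      Le * \int[m]_x (u n x * v x))).
    by apply: cvgD; [apply: cvgD => //; exact: cvg_cst|apply: cvgMr].
  apply/funext => n /=; rewrite -E1; last exact: bmeas_L2.
  rewrite -RintegralZl//; last exact: L2M_integrable (bmeas_L2 m (bu n)) Lv.
  under [X in _ + X]eq_Rintegral do rewrite mulrA.
  rewrite -RintegralD//.
  - by apply: eq_Rintegral => x _; rewrite -mulrDl.
  - apply: L2M_integrable => //; apply: L2D; last exact: bmeas_L2 (bmeasM bS be).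
    by apply: L2_bmeasM => //; exact: bmeas_L2.
  - by apply: L2M_integrable => //; exact: L2Z (bmeas_L2 m (bu n)).
have [s [k [sn Lk kle wk]]] := weak_extraction cX bkn brn kr Lr rnr.
split.
  apply: L2D; last exact: bmeas_L2 (bmeasM be bS).
  have := L2_bmeasM LG b1e; rewrite (_ : (fun x => _) = (fun x => (1 - eta x) * G x))//.
  by apply/funext => x; rewrite mulrC.
exists k, (fun n => chi (s n)); split => //.
- have FF := ae_filter_ringOfSetsType m.
  apply: filterS2 kle GtG => x kx Gx; apply: (le_trans kx).
  rewrite /r mulrC (mulrC (slopeF x)) lerD2r ler_wpM2l// subr_ge0.
  by case/andP: (eta01 x).
- have sN := ge_id_cvg_infty sn.
  suff cv : (fun n => \int[m]_x ((chi n x - phi x) ^+ 2)%:E)%E @ \oo --> 0%E.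
    exact: (cvg_comp _ _ sN cv).
  apply: (L2_cvg0_le _ _ psi0) => [n|n x]; first by apply: measurable_funB; exact: measurable_fun_lipschitz.
  have := th2 n x; rewrite /chi.
  rewrite (_ : (1 - eta x) * psi n x + eta x * th n x - phi x =
    (1 - eta x) * (psi n x - phi x) + eta x * (th n x - phi x)); last by ring.
  have /andP[e0 e1] := eta01 x; move: (psi n x - phi x) (th n x - phi x) (n.+1%:R^-1) => p q w qw.
  have h : ((1 - eta x) * p + eta x * q) ^+ 2 <= (1 - eta x) * p ^+ 2 + eta x * q ^+ 2.
    rewrite -subr_ge0 (_ : _ - _ = eta x * (1 - eta x) * (p - q) ^+ 2); last by ring.
    by apply: mulr_ge0; [apply: mulr_ge0; rewrite ?subr_ge0|exact: sqr_ge0].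
  apply: (le_trans h); have p0 := sqr_ge0 p; have q0 := sqr_ge0 q.
  have h1 : (1 - eta x) * p ^+ 2 <= p ^+ 2 by rewrite ler_piMl// lerBlDr lerDl.
  have h2 : eta x * q ^+ 2 <= q ^+ 2 by rewrite ler_piMl.
  lra.
Qed.

(** The glued slope competes with [G]. Convexity of the square bounds its energy by the integral of
    [(1 - eta) G^2 + eta slopeF^2], and the energy of [G] cancels. *)
Lemma min_relaxed_slope_weighted (G eta : X -> R) : min_relaxed_slope m phi G ->
  Defs.lipschitz eta -> (forall x, 0 <= eta x <= 1) ->
  \int[m]_x (G x * (G x * eta x)) <= \int[m]_x (slopeF x * (slopeF x * eta x)).
Proof.
move=> [rG Gmin] leta eta01; have [LG _] := rG.
have := Gmin _ (relaxed_slope_comb rG leta eta01).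
have bS := slopeF_bmeas; have be := lipschitz_bmeas cX leta.
have LS := bmeas_L2 m bS; have LGe := L2_bmeasM LG be; have LSe := L2_bmeasM LS be.
have [Lc _] := relaxed_slope_comb rG leta eta01.
have L1 := L2B LG LGe; have iGG := L2M_integrable LG LG.
have iGe := L2M_integrable LG LGe; have iSe := L2M_integrable LS LSe.
under eq_integral do rewrite expr2.
under [X in (_ <= X)%E]eq_integral do rewrite expr2.
rewrite (L2_int_EFin LG LG) (L2_int_EFin Lc Lc) lee_fin => H.
have : \int[m]_x (((1 - eta x) * G x + eta x * slopeF x) * ((1 - eta x) * G x + eta x * slopeF x))
    <= \int[m]_x (G x * G x - G x * (G x * eta x) + slopeF x * (slopeF x * eta x)).
  apply: le_Rintegral => //; first exact: L2M_integrable.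
    exact: (integrableD measurableT (integrableB measurableT iGG iGe) iSe).
  move=> x _; have /andP[e0 e1] := eta01 x; move: (G x) (slopeF x) => p q.
  rewrite -subr_ge0 (_ : _ - _ = eta x * (1 - eta x) * (p - q) ^+ 2); last by ring.
  by apply: mulr_ge0; [apply: mulr_ge0; rewrite ?subr_ge0|exact: sqr_ge0].
rewrite RintegralD//; last exact: (integrableB measurableT iGG iGe).
rewrite RintegralB//; move: H; do 4 move: (Rintegral _ _ _) => ?; lra.
Qed.

(** The indicator is approximated by cutoffs in L1 with weight [G^2 + C^2], so that the errors on
    both sides of the weighted inequality are controlled at once. *)
Lemma min_relaxed_slope_set (G : X -> R) (A : set BX) : min_relaxed_slope m phi G ->
  measurable A ->
  \int[m]_x (G x * (G x * \1_A x)) <= \int[m]_x (slopeF x * (slopeF x * \1_A x)).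
Proof.
move=> mG mA; have [[LG _] _] := mG; have bS := slopeF_bmeas; have LS := bmeas_L2 m bS.
have bA := indic_bmeas mA.
pose w x := G x * G x + C * C.
have L1 := bmeas_L2 m (@bmeas_cst _ BX R (C * C)).
have iw : m.-integrable setT (EFin \o w : BX -> \bar R).
  have i1 := L2M_integrable LG LG; have i2 := bmeas_integrable m (@bmeas_cst _ BX R (C * C)).
  exact: (integrableD measurableT i1 i2).
have w0 x : 0 <= w x by rewrite addr_ge0// -expr2 sqr_ge0.
have mw : measurable_fun setT (w : BX -> R) by apply/measurable_EFinP; exact: measurable_int iw.
apply/ler_addgt0Pr => e e0; have e20 : 0 < e / 2 by rewrite divr_gt0.
have [h [lh h01 hA]] := lipschitz_approx_indic cX iw w0 mA e20.
have bh := lipschitz_bmeas cX lh.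
have H := min_relaxed_slope_weighted mG lh h01.
have iD : m.-integrable setT (fun x : BX => (`|\1_A x - h x| * w x)%:E).
  apply/integrableP; split.
    apply/measurable_EFinP; apply: measurable_funM => //.
    by case: (bmeas_norm (bmeasB bA bh)).
  apply: le_lt_trans (ltry (e / 2)); apply: le_trans hA.
  by apply: ge0_le_lower_integral => x _; rewrite ?abse_ge0// gee0_abs// lee_fin mulr_ge0.
have {}hA : \int[m]_x (`|\1_A x - h x| * w x) <= e / 2.
  rewrite -lee_fin; apply: le_trans hA; rewrite /Rintegral fineK//.
  exact: (integrable_fin_num measurableT iD).
have H1 : \int[m]_x (G x * (G x * \1_A x)) <= \int[m]_x (G x * (G x * h x) + `|\1_A x - h x| * w x).
  have i1 := L2M_integrable LG (L2_bmeasM LG bA); have i2 := L2M_integrable LG (L2_bmeasM LG bh).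
  apply: le_Rintegral => //; first exact: (integrableD measurableT i2 iD).
  move=> x _; rewrite -lerBlDl -!mulrBr mulrA mulrC /w.
  have G2 : 0 <= G x * G x by rewrite -expr2 sqr_ge0.
  apply: (le_trans (ler_wpM2r G2 (ler_norm _))).
  by rewrite ler_wpM2l// lerDl -expr2 sqr_ge0.
have H2 : \int[m]_x (slopeF x * (slopeF x * h x)) <=
    \int[m]_x (slopeF x * (slopeF x * \1_A x) + `|\1_A x - h x| * w x).
  have i1 := L2M_integrable LS (L2_bmeasM LS bA); have i2 := L2M_integrable LS (L2_bmeasM LS bh).
  apply: le_Rintegral => //; first exact: (integrableD measurableT i1 iD).
  move=> x _; rewrite -lerBlDl -!mulrBr mulrA mulrC /w.
  have /andP[S0 SC] := slopeF_bound x.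
  have S2 : 0 <= slopeF x * slopeF x by rewrite mulr_ge0.
  rewrite (distrC (\1_A x)); apply: (le_trans (ler_wpM2r S2 (ler_norm _))).
  rewrite ler_wpM2l// (le_trans (_ : _ <= C * C)) ?ler_pM// lerDr -expr2 sqr_ge0//.
move: H1 H2; rewrite RintegralD//; last exact: L2M_integrable LG (L2_bmeasM LG bh).
rewrite RintegralD//; last exact: L2M_integrable LS (L2_bmeasM LS bA).
move: H hA; do 5 move: (Rintegral _ _ _) => ?; lra.
Qed.

(** On the part of [F] where [G] exceeds [a], the integral of [G^2] is at most that of [a^2], which
    forces this part to be null. *)
Lemma min_relaxed_slope_le_on (G : X -> R) : min_relaxed_slope m phi G ->
  {ae m, forall x : BX, F x -> G x <= a}.
Proof.
move=> mG; have [[LG _] _] := mG; have [mmG _] := LG.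
pose A : set BX := F `&` [set x | a < G x].
have mA : measurable A.
  apply: measurableI => //; rewrite (_ : [set _ | _] = ~` [set x | G x <= a]).
    by apply: measurableC; exact: measurable_set_le.
  by apply/seteqP; split => x /=; rewrite ltNge => /negP.
have := min_relaxed_slope_set mG mA.
have bA := indic_bmeas mA.
have aE : \int[m]_x (slopeF x * (slopeF x * \1_A x)) = \int[m]_x (a * (a * \1_A x)).
  apply: eq_Rintegral => x _; rewrite indicE; have [/set_mem[Fx _]|_] := boolP (x \in A).
    by rewrite slopeF_in.
  by rewrite !mulr0.
rewrite aE -subr_le0.
have ba := @bmeas_cst _ BX R a; have La := bmeas_L2 m ba.
have i1 := L2M_integrable LG (L2_bmeasM LG bA); have i2 := L2M_integrable La (L2_bmeasM La bA).
rewrite -RintegralB// => H.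
pose g x := G x * (G x * \1_A x) - a * (a * \1_A x).
have g0 x : 0 <= g x.
  rewrite /g indicE; have [/set_mem[Fx /= aG]|_] := boolP (x \in A); last by rewrite !mulr0 subr0.
  by rewrite !mulr1 subr_ge0 ler_pM// ltW.
have ig : m.-integrable setT (EFin \o g : BX -> \bar R) by exact: (integrableB measurableT i1 i2).
have mg : measurable_fun setT (g : BX -> R) by apply/measurable_EFinP; exact: measurable_int ig.
have I0 : (\int[m]_x (g x)%:E = 0)%E.
  apply/eqP; rewrite eq_le; apply/andP; split; last by apply: integral_ge0 => x _; rewrite lee_fin.
  by rewrite -(fineK (integrable_fin_num measurableT ig)) lee_fin.
have FF := ae_filter_ringOfSetsType m.
apply: filterS (ge0_integral_eq0_ae mg g0 I0) => x gx Fx; rewrite leNgt; apply/negP => aG.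
move: gx; rewrite /g indicE mem_set; last by split.
rewrite !mulr1 => /eqP; rewrite subr_eq0 => /eqP E.
by have : a * a < G x * G x by [apply: ltr_pM]; rewrite E ltxx.
Qed.

End comparison.

(** [F k l n j] collects points where the one-sided bound with constant [a k l] holds up to distance
    [1 / (n + 1)], inside a ball of smaller diameter. Any two of its points see each other, so the
    one-sided bound applied in both directions makes [phi] two-sidedly Lipschitz there. *)
Lemma min_relaxed_slope_le_asc_slope (m : probability BX R) (phi G : X -> R) :
  Defs.lipschitz phi -> min_relaxed_slope m phi G ->
  {ae m, forall x : BX, G x <= fine (asc_slope phi x)}.
Proof.
move=> /lipschitz_gt0[L L0 phiL] mG; have [p Hp] := dense_sequence cX.
pose a k l : R := k.+1%:R / l.+1%:R.
pose F k l n j : set X := [set x | d (p j) x <= (4 * n.+1%:R)^-1] `&`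
  [set x | forall y, d y x < n.+1%:R^-1 -> phi y - phi x <= a k l * d y x].
have a0 k l : 0 <= a k l by rewrite divr_ge0.
have mF k l n j : measurable (F k l n j : set BX).
  apply: measurableI.
    by apply: measurable_set_le; apply: measurable_fun_lipschitz; exact: lipschitz_mdist.
  rewrite -[X in measurable X]setCK; apply: measurableC; apply: measurable_open.
  apply/open_mdistP => x /= /existsNP[y /not_implyP[yx /negP]]; rewrite -ltNge => ay.
  pose g z := phi y - phi z - a k l * d y z.
  have lg : Defs.lipschitz g.
    apply: lipschitzB; last by apply: lipschitzZ; exact: lipschitz_mdist.
    by apply: lipschitzB; [exact: lipschitz_cst|exists L].
  have g0 : 0 < g x by rewrite subr_gt0.
  have /open_mdistP/(_ x g0)[e1 e10 He1] := lipschitz_open_preimage 0 lg.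
  exists (Num.min e1 (n.+1%:R^-1 - d y x)); first by rewrite lt_min e10 subr_gt0.
  move=> z; rewrite lt_min => /andP[/He1 /= gz zx]; apply/existsNP; exists y; apply/not_implyP; split.
    by have := metric_triangle y x z; move: zx; rewrite ltrBrDl; exact: (fun h1 h2 => le_lt_trans h2 h1).
  by apply/negP; rewrite -ltNge -subr_gt0.
have phiF k l n j x y : F k l n j x -> F k l n j y -> `|phi x - phi y| <= a k l * d x y.
  move=> [/= px Hx] [/= py Hy].
  have xy : d x y < n.+1%:R^-1.
    have := metric_triangle x (p j) y; rewrite (metric_sym x (p j)) => /le_lt_trans; apply.
    apply: (le_lt_trans (lerD px py)); rewrite invfM; have : 0 < n.+1%:R^-1 :> R by rewrite invr_gt0.
    by move: (n.+1%:R^-1) => q; lra.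
  rewrite ler_norml lerNl opprB; apply/andP; split.
    by rewrite metric_sym; apply: Hx; rewrite metric_sym.
  exact: Hy.
have H k l n j := min_relaxed_slope_le_on L0 phiL (a0 k l) (mF k l n j) (@phiF k l n j) mG.
have H' : {ae m, forall x : BX, forall k l n j, F k l n j x -> G x <= a k l}.
  by do 4 (apply: ae_foralln => ?); exact: H.
have FF := ae_filter_ringOfSetsType m.
apply: filterS H' => x Hx; set S := fine _; rewrite leNgt; apply/negP => SG.
have S0 : 0 <= S by rewrite fine_ge0// asc_slope_ge0.
have GS : 0 < G x - S by rewrite subr_gt0.
have [l _ /(_ l (leqnn l)) /= Hl] := near_infty_natSinv_lt (PosNum GS).
(* As [1 / (l + 1)] is smaller than the gap [G x - S], the fraction [(k + 1) / (l + 1)] lies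
   strictly between [S] and [G x]. *)
pose k := Num.truncn (S * l.+1%:R).
have Sl0 : 0 <= S * l.+1%:R by rewrite mulr_ge0.
have /andP[k1 k2] := truncn_itv Sl0; rewrite -/k in k1 k2.
have Sa : S < a k l by rewrite /a ltr_pdivlMr.
have aG : a k l < G x.
  have h : k%:R / l.+1%:R <= S by rewrite ler_pdivrMr.
  have E : a k l = k%:R / l.+1%:R + l.+1%:R^-1 by rewrite /a -(@natr1 R k) mulrDl mul1r.
  by rewrite E (le_lt_trans (y := S + l.+1%:R^-1)) ?lerD2r// -ltrBrDl.
have aS : 0 < a k l - S by rewrite subr_gt0.
have [r r0 Hr] := asc_slope_eps (ltW L0) phiL x aS.
have [n _ /(_ n (leqnn n)) /= Hn] := near_infty_natSinv_lt (PosNum r0).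
have n40 : 0 < (4 * n.+1%:R)^-1 :> R by rewrite invr_gt0 mulr_gt0.
have [j Hj] := Hp x _ n40.
have : G x <= a k l.
  apply: (Hx k l n j); split; first exact: ltW.
  by move=> y yx; have := Hr y (lt_trans yx Hn); rewrite -/S subrKC.
by rewrite leNgt aG.
Qed.

End slope_comparison.

(** * Null sets, weak limits and upper gradients along plans *)

Section plan_upper_gradients.
Context {R : realType} {X : pmetricType R}.
Local Notation d := (@mdist R X).
Local Notation BX := (@BX R X).
Local Notation Curves := (@Curves R X).
Local Notation T := (measurableTypeR R).
Hypothesis cX : compact [set: X].
Variable m : probability BX R.

Let i0 : 0 <= (0 : R) <= 1. Proof. by rewrite lexx ler01. Qed.

(** The law of [flow t] is at most [C m], so almost no pair of a geodesic and a time meets an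
    [m]-null set. *)
Lemma plan_upper_gradient_ae (phi : X -> R) (G G' : X -> \bar R) :
  measurable_fun setT (G : BX -> \bar R) -> measurable_fun setT (G' : BX -> \bar R) ->
  (forall x, 0 <= G x)%E -> (forall x, 0 <= G' x)%E ->
  {ae m, forall x : BX, (G x <= G' x)%E} ->
  plan_upper_gradient m phi G -> plan_upper_gradient m phi G'.
Proof.
move=> mG mG' G0 G'0 [N [mN N0 NG]] UG P C t C0 Pg PC t01.
apply: (le_trans (UG P C t C0 Pg PC t01)); have /andP[t0 _] := t01.
rewrite lee_wpmul2l ?lee_fin//; have mf := measurable_flow cX t01.
have mdd : measurable_fun setT (fun z : Curves * T => (d (ev 0 z.1) (ev 1 z.1))%:E).
  by apply/measurable_EFinP; exact: measurable_fun_dist01.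
apply: (@ge0_lower_integral_le _ _ _ _ (flow t @^-1` N)).
- by rewrite -[X in measurable X]setTI; exact: mf.
- have mfN : measurable (flow t @^-1` N : set (Curves * T)).
    by rewrite -[X in measurable X]setTI; exact: mf.
  apply/eqP; rewrite eq_le measure_ge0 andbT.
  have := integral_flow_le cX C0 Pg PC t01 (h := fun x => (\1_N x)%:E).
  have m1 : measurable_fun setT (fun x : BX => (\1_N x)%:E : \bar R).
    by apply/measurable_EFinP; exact: measurable_indic.
  have p1 (x : X) : (0 <= (\1_N x : R)%:E)%E by rewrite lee_fin indicE.
  have E1 : (\int[m]_x (\1_N x)%:E = 0)%E by rewrite integral_indic// setIT; exact: N0.
  have E2 : (\int[(P \x U01)%E]_z (\1_N (flow t z))%:E = (P \x U01)%E (flow t @^-1` N))%E.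
    transitivity (\int[(P \x U01)%E]_z (\1_(flow t @^-1` N) z)%:E)%E.
      by apply: eq_integral => z _; rewrite !indicE.
    by rewrite (@integral_indic _ _ R (P \x U01)%E setT measurableT _ mfN) setIT.
  by move=> /(_ m1 p1); rewrite E1 mule0 E2 => H; exact: H.
- by apply: emeasurable_funM => //; exact: measurableT_comp.
- by move=> z; rewrite mule_ge0// lee_fin mdist_ge0.
- by move=> z; rewrite mule_ge0// lee_fin mdist_ge0.
- move=> z Nz; rewrite lee_wpmul2r// ?lee_fin ?mdist_ge0//.
  by apply: contrapT => nG; apply: Nz; apply: NG.
Qed.

(** The law of the flow weighted by the length of the geodesic has a bounded density, hence one in
    L2. This rewrites integrals over the plan as pairings against which weak L2 convergence can be
    tested. *)
Lemma flow_density (P : probability Curves R) C t : 0 <= C ->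
  concentrated P (geodesic : set Curves) ->
  (forall t, 0 <= t <= 1 -> forall A : set BX, measurable A ->
    (P (ev t @^-1` A) <= C%:E * m A)%E) -> 0 <= t <= 1 ->
  exists rho : BX -> R, [/\ bmeas rho, forall x, 0 <= rho x &
    forall h : BX -> R, bmeas h -> (forall x, 0 <= h x) ->
      \int[(P \x U01)%E]_z (h (flow t z) * d (ev 0 z.1) (ev 1 z.1)) =
      \int[m]_x (h x * rho x)].
Proof.
move=> C0 Pg PC t01; pose dd (z : Curves * T) := d (ev 0 z.1) (ev 1 z.1).
have bdd : bmeas dd by exact: (bmeas_comp (@measurable_fst _ _ Curves T) (dist01_bmeas cX)).
have dd0 z : 0 <= dd z by exact: mdist_ge0.
have [D D0 dD] := mdist_bounded cX.
pose J := \int[(P \x U01)%E]_z dd z; have J0 : 0 <= J by exact: bint_ge0.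
have mf := measurable_flow cX t01.
(* If the mean length is 0, the weight cannot be normalised to a probability; the integrals vanish
   and the density is 0. *)
move: J0; rewrite le_eqVlt => /orP[/eqP J0|J0].
  exists (fun=> 0); split => // [|h bh h0]; first exact: bmeas_cst.
  under [RHS]eq_Rintegral do rewrite mulr0.
  rewrite bint_cst; apply/eqP; rewrite eq_le; apply/andP; split; last first.
    by apply: bint_ge0 => z; rewrite mulr_ge0 ?mdist_ge0.
  have [mh [M hM]] := bh; have bhf := flow_bmeas cX t01 bh.
  rewrite -[leRHS](mulr0 M) [X in M * X]J0 -bintZ//.
  apply: bint_le; [exact: bmeasM|exact: bmeasZ|move=> z].
  by apply: ler_wpM2r; [exact: mdist_ge0|exact: le_trans (ler_norm _) (hM _)].
have bf : bmeas (fun z => J^-1 * dd z) by exact: bmeasZ.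
have f0 z : 0 <= J^-1 * dd z by rewrite mulr_ge0// invr_ge0 ltW.
have f1 : (\int[(P \x U01)%E]_z (J^-1 * dd z)%:E = 1)%E.
  have -> : (\int[(P \x U01)%E]_z (J^-1 * dd z)%:E = (\int[(P \x U01)%E]_z (J^-1 * dd z))%R%:E)%E.
    exact: bmeas_EFin.
  by rewrite bintZ// -/J mulVf// gt_eqF.
have [mf' _] := bf.
have [Q0 [Q0E Q0f]] := density_probability (P := (P \x U01)%E) mf' f0 f1.
have [Q [QE Qf]] := pushforward_probability Q0 mf.
have Qh (h : BX -> R) : bmeas h -> (forall x, 0 <= h x) ->
    \int[(P \x U01)%E]_z (h (flow t z) * dd z) = J * \int[Q]_x h x.
  move=> bh h0; have [mh _] := bh; have bhf := flow_bmeas cX t01 bh; have [mhf _] := bhf.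
  have -> : \int[Q]_x h x = \int[(P \x U01)%E]_z (h (flow t z) * (J^-1 * dd z)).
    apply: EFin_inj; rewrite -(bmeas_EFin Q bh) Qf//; last first.
      exact/measurable_EFinP.
    have mhf' : measurable_fun setT (fun z : Curves * T => (h (flow t z))%:E).
      exact/measurable_EFinP.
    rewrite (Q0f _ mhf')//; last by move=> z; rewrite lee_fin.
    exact: (bmeas_EFin (P \x U01)%E (bmeasM bhf bf)).
  rewrite -bintZ; last exact: bmeasM.
  by apply: eq_Rintegral => z _; rewrite mulrCA (mulrA J) divff ?mul1r// gt_eqF.
pose B := D * C / J; have B0 : 0 <= B by rewrite divr_ge0 ?mulr_ge0// ltW.
have iB : m.-integrable setT (EFin \o (fun=> B) : BX -> \bar R).
  exact: finite_measure_integrable_cst.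
have [|rho [mrho rhoB Qrho]] := @exists_density_le _ BX R Q m (fun=> B) iB (fun=> B0).
  move=> A mA; rewrite integral_cst//=.
  have b1 := indic_bmeas mA; have bf1 := flow_bmeas cX t01 b1.
  have i1 x : 0 <= \1_A x :> R by rewrite indicE.
  have H : J * \int[Q]_x \1_A x <= D * (C * \int[m]_x \1_A x).
    rewrite -Qh//; apply: (@le_trans _ _ (\int[(P \x U01)%E]_z (D * \1_A (flow t z)))).
      apply: bint_le; [exact: bmeasM|exact: bmeasZ|move=> z].
      by rewrite mulrC; apply: ler_wpM2r; [exact: i1|exact: dD].
    rewrite bintZ// ler_wpM2l ?(ltW D0)// -lee_fin.
    rewrite EFinM -(bmeas_EFin m b1).
    have := integral_flow_le cX C0 Pg PC t01 (h := fun x => (\1_A x)%:E).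
    move=> /(_ _ (fun x => _)) K; apply: le_trans (K _ _).
    + by rewrite -(bmeas_EFin (P \x U01)%E bf1).
    + by apply/measurable_EFinP; case: b1.
    + by move=> x; rewrite lee_fin.
  have E (mu : probability BX R) : mu A = (\int[mu]_x \1_A x)%R%:E.
    by rewrite -(bmeas_EFin mu b1) integral_indic// setIT.
  have EQ := E Q; have Em := E m.
  suff : \int[Q]_x \1_A x <= B * \int[m]_x \1_A x.
    by rewrite -lee_fin EFinM -EQ -Em => h; exact: h.
  by rewrite /B mulrAC ler_pdivlMr// mulrC -mulrA.
have rho0 x : 0 <= rho x by case/andP: (rhoB x).
have brho : bmeas rho.
  by split => //; exists B => x; rewrite ger0_norm//; case/andP: (rhoB x).
exists (fun x => J * rho x); split => [|x|h bh h0].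
- exact: bmeasZ.
- by rewrite mulr_ge0// ltW.
- have [mh _] := bh; rewrite Qh//.
  under [RHS]eq_Rintegral do rewrite mulrCA.
  rewrite bintZ; last exact: bmeasM.
  congr (_ * _); apply: EFin_inj; rewrite -(bmeas_EFin Q bh) -(bmeas_EFin m (bmeasM bh brho)).
  rewrite (ge0_integral_density mrho rho0 Qrho)//; exact/measurable_EFinP.
Qed.

Lemma L2_int_le_ae (f g v : X -> R) : L2 m f -> L2 m g -> L2 m v -> (forall x, 0 <= v x) ->
  {ae m, forall x : BX, f x <= g x} -> \int[m]_x (f x * v x) <= \int[m]_x (g x * v x).
Proof.
move=> Lf Lg Lv v0 fg; have if_ := L2M_integrable Lf Lv; have ig := L2M_integrable Lg Lv.
rewrite -subr_ge0 -RintegralB//.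
have ih : m.-integrable setT (EFin \o (fun x : BX => g x * v x - f x * v x)).
  exact: (integrableB measurableT ig if_).
have mh := measurable_int _ ih; have mh' : measurable_fun setT (fun x : BX => g x * v x - f x * v x).
  exact/measurable_EFinP.
rewrite (_ : Rintegral _ _ _ = \int[m]_x `|g x * v x - f x * v x|); first exact: Rintegral_ge0.
rewrite /Rintegral; congr fine; apply: ae_eq_integral => //.
  by apply/measurable_EFinP; exact: measurableT_comp.
have FF := ae_filter_ringOfSetsType m.
by apply: filterS fg => x fgx _; rewrite ger0_norm// -mulrBl mulr_ge0// subr_ge0.
Qed.

(** The inequality holds for each [psi n], whose local Lipschitz constant dominates its ascending
    slope. Replacing [phi] by [psi n] at two times costs [2 C] times their L1 distance, and the
    slopes pass to the limit when tested against [rho]. *)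
Lemma relaxed_plan_upper_gradient (phi G G' : X -> R) : Defs.lipschitz phi ->
  relaxed_slope m phi G -> bmeas (G' : BX -> R) -> (forall x, 0 <= G' x) ->
  {ae m, forall x : BX, G x <= G' x} ->
  plan_upper_gradient m phi (fun x => (G' x)%:E).
Proof.
move=> lphi [LG [Gt [psi [LGt GtG lpsi psi0 psiG]]]] bG' G'0 GG' P C t C0 Pg PC t01.
have [rho [brho rho0 Hrho]] := flow_density C0 Pg PC t01.
have bdd : bmeas (fun z : Curves * T => d (ev 0 z.1) (ev 1 z.1)).
  exact: (bmeas_comp (@measurable_fst _ _ Curves T) (dist01_bmeas cX)).
have bG'f := flow_bmeas cX t01 bG'; have bphi := lipschitz_bmeas cX lphi.
have b0 := ev_bmeas cX i0 bphi; have bt := ev_bmeas cX t01 bphi.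
have /andP[t0 _] := t01.
rewrite (bmeas_EFin P (bmeasB b0 bt)); under eq_integral do rewrite -EFinM.
have -> : (\int[(P \x U01)%E]_z (G' (flow t z) * d (ev 0 z.1) (ev 1 z.1))%:E =
   (\int[(P \x U01)%E]_z (G' (flow t z) * d (ev 0 z.1) (ev 1 z.1)))%R%:E)%E.
  exact: (bmeas_EFin (P \x U01)%E (bmeasM bG'f bdd)).
rewrite -EFinM lee_fin Hrho//.
have Lrho := bmeas_L2 m brho.
have H1 : \int[m]_x (Gt x * rho x) <= \int[m]_x (G' x * rho x).
  apply: L2_int_le_ae => //; first exact: bmeas_L2.
  have FF := ae_filter_ringOfSetsType m.
  by apply: filterS2 GtG GG' => x; exact: le_trans.
apply: (@le_trans _ _ (t * \int[m]_x (Gt x * rho x))); last by rewrite ler_wpM2l.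
pose s n x := fine (lip_const (psi n) x).
have bs n : bmeas (s n : BX -> R) by exact: lip_const_bmeas.
have s0 n x : 0 <= s n x by rewrite fine_ge0// lip_const_ge0.
have cR : (fun n => t * \int[m]_x (s n x * rho x)) @ \oo --> t * \int[m]_x (Gt x * rho x).
  by apply: cvgMr; exact: weakL2_cvgP psiG LGt Lrho.
pose u n x := `|psi n x - phi x|.
have bu n : bmeas (u n : BX -> R).
  by apply: bmeas_norm; apply: bmeasB => //; exact: lipschitz_bmeas.
have cu : (fun n => 2 * (C * \int[m]_x (u n x * 1))) @ \oo --> 2 * (C * 0).
  apply: cvgMr; apply: cvgMr; apply: (L2_cvg0_weak (u := u)).
  - by move=> n; exact: bmeas_L2.
  - exact: bmeas_L2 (@bmeas_cst _ BX R 1).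
  - by rewrite /u; under eq_fun do under eq_integral do rewrite real_normK ?num_real//.
have marg n r : 0 <= r <= 1 -> \int[P]_g u n (ev r g) <= C * \int[m]_x (u n x * 1).
  move=> r01; have bur := ev_bmeas cX r01 (bu n).
  rewrite -lee_fin -(bmeas_EFin P bur) EFinM; under [in leRHS]eq_Rintegral do rewrite mulr1.
  rewrite -(bmeas_EFin m (bu n)).
  apply: (integral_marginal_le cX C0 PC (h := fun x => (u n x)%:E) r01).
  - by apply/measurable_EFinP; case: (bu n).
  - by move=> x; rewrite lee_fin; exact: normr_ge0.
have H n : \int[P]_g (phi (ev 0 g) - phi (ev t g)) <=
    t * \int[m]_x (s n x * rho x) + 2 * (C * \int[m]_x (u n x * 1)).
  have bpsi := lipschitz_bmeas cX (lpsi n).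
  have bp0 := ev_bmeas cX i0 bpsi; have bpt := ev_bmeas cX t01 bpsi.
  have bu0 := ev_bmeas cX i0 (bu n); have but := ev_bmeas cX t01 (bu n).
  have h1 : \int[P]_g (phi (ev 0 g) - phi (ev t g)) <=
      \int[P]_g ((psi n (ev 0 g) - psi n (ev t g)) + (u n (ev 0 g) + u n (ev t g))).
    apply: bint_le; [exact: bmeasB|by apply: bmeasD; [exact: bmeasB|exact: bmeasD]|move=> g].
    rewrite /u; have := ler_norm (- (psi n (ev 0 g) - phi (ev 0 g))); rewrite normrN.
    have := ler_norm (psi n (ev t g) - phi (ev t g)); lra.
  apply: (le_trans h1); rewrite bintD; [|exact: bmeasB|exact: bmeasD].
  apply: lerD; last by rewrite bintD// mulr2n mulrDl mul1r lerD// marg.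
  have [Lf Lf0 fL] := lipschitz_gt0 (lpsi n).
  have UG := weak_ug_plan_upper_gradient cX (lpsi n) (weak_ug_asc_slope Lf0 fL m).
  rewrite -Hrho// -lee_fin -(bmeas_EFin P (bmeasB bp0 bpt)).
  apply: (le_trans (UG P C t C0 Pg PC t01)); rewrite EFinM lee_wpmul2l ?lee_fin//.
  rewrite -[leRHS](bmeas_EFin (P \x U01)%E (bmeasM (flow_bmeas cX t01 (bs n)) bdd)).
  apply: ge0_le_lower_integral => z _; first by rewrite mule_ge0 ?asc_slope_ge0// lee_fin mdist_ge0.
  rewrite EFinM lee_wpmul2r ?lee_fin ?mdist_ge0// /s (lip_constK (ltW Lf0) fL).
  exact: asc_slope_le_lip_const.
have cS : (fun n => t * \int[m]_x (s n x * rho x) + 2 * (C * \int[m]_x (u n x * 1))) @ \oo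
    --> t * \int[m]_x (Gt x * rho x) + 2 * (C * 0) by exact: cvgD cR cu.
rewrite !mulr0 addr0 in cS.
by apply: (cvgr_to_ge cS); apply: nearW => n; exact: H.
Qed.

End plan_upper_gradients.

(** * Slopes of Kantorovich potentials *)

Lemma measurable_fun_invr d (T : measurableType d) (R : realType) (f : T -> R) :
  measurable_fun setT f -> (forall x, 0 <= f x) -> measurable_fun setT (fun x => (f x)^-1).
Proof.
move=> mf f0; apply: measurable_fun_gt => a.
have [a0|a0] := ltP a 0.
  rewrite (_ : [set _ | _] = setT)//; apply/seteqP; split => // x _ /=.
  by rewrite (lt_le_trans a0)// invr_ge0.
rewrite (_ : [set _ | _] = [set x | - f x < 0] `&` [set x | a * f x < 1]).
  by apply: measurableI; apply: measurable_set_lt; [exact: measurableT_comp|exact: measurable_funM].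
apply/seteqP; split => x /=; rewrite oppr_lt0.
  have := f0 x; rewrite le_eqVlt => /orP[/eqP<-|fx]; first by rewrite invr0 ltNge a0.
  by split => //; rewrite -ltr_pdivlMr// div1r.
by move=> [fx]; rewrite -ltr_pdivlMr// div1r.
Qed.

Section kantorovich.
Context {R : realType} {X : pmetricType R}.
Local Notation d := (@mdist R X).
Local Notation BX := (@BX R X).
Local Notation Curves := (@Curves R X).
Local Notation T := (measurableTypeR R).
Hypothesis cX : compact [set: X].
Variables (K : R) (m : probability BX R) (f0 f1 : X -> R).
Variables (mu0 mu1 : probability BX R) (phi : X -> R).
Hypothesis scd : strongCD m K.
Hypothesis pf0 : prob_density m f0.
Hypothesis pf1 : prob_density m f1.
Hypothesis mu0E : forall A : set BX, measurable A -> mu0 A = (\int[m]_(x in A) (f0 x)%:E)%E.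
Hypothesis mu1E : forall A : set BX, measurable A -> mu1 A = (\int[m]_(x in A) (f1 x)%:E)%E.
Hypothesis pot : kantorovich_potential mu0 mu1 phi.

Local Notation W := (W2 mu0 mu1).
Local Notation s := (fun x : X => fine (asc_slope phi x)).

Let i0 : 0 <= (0 : R) <= 1. Proof. by rewrite lexx ler01. Qed.
Let i1 : 0 <= (1 : R) <= 1. Proof. by rewrite lexx ler01. Qed.
Let lphi := potential_lipschitz cX pot.
Let bs := asc_slope_bmeas lphi.
Let s0 x : 0 <= s x. Proof. by rewrite fine_ge0// asc_slope_ge0. Qed.
Let sE x : asc_slope phi x = (s x)%:E.
Proof. by have [L L0 phiL] := lipschitz_gt0 lphi; rewrite (asc_slopeK (ltW L0) phiL). Qed.

Lemma ae_density (A : set BX) : {ae m, forall x : BX, A x} -> {ae mu0, forall x : BX, A x}.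
Proof.
move=> [N [mN N0 NA]]; exists N; split => //; rewrite mu0E//.
by have [mf0 _ _] := pf0; apply: null_set_integral => //; apply/measurable_EFinP; exact: measurable_funTS.
Qed.

Lemma ae_geoopt (P : probability Curves R) (A : set BX) : GeoOpt mu0 mu1 P ->
  {ae mu0, forall x : BX, A x} -> {ae P, forall g : Curves, A (ev 0 g)}.
Proof.
move=> [_ PE _] [N [mN N0 NA]]; exists (ev 0 @^-1` N); split.
- exact: (measurable_ev_preimage cX).
- by have [-> _] := PE N mN.
- by move=> g /NA.
Qed.

Lemma asc_slope_plan_upper_gradient : plan_upper_gradient m phi (fun x => (s x)%:E).
Proof.
have [L L0 phiL] := lipschitz_gt0 lphi.
have := weak_ug_plan_upper_gradient cX lphi (weak_ug_asc_slope L0 phiL m).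
by rewrite (_ : asc_slope phi = (fun x => (s x)%:E))//; apply/funext => x; exact: sE.
Qed.

Lemma W2_le (G : BX -> R) : bmeas G -> (forall x, 0 <= G x) ->
  plan_upper_gradient m phi (fun x => (G x)%:E) -> W <= \int[mu0]_x (G x) ^+ 2.
Proof.
move=> bG G0 UG; have := W2sq_le_upper_gradient cX scd pf0 pf1 mu0E mu1E pot bG G0 UG.
by rewrite (W2K cX pot) (bmeas_EFin mu0 (bmeas_sqr bG)) lee_fin.
Qed.

Lemma asc_slope_W2 : \int[mu0]_x (s x) ^+ 2 = W.
Proof.
apply/eqP; rewrite eq_le W2_le ?andbT//; last exact: asc_slope_plan_upper_gradient.
have := asc_slope_integral_le cX pot; rewrite (W2K cX pot).
under eq_integral do rewrite sE -EFinM.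
by rewrite (bmeas_EFin mu0 (bmeas_sqr bs)) lee_fin.
Qed.

(** The equality case of all the inequalities: the difference of the squares is nonnegative almost
    everywhere and its integral is at most 0. *)
Lemma ae_eq_of_sqr dT (Q : measurableType dT) (mu : probability Q R) (f g : Q -> R) :
  bmeas f -> bmeas g -> (forall x, 0 <= f x) -> (forall x, 0 <= g x) ->
  {ae mu, forall x, f x <= g x} -> \int[mu]_x (g x) ^+ 2 <= \int[mu]_x (f x) ^+ 2 ->
  {ae mu, forall x, f x = g x}.
Proof.
move=> bf bg f00 g0 fg H; have bf2 := bmeas_sqr bf; have bg2 := bmeas_sqr bg.
have bh := bmeasB bg2 bf2; have bn := bmeas_norm bh.
have FF := ae_filter_ringOfSetsType mu.
have fg2 : {ae mu, forall x, (f x) ^+ 2 <= (g x) ^+ 2}.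
  by apply: filterS fg => x fx; rewrite ler_sqr ?nnegrE.
have E : \int[mu]_x `|(g x) ^+ 2 - (f x) ^+ 2| = 0.
  apply/eqP; rewrite eq_le; apply/andP; split; last exact: bint_ge0.
  have : \int[mu]_x `|(g x) ^+ 2 - (f x) ^+ 2| <= \int[mu]_x ((g x) ^+ 2 - (f x) ^+ 2).
    by apply: bint_le_ae => //; apply: filterS fg2 => x h; rewrite ger0_norm// subr_ge0.
  by rewrite bintB// => /le_trans; apply; rewrite subr_le0.
apply: filterS (bint_eq0_ae bn (fun x => normr_ge0 _) E) => x /normr0_eq0/eqP.
by rewrite subr_eq0 eq_sym eqrXn2// => /eqP.
Qed.

Lemma ae_eq_asc_slope (G : BX -> R) : bmeas G -> (forall x, 0 <= G x) ->
  plan_upper_gradient m phi (fun x => (G x)%:E) -> {ae m, forall x : BX, G x <= s x} ->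
  {ae mu0, forall x : BX, G x = s x}.
Proof.
move=> bG G0 UG Gs; apply: ae_eq_of_sqr => //; first exact: (ae_density Gs).
by rewrite asc_slope_W2; exact: W2_le.
Qed.

Section optimal_plan.
Variable P : probability Curves R.
Hypothesis oP : GeoOpt mu0 mu1 P.

Local Notation dd := (fun g : Curves => d (ev 0 g) (ev 1 g)).

Lemma cost_W2 : \int[P]_g (dd g) ^+ 2 = W.
Proof.
have [_ _ PW] := oP; apply: EFin_inj; rewrite -(W2K cX pot) -PW.
by rewrite (bmeas_EFin P (bmeas_sqr (dist01_bmeas cX))).
Qed.

(** The cost of an optimal plan is exactly [W], so its defect is a nonnegative function of integral
    0. *)
Lemma ae_defect : {ae P, forall g : Curves, defect phi (ev 0 g, ev 1 g) = 0}.
Proof.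
have [Q [cQ Qf]] := geoopt_coupling cX oP; have be := defect_bmeas cX pot.
apply: bint_eq0_ae => //.
- exact: (bmeas_comp (measurable_ev_pair cX i0 i1) be).
- by move=> g; exact: (defect_ge0 cX pot).
rewrite -(Qf _ be); have := integral_cost cX pot cQ.
rewrite (Qf _ (bmeas_sqr (mdist_bmeas cX))) cost_W2; move: (Rintegral _ _ _) => I; lra.
Qed.

Lemma asc_slope_le_dist x z : defect phi (x, z) = 0 -> s x <= d x z.
Proof.
move=> e0; rewrite -lee_fin -sE; apply/lee_addgt0Pr => e e_0; rewrite -EFinD asc_slopeE.
have [M phiM] := potential_ubound cX pot.
(* The quotient exceeds [d x z] by at most [d y x / 2], which is below [e] on this ball. *)
apply: (slope_le (r := 2 * e)); [by rewrite addr_ge0 ?mdist_ge0// ltW|by rewrite mulr_gt0|].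
move=> y /andP[y0 yr]; have H := potential_slope x y z phiM.
rewrite /incr ge_max; apply/andP; split; last by rewrite mulr_ge0 ?addr_ge0 ?mdist_ge0// ltW.
apply: (le_trans H); have -> : d x z ^+ 2 / 2 - phi x - ctrans phi z = 0 by exact: e0.
by rewrite addr0 mulrC ler_pM2r// lerD2l ler_pdivrMr// mulrC ltW.
Qed.

(** One inequality is pointwise where the defect vanishes, and both functions have squares of
    integral [W]. *)
Lemma ae_dist_asc_slope : {ae P, forall g : Curves, s (ev 0 g) = d (ev 0 g) (ev 1 g)}.
Proof.
have FF := ae_filter_ringOfSetsType P.
apply: ae_eq_of_sqr.
- exact: (ev_bmeas cX i0 bs).
- exact: (dist01_bmeas cX).
- by move=> g; exact: s0.
- by move=> g; exact: mdist_ge0.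
- by apply: filterS ae_defect => g; exact: asc_slope_le_dist.
rewrite cost_W2 -asc_slope_W2; have [Q [cQ Qf]] := geoopt_coupling cX oP.
have bs2 := bmeas_sqr bs; have [<- _] := coupling_bint cQ bs2.
by rewrite (Qf _ (bmeas_comp (@measurable_fst _ _ BX BX) bs2)).
Qed.

End optimal_plan.

Lemma clip_bmeas (L : R) (G : X -> \bar R) : 0 <= L -> measurable_fun setT (G : BX -> \bar R) ->
  (forall x, 0 <= G x)%E -> bmeas (fun x : BX => fine (mine (G x) L%:E)).
Proof.
move=> L0 mG G0; split; first by apply: measurableT_comp => //; exact: measurable_mine.
exists L => x; have := G0 x; case: (G x) => [r| |]//=; rewrite ?lee_fin => r0.
  by rewrite -EFin_min/= ger0_norm ?le_min ?r0// ge_min lexx orbT.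
by rewrite ger0_norm.
Qed.

Lemma min_weak_ug_asc_slope (G : X -> \bar R) : min_weak_ug m phi G ->
  {ae mu0, forall x : BX, G x = (s x)%:E}.
Proof.
move=> [wG Gmin]; have [L L0 phiL] := lipschitz_gt0 lphi; have [mG G0 _] := wG.
have GS := Gmin _ (weak_ug_asc_slope L0 phiL m).
(* Minimality puts [G] below the ascending slope, hence below the Lipschitz constant [L], almost
   everywhere; clipping changes [G] on a null set only and makes it bounded. *)
pose G' x := fine (mine (G x) L%:E).
have FF := ae_filter_ringOfSetsType m.
have sL x : s x <= L by rewrite -lee_fin -sE; exact: asc_slope_le (ltW L0) phiL x.
have GG' x : (G x <= asc_slope phi x)%E -> G x = (G' x)%:E.
  rewrite sE => GsE; rewrite /G' min_l; last by apply: (le_trans GsE); rewrite lee_fin.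
  by rewrite fineK// ge0_fin_numE// (le_lt_trans GsE)// ltry.
have bG' := clip_bmeas (ltW L0) mG G0; have [mG' _] := bG'.
have G'0 x : 0 <= G' x by rewrite fine_ge0// le_min G0 lee_fin ltW.
have UG : plan_upper_gradient m phi (fun x => (G' x)%:E).
  apply: (plan_upper_gradient_ae cX mG _ G0) (weak_ug_plan_upper_gradient cX lphi wG).
  - exact/measurable_EFinP.
  - by move=> x; rewrite lee_fin.
  - by apply: filterS GS => x /GG' ->.
have E := ae_eq_asc_slope bG' G'0 UG.
have GE : {ae m, forall x : BX, G' x <= s x}.
  by apply: filterS GS => x h; rewrite -lee_fin -sE -(GG' x h).
have FF0 := ae_filter_ringOfSetsType mu0.
by apply: filterS2 (E GE) (ae_density GS) => x <- /GG'.
Qed.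

Lemma min_relaxed_slope_W2 (G : X -> R) : min_relaxed_slope m phi G ->
  W2sq mu0 mu1 = (\int[m]_x ((G x) ^+ 2 * f0 x)%:E)%E.
Proof.
move=> mG; have [[LG [Gt [psi [LGt GtG lpsi psi0 psiG]]]] _] := mG; have [rG _] := mG.
have [L L0 phiL] := lipschitz_gt0 lphi; have [mf0 f00 _] := pf0; have [mmG _] := LG.
have Gs := min_relaxed_slope_le_asc_slope cX lphi mG.
have sL x : s x <= L by rewrite -lee_fin -sE; exact: asc_slope_le (ltW L0) phiL x.
(* A relaxed slope is only an L2 function, whose sign and bound hold almost everywhere: it lies
   above [Gt], a weak limit of nonnegative slopes, and below the ascending slope. *)
pose G' x := Num.max 0 (Num.min (G x) L).
have bG' : bmeas (G' : BX -> R).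
  split; first by apply: measurable_maxr => //; exact: measurable_minr.
  exists L => x; rewrite /G' ger0_norm ?le_max ?lexx// ge_max ltW//=.
  by rewrite ge_min lexx orbT.
have G'0 x : 0 <= G' x by rewrite le_max lexx.
have FF := ae_filter_ringOfSetsType m.
have Gt0 : {ae m, forall x : BX, 0 <= Gt x}.
  apply: L2_ge0_ae => // v bv v0.
  apply: (cvgr_to_ge (weakL2_cvgP psiG LGt (bmeas_L2 m bv))); apply: nearW => n.
  by apply: bint_ge0 => x; rewrite mulr_ge0// fine_ge0// lip_const_ge0.
have G0 : {ae m, forall x : BX, 0 <= G x} by apply: filterS2 Gt0 GtG => x; exact: le_trans.
have GE : {ae m, forall x : BX, G x = G' x}.
  apply: filterS2 G0 Gs => x Gx Gsx; rewrite /G' min_l ?max_r//.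
  exact: le_trans Gsx (sL x).
have UG : plan_upper_gradient m phi (fun x => (G' x)%:E).
  apply: (relaxed_plan_upper_gradient cX lphi rG bG' G'0).
  by apply: filterS GE => x ->.
have G's : {ae m, forall x : BX, G' x <= s x}.
  by apply: filterS2 GE Gs => x <-.
have E := ae_eq_asc_slope bG' G'0 UG G's.
have bG'2 := bmeas_sqr bG'; have bs2 := bmeas_sqr bs.
rewrite (W2K cX pot) -asc_slope_W2 -(bmeas_EFin mu0 bs2).
have FF0 := ae_filter_ringOfSetsType mu0.
rewrite (_ : (\int[mu0]_x (s x ^+ 2)%:E)%E = (\int[mu0]_x (G' x ^+ 2)%:E)%E); last first.
  apply: ae_eq_integral => //; [by apply/measurable_EFinP; case: bs2|by apply/measurable_EFinP; case: bG'2|].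
  by apply: filterS E => x <-.
rewrite (ge0_integral_density mf0 f00 mu0E); last 2 first.
- by apply/measurable_EFinP; case: bG'2.
- by move=> x; rewrite lee_fin sqr_ge0.
apply: ae_eq_integral => //.
- apply: emeasurable_funM; last exact/measurable_EFinP.
  by apply/measurable_EFinP; case: bG'2.
- by apply/measurable_EFinP; apply: measurable_funM => //; exact: measurable_funX.
- by apply: filterS GE => x <- _.
Qed.

(** * Convergence of the difference quotients *)

Section difference_quotient.
Variables (P : probability Curves R) (C : R).
Hypothesis oP : GeoOpt mu0 mu1 P.
Hypothesis C0 : 0 <= C.
Hypothesis PC : forall t, 0 <= t <= 1 -> forall A : set BX, measurable A ->
  (P (ev t @^-1` A) <= C%:E * m A)%E.

Local Notation dd := (fun g : Curves => d (ev 0 g) (ev 1 g)).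
Let q t (g : Curves) := (phi (ev 0 g) - phi (ev t g)) / d (ev 0 g) (ev t g).
Let Pg : concentrated P (geodesic : set Curves). Proof. by case: oP. Qed.

Lemma quotient_bmeas t : 0 <= t <= 1 -> bmeas (q t).
Proof.
move=> t01; have bphi := lipschitz_bmeas cX lphi; have [L L0 phiL] := lipschitz_gt0 lphi.
have [m0 _] := ev_bmeas cX i0 bphi; have [mt _] := ev_bmeas cX t01 bphi; split.
  apply: measurable_funM; first exact: measurable_funB.
  by apply: measurable_fun_invr => [|g]; [exact: measurable_fun_mdist_ev|exact: mdist_ge0].
exists L => g; rewrite /q normrM normfV (ger0_norm (mdist_ge0 _ _)).
have := mdist_ge0 (ev 0 g) (ev t g); rewrite le_eqVlt => /orP[/eqP<-|h].
  by rewrite invr0 mulr0 ltW.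
by rewrite ler_pdivrMr.
Qed.

(** The drop of [phi] with vanishing defect, divided by [d(g_0, g_t) = t d]. Multiplication by one
    more [d] covers constant geodesics, where the quotient is 0 by convention. *)
Lemma ae_quotient_ge t : 0 <= t <= 1 -> 0 < t ->
  {ae P, forall g : Curves, (1 - t / 2) * (dd g) ^+ 2 <= q t g * dd g}.
Proof.
move=> t01 t0; have FF := ae_filter_ringOfSetsType P.
have [M phiM] := potential_ubound cX pot; have AG := ae_geodesic cX Pg.
apply: filterS2 (ae_defect oP) AG => g e0 gg.
have := potential_drop phiM gg t01.
have -> : d (g 0) (g 1) ^+ 2 / 2 - phi (g 0) - ctrans phi (g 1) = 0 by exact: e0.
rewrite subr0 /q; have -> : d (ev 0 g) (ev t g) = t * dd g by exact: geodesic_mdist0 gg t01.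
have := mdist_ge0 (ev 0 g) (ev 1 g); rewrite le_eqVlt => /orP[/eqP<- _|h H].
  by rewrite expr0n mulr0 mulr0.
have {}H : (dd g) ^+ 2 * (t - t ^+ 2 / 2) <= phi (ev 0 g) - phi (ev t g) by exact: H.
move: H h; rewrite /=; move: (d _ _) (_ - phi _) => D v H D0.
have -> : v / (t * D) * D = v / t by field; rewrite !gt_eqF.
by rewrite ler_pdivlMr// (_ : _ * _ * t = D ^+ 2 * (t - t ^+ 2 / 2))//; field.
Qed.

(** The upper gradient inequality bounds the quotient by the mean [c] of the slope up to time [t];
    the passage to squares is Jensen's inequality, obtained from the nonnegative integral of
    [(s - c)^2]. *)
Lemma ae_quotient_sqr_le t : 0 <= t <= 1 -> 0 < t ->
  {ae P, forall g : Curves, ((q t g) ^+ 2)%:E <= \int[U01]_u ((s (flow t (g, u))) ^+ 2)%:E}%E.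
Proof.
move=> t01 t0; have FF := ae_filter_ringOfSetsType P.
have [L L0 phiL] := lipschitz_gt0 lphi; have AG := ae_geodesic cX Pg.
have AU := ae_restr_upper_gradient cX Pg PC t01 (weak_ug_asc_slope L0 phiL m).
apply: filterS2 AG AU => g gg.
have mfl : measurable_fun setT (fun u : T => flow t (g, u)).
  by apply: (measurableT_comp (measurable_flow cX t01)); exact: measurable_pair1.
have bf : bmeas (fun u : T => s (flow t (g, u))) by exact: (bmeas_comp mfl bs).
have bf2 := bmeas_sqr bf.
under eq_integral do rewrite sE.
rewrite (bmeas_EFin U01 bf) (bmeas_EFin U01 bf2) -EFinM !lee_fin.
set c := Rintegral _ _ _ => H.
have c0 : 0 <= c by apply: bint_ge0 => u; exact: s0.
have qc : `|q t g| <= c.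
  rewrite /q; have -> : d (ev 0 g) (ev t g) = t * dd g by exact: geodesic_mdist0 gg t01.
  rewrite normrM normfV (ger0_norm (_ : 0 <= t * dd g)); last by rewrite mulr_ge0 ?mdist_ge0// ltW.
  have := mdist_ge0 (ev 0 g) (ev 1 g); rewrite le_eqVlt => /orP[/eqP h|h].
    by rewrite /= -h mulr0 invr0 mulr0.
  by rewrite ler_pdivrMr ?mulr_gt0// mulrC.
rewrite -(real_normK (num_real (q t g))).
apply: (@le_trans _ _ (c ^+ 2)); first by rewrite ler_sqr ?nnegrE.
have : 0 <= \int[U01]_u ((s (flow t (g, u)) - c) ^+ 2) by apply: bint_ge0 => u; exact: sqr_ge0.
have bc := @bmeas_cst _ T R (c ^+ 2).
rewrite (_ : Rintegral _ _ _ = \int[U01]_u (s (flow t (g, u)) ^+ 2 - (2 * c * s (flow t (g, u)) - c ^+ 2))); last first.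
  by apply: eq_Rintegral => u _; ring.
have b1 := bmeasZ (2 * c) bf.
rewrite bintB//; last exact: bmeasB.
rewrite bintB// bintZ// bint_cst -/c expr2; lra.
Qed.

Lemma quotient_sqr_integral_le t : 0 <= t <= 1 -> 0 < t ->
  \int[P]_g (q t g) ^+ 2 <= \int[(P \x U01)%E]_z (s (flow t z)) ^+ 2.
Proof.
move=> t01 t0; have bq2 := bmeas_sqr (quotient_bmeas t01).
have bf2 := flow_bmeas cX t01 (bmeas_sqr bs); have [mf2 _] := bf2.
rewrite -lee_fin -(bmeas_EFin P bq2) -[leRHS](bmeas_EFin (P \x U01)%E bf2).
have mF : measurable_fun setT (fun z : Curves * T => ((s (flow t z)) ^+ 2)%:E).
  exact/measurable_EFinP.
rewrite fubini_tonelli1//; last by move=> z; rewrite lee_fin sqr_ge0.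
apply: ae_ge0_le_integral => //.
- by move=> g _; rewrite lee_fin sqr_ge0.
- by apply/measurable_EFinP; case: bq2.
- by move=> g _; apply: integral_ge0 => u _; rewrite lee_fin sqr_ge0.
- by apply: measurable_fun_fubini_tonelli_F => // z; rewrite lee_fin sqr_ge0.
- have FF := ae_filter_ringOfSetsType P.
  by apply: filterS (ae_quotient_sqr_le t01 t0) => g h _.
Qed.

(** Almost everywhere the slope at [g_0] equals [d], so the integral is that of [q^2 - 2 q d + d^2].
    The bounds above give at most [(W + e) - 2 (1 - t / 2) W + W = e + t W]. *)
Lemma difference_quotient_cvg :
  (fun t => \int[P]_g ((q t g - s (ev 0 g)) ^+ 2)%:E)%E @ 0^'+ --> 0%E.
Proof.
have FF := ae_filter_ringOfSetsType P.
have bd := dist01_bmeas cX; have bd2 := bmeas_sqr bd; have bs0 := ev_bmeas cX i0 bs.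
have bD t : 0 <= t <= 1 -> bmeas (fun g => (q t g - s (ev 0 g)) ^+ 2).
  by move=> t01; apply: bmeas_sqr; apply: bmeasB => //; exact: quotient_bmeas.
have W0 : 0 <= W by rewrite -(cost_W2 oP); apply: bint_ge0 => g; exact: sqr_ge0.
have bound t e : 0 <= t <= 1 -> 0 < t ->
    \int[(P \x U01)%E]_z (s (flow t z)) ^+ 2 <= \int[P]_g (s (ev 0 g)) ^+ 2 + e ->
    \int[P]_g (q t g - s (ev 0 g)) ^+ 2 <= e + t * W.
  move=> t01 t0 He; have bq := quotient_bmeas t01; have bq2 := bmeas_sqr bq.
  have sW : \int[P]_g (s (ev 0 g)) ^+ 2 = W.
    rewrite -asc_slope_W2; have [Q [cQ Qf]] := geoopt_coupling cX oP.
    have bs2 := bmeas_sqr bs; have [<- _] := coupling_bint cQ bs2.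
    by rewrite (Qf _ (bmeas_comp (@measurable_fst _ _ BX BX) bs2)).
  rewrite sW in He; have Hq := le_trans (quotient_sqr_integral_le t01 t0) He.
  have b2q := bmeasZ 2 (bmeasM bq bd).
  apply: (@le_trans _ _ (\int[P]_g ((q t g) ^+ 2 - (2 * (q t g * dd g) - (dd g) ^+ 2)))).
    apply: bint_le_ae; [exact: bD|by apply: bmeasB => //; exact: bmeasB|].
    by apply: filterS (ae_dist_asc_slope oP) => g ->; rewrite le_eqVlt; apply/orP; left; apply/eqP; ring.
  rewrite bintB//; last exact: bmeasB.
  rewrite bintB// bintZ; last exact: bmeasM.
  have H1 : (1 - t / 2) * W <= \int[P]_g (q t g * dd g).
    rewrite -(cost_W2 oP) -bintZ//; apply: bint_le_ae; [exact: bmeasZ|exact: bmeasM|].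
    exact: ae_quotient_ge.
  rewrite (cost_W2 oP); move: Hq H1; move: (Rintegral _ _ _) (Rintegral _ _ _) => A B ? ?; lra.
apply/fine_cvgP; split.
  near=> t; have t01 : 0 <= t <= 1.
    by apply/andP; split; near: t; [exact: nbhs_right_ge|exact: nbhs_right_le].
  by rewrite (bmeas_EFin P (bD t t01)).
apply/cvgrPdist_le => e e0; have e20 : 0 < e / 2 by rewrite divr_gt0.
have [r r0 Hr] := flow_integral_cvg cX m (bmeas_sqr bs) (fun x => sqr_ge0 (s x)) C0 e20.
have W1 : 0 < W + 1 by rewrite ltr_wpDl.
have e2W : 0 < e / 2 / (W + 1) by rewrite divr_gt0.
near=> t; have t0 : 0 < t by near: t; exact: nbhs_right_gt.
have t01 : 0 <= t <= 1.
  by apply/andP; split; near: t; [exact: nbhs_right_ge|exact: nbhs_right_le].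
have tr : t <= r by near: t; exact: nbhs_right_le.
have tW : t * (W + 1) <= e / 2.
  by rewrite -ler_pdivlMr//; near: t; exact: nbhs_right_le.
rewrite /= (bmeas_EFin P (bD t t01)) /= sub0r normrN ger0_norm; last first.
  by apply: bint_ge0 => g; exact: sqr_ge0.
apply: (le_trans (bound t (e / 2) t01 t0 (Hr P t Pg PC t01 tr))).
by move: tW; rewrite mulrDr mulr1 => ?; lra.
Unshelve. all: by end_near. Qed.

End difference_quotient.

End kantorovich.

Theorem mainTheorem16 (R : realType) (X : pmetricType R) (K : R)
  (m : probability (@BX R X) R) (f0 f1 : X -> R)
  (mu0 mu1 : probability (@BX R X) R) (phi : X -> R) :
  compact [set: X] ->
  strongCD m K ->
  prob_density m f0 -> prob_density m f1 ->
  (forall A : set (@BX R X), measurable A -> mu0 A = (\int[m]_(x in A) (f0 x)%:E)%E) ->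
  (forall A : set (@BX R X), measurable A -> mu1 A = (\int[m]_(x in A) (f1 x)%:E)%E) ->
  kantorovich_potential mu0 mu1 phi ->
  [/\
    (* first claim: for every pi in GeoOpt, pi-a.e. d(g0,g1) = |D phi|_w(g0) = |D^+ phi|(g0) *)
    (forall P : probability (@Curves R X) R, GeoOpt mu0 mu1 P ->
       {ae P, forall g : @Curves R X,
          (mdist (ev 0 g) (ev 1 g))%:E = asc_slope phi (ev 0 g)} /\
       (forall G, min_weak_ug m phi G ->
          {ae P, forall g : @Curves R X, (mdist (ev 0 g) (ev 1 g))%:E = G (ev 0 g)})),
    (* second claim: W_2^2(f0 m, f1 m) = \int |D phi|_*^2 f0 dm *)
    (forall G, min_relaxed_slope m phi G ->
       W2sq mu0 mu1 = (\int[m]_x ((G x) ^+ 2 * f0 x)%:E)%E) &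
    (* third claim: L^2(pi) convergence of the difference quotients as t -> 0+ *)
    (Linf m f0 -> Linf m f1 ->
     forall P : probability (@Curves R X) R, GeoOpt mu0 mu1 P -> test_plan m P ->
       (fun t => \int[P]_g
          (((phi (ev 0 g) - phi (ev t g)) / mdist (ev 0 g) (ev t g)
            - fine (asc_slope phi (ev 0 g))) ^+ 2)%:E)%E
         @ 0^'+ --> 0%E)].
Proof.
move=> cX scd pf0 pf1 mu0E mu1E pot.
have lphi := potential_lipschitz cX pot; have [L L0 phiL] := lipschitz_gt0 lphi.
split=> [P oP|G mG|_ _ P oP [_ _ [C PC]]].
- have FF := ae_filter_ringOfSetsType P.
  have AD := ae_dist_asc_slope cX scd pf0 pf1 mu0E mu1E pot oP.
  split=> [|G mG].
    by apply: filterS AD => g <-; rewrite (asc_slopeK (ltW L0) phiL).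
  have AG := min_weak_ug_asc_slope cX scd pf0 pf1 mu0E mu1E pot mG.
  by apply: filterS2 (ae_geoopt cX oP AG) AD => g -> ->.
- exact: (min_relaxed_slope_W2 cX scd pf0 pf1 mu0E mu1E pot mG).
(* The density bound tested on the whole space reads [1 <= C]. *)
- have C0 : 0 <= C.
    have i0 : 0 <= (0 : R) <= 1 by rewrite lexx ler01.
    have := PC 0 i0 setT measurableT.
    rewrite preimage_setT probability_setT probability_setT mule1 lee_fin.
    exact: le_trans ler01.
  exact: (difference_quotient_cvg cX scd pf0 pf1 mu0E mu1E pot oP C0 PC).
Qed.
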